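(* Let $\kappa\ge84$ be a numerical constant and let $w$ be either the Bayesian weights (for some $\eta\in\mathbb N$) or the model selection weights, built from $\tilde f_k$ and the penalties $\mathrm{pen}_k=\kappa k\Lambda_k/n$, $1\le k\le n$; let $\tilde f_w=\sum_{k=1}^nw_k\tilde f_k$. Let $k_g:=\lfloor3(400)^2\|g\|_{\ell^1}^2\rfloor$. There is a finite constant $C>0$ depending only on $\kappa$ such that the following holds. (p) Assume there is $K\in\mathbb N_0$ with $1\ge b_{K-1}(f)>0$ and $b_K(f)=0$ (convention $b_{-1}(f):=1$). If $K=0$ set $c_f:=0$, otherwise $c_f:=\frac{4\kappa}{\|\Pi_0^\perp f\|^2b_{K-1}^2(f)}$. For $n\in\mathbb N$ let $k_n^\star:=\max\{k\in\{1,\dots,n\}:n>c_fk\Lambda_k\}$ if this set is non-empty and $k_n^\star:=\lceil k_g\log(2+n)\rceil$ otherwise. There is a finite constant $C_{f,\varphi}$ depending only on $f$ and $\varphi$ (and $\kappa$) such that for all $n\in\mathbb N$ $$\mathbb E^n_{f,\varphi}\|\tilde f_w-f\|^2\le C\|\Pi_0^\perp f\|^2\Big[n^{-1}\vee\exp\Big(\frac{-\lambda_{k_n^\star}k_n^\star}{k_g}\Big)\Big]+C_{f,\varphi}n^{-1}.$$ (np) Assume $b_k(f)>0$ for all $k\in\mathbb N$. There is a finite constant $C_{f,\varphi}$ depending only on $f$ and $\varphi$ (and $\kappa$) such that for all $n\in\mathbb N$ $$\mathbb E^n_{f,\varphi}\|\tilde f_w-f\|^2\le C[\|\Pi_0^\perp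 f\|^2\vee1]\,\mathcal R_n^{a}+C_{f,\varphi}n^{-1},\qquad\mathcal R_n^{a}:=\min_{1\le k\le n}\Big[b_k^2(f)\vee\frac{k\Lambda_k}{n}\vee\exp\Big(\frac{-\lambda_kk}{k_g}\Big)\Big].$$
   Context: Notation: $\mathbb N=\{1,2,\dots\}$, $\mathbb N_0=\mathbb N\cup\{0\}$, $a\vee b=\max(a,b)$. $L^2=L^2([0,1))$ is the space of square-integrable complex functions with norm $\|\cdot\|$ and inner product $\langle h,h'\rangle=\int h\overline{h'}$; $e_j(x)=\exp(-2\pi\iota jx)$ with $\iota^2=-1$, and $h_j:=\langle h,e_j\rangle$, $j\in\mathbb Z$. $\mathcal D$ is the set of real-valued Lebesgue probability densities on $[0,1)$ lying in $L^2$. $\Pi_k$ is the orthogonal projection of $L^2$ onto $\mathrm{span}\{e_j:-k\le j\le k\}$, $\Pi_k^\perp$ the projection onto its orthogonal complement, and $b_k(p):=\|\Pi_k^\perp p\|/\|\Pi_0^\perp p\|$ with $0/0=0$. Model: $f,\varphi\in\mathcal D$ with $\varphi_j\ne0$ for all $j\in\mathbb Z$; $g=f\circledast\varphi$ is the circular convolution on $[0,1)$, so $g_j=f_j\varphi_j$; $\|g\|_{\ell^1}:=\sum_{j\in\mathbb Z}|g_j|$. The error density $\varphi$ is known, and $Y_1,\dots,Y_n$ are i.i.d. with density $g$; $\mathbb E^n_{f,\varphi}$ is the expectation under their joint law. For $k\in\mathbb N_0$: $v_k:=|\varphi_k|^{-2}$, $v_{(k)}:=\max_{0\le j\le k}v_j$,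 $\lambda_k:=\frac{|\log(kv_{(k)}\vee(k+2))|^2}{|\log(k+2)|^2}$, $\Lambda_k:=\lambda_kv_{(k)}$, and $\mathrm{pen}_k:=\kappa k\Lambda_k/n$. Estimators: $\hat g_j:=n^{-1}\sum_{i=1}^ne_j(-Y_i)$, $\tilde f_k:=e_0+\sum_{1\le|j|\le k}\varphi_j^{-1}\hat g_je_j$. Weights: Bayesian weights $w_k:=\frac{\exp(-\eta n\{-\|\tilde f_k\|^2+\mathrm{pen}_k\})}{\sum_{l=1}^n\exp(-\eta n\{-\|\tilde f_l\|^2+\mathrm{pen}_l\})}$; model selection weights $w_k:=\mathbf 1\{k=\tilde k\}$ with $\tilde k$ the smallest minimiser of $k\mapsto-\|\tilde f_k\|^2+\mathrm{pen}_k$ over $\{1,\dots,n\}$. *)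

(* Defs.v *)
From HB Require Import structures.
From mathcomp Require Import all_boot all_order all_algebra.
From mathcomp Require Import all_classical all_reals all_analysis.
From mathcomp Require Import complex.
Set Implicit Arguments.
Unset Strict Implicit.
Unset Printing Implicit Defensive.
Import Order.TTheory GRing.Theory Num.Theory.
Import numFieldNormedType.Exports.
Local Open Scope classical_set_scope.
Local Open Scope ring_scope.
Local Open Scope complex_scope.

(* Functions on [0,1) are represented by functions on R of which only the
   restriction to [0,1) is ever used; [cabs] is the modulus as a real number. *)

Notation cabs := ComplexField.Normc.normc.

Section L2.
Context {R : realType}.
Local Notation mu := (@lebesgue_measure R).

Definition unit_itv : set R := [set x | 0 <= x < 1].

Definition toC (f : R -> R) : R -> R[i] := fun x => (f x)%:C.

Definition cintegral (h : R -> R[i]) : R[i] :=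
  (\int[mu]_(x in unit_itv) complex.Re (h x))
    +i* (\int[mu]_(x in unit_itv) complex.Im (h x)).

Definition in_L2 (h : R -> R[i]) : Prop :=
  [/\ measurable_fun unit_itv (fun x => complex.Re (h x)),
      measurable_fun unit_itv (fun x => complex.Im (h x)) &
      (\int[mu]_(x in unit_itv) (cabs (h x) ^+ 2)%:E < +oo)%E].

Definition inner (h h' : R -> R[i]) : R[i] := cintegral (fun x => h x * (h' x)^*).

Definition L2norm (h : R -> R[i]) : R :=
  Num.sqrt (\int[mu]_(x in unit_itv) (cabs (h x) ^+ 2)).

(* e_j(x) = exp(-2 pi i j x), written with Euler's formula *)
Definition e_ (j : int) : R -> R[i] :=
  fun x => cos (- (2 * pi * j%:~R * x)) +i* sin (- (2 * pi * j%:~R * x)).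

Definition coef (h : R -> R[i]) (j : int) : R[i] := inner h (e_ j).

(* the integers -k, ..., k *)
Definition freqs (k : nat) : seq int := [seq i%:Z - k%:Z | i <- iota 0 k.*2.+1].

Definition trig_span (k : nat) : set (R -> R[i]) :=
  [set p | exists a : int -> R[i], p = fun x => \sum_(j <- freqs k) a j * e_ j x].

(* The orthogonal projection of h onto the subspace S: the p in S such that
   h - p is orthogonal to S.  For h in L^2 and S = trig_span k it exists and is
   unique, so that the default value h is not used. *)
Definition orthproj (S : set (R -> R[i])) (h : R -> R[i]) : R -> R[i] :=
  xget h [set p | S p /\ forall s, S s -> inner (fun x => h x - p x) s = 0].

Definition Pi_ (k : nat) (h : R -> R[i]) : R -> R[i] := orthproj (trig_span k) h.

Definition Pi_perp (k : nat) (h : R -> R[i]) : R -> R[i] :=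
  fun x => h x - Pi_ k h x.

(* x / 0 = 0 in MathComp, in agreement with the convention 0 / 0 = 0 *)
Definition b_ (k : nat) (p : R -> R[i]) : R :=
  L2norm (Pi_perp k p) / L2norm (Pi_perp 0 p).

(* b_(K-1), with the convention b_(-1) = 1 *)
Definition b_pred (K : nat) (p : R -> R[i]) : R :=
  if K is K'.+1 then b_ K' p else 1.

Definition density_L2 (f : R -> R) : Prop :=
  [/\ measurable_fun unit_itv f,
      forall x, unit_itv x -> 0 <= f x,
      (\int[mu]_(x in unit_itv) (f x)%:E = 1)%E &
      in_L2 (toC f)].

(* circular convolution: the argument y - s is taken modulo 1 *)
Definition cconv (f phi : R -> R) : R -> R :=
  fun y => \int[mu]_(s in unit_itv)
    (f (y - s - (Num.floor (y - s))%:~R) * phi s).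

(* the series is finite for the convolution of two densities in L^2 *)
Definition ell1norm (g : R -> R) : R :=
  fine (\esum_(j in [set: int]) (cabs (coef (toC g) j))%:E)%E.

Definition k_g (g : R -> R) : nat :=
  Num.truncn (3 * 400 ^+ 2 * ell1norm g ^+ 2).

End L2.

Section Model.
Context {R : realType} d (T : measurableType d) (P : probability T R) (n : nat).

Definition mutually_independent (Y : 'I_n -> {RV P >-> R}) : Prop :=
  forall (J : {set 'I_n}) (B : 'I_n -> set R), (forall i, measurable (B i)) ->
  (P (\bigcap_(i in [set i | i \in J]) (Y i @^-1` B i))
   = \prod_(i in J) P (Y i @^-1` B i))%E.

Definition iid_with_density (g : R -> R) (Y : 'I_n -> {RV P >-> R}) : Prop :=
  mutually_independent Y /\
  forall (i : 'I_n) (A : set R), measurable A ->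
  (distribution P (Y i) A
   = \int[@lebesgue_measure R]_(y in A `&` unit_itv) (g y)%:E)%E.

End Model.

Section Penalties.
Context {R : realType} (phi : R -> R).

Definition v_ (k : nat) : R := (cabs (coef (toC phi) k%:Z) ^+ 2)^-1.

Definition vmax (k : nat) : R := \big[Num.max/0]_(j < k.+1) v_ j.

Definition lambda_ (k : nat) : R :=
  ln (Num.max (k%:R * vmax k) (k + 2)%:R) ^+ 2 / ln (k + 2)%:R ^+ 2.

Definition Lambda_ (k : nat) : R := lambda_ k * vmax k.

Definition pen (kappa : R) (n k : nat) : R := kappa * k%:R * Lambda_ k / n%:R.

End Penalties.

Section Estimators.
Context {R : realType} (phi : R -> R) (n : nat).

(* y is the observed sample (Y_1, ..., Y_n) *)
Definition ghat (y : 'I_n -> R) (j : int) : R[i] :=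
  (n%:R)^-1 * \sum_(i < n) e_ j (- y i).

Definition ftilde (y : 'I_n -> R) (k : nat) : R -> R[i] :=
  fun x => e_ 0 x +
    \sum_(j <- freqs k | j != 0) (coef (toC phi) j)^-1 * ghat y j * e_ j x.

Definition contrast (kappa : R) (y : 'I_n -> R) (k : nat) : R :=
  - L2norm (ftilde y k) ^+ 2 + pen phi kappa n k.

End Estimators.

(* A weighting scheme maps n, the contrast k |-> -|f~_k|^2 + pen_k and
   k in {1, ..., n} to the weight w_k. *)
Section Weights.
Context {R : realType}.

Definition bayes_weights (eta n : nat) (c : nat -> R) (k : nat) : R :=
  expR (- (eta%:R * n%:R * c k)) /
  \sum_(1 <= l < n.+1) expR (- (eta%:R * n%:R * c l)).

(* smallest minimiser of c over {1, ..., n} *)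
Definition argmin (n : nat) (c : nat -> R) : nat :=
  head 0%N [seq k <- iota 1 n | all (fun l => c k <= c l) (iota 1 n)].

Definition ms_weights (n : nat) (c : nat -> R) (k : nat) : R :=
  (k == argmin n c)%:R.

Definition weight_scheme (w : nat -> (nat -> R) -> nat -> R) : Prop :=
  (exists2 eta : nat, (0 < eta)%N & w = bayes_weights eta) \/ w = ms_weights.

Definition ftilde_w (phi : R -> R) (kappa : R)
    (w : nat -> (nat -> R) -> nat -> R) (n : nat) (y : 'I_n -> R) : R -> R[i] :=
  fun x => \sum_(1 <= k < n.+1)
    (w n (contrast phi kappa y) k)%:C * ftilde phi y k x.

Definition loss (f phi : R -> R) (kappa : R)
    (w : nat -> (nat -> R) -> nat -> R) (n : nat) (y : 'I_n -> R) : R :=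
  L2norm (fun x => ftilde_w phi kappa w y x - toC f x) ^+ 2.

End Weights.

Section Rates.
Context {R : realType} (f phi : R -> R).
Local Notation g := (cconv f phi).

Definition exp_term (k : nat) : R :=
  expR (- (lambda_ phi k * k%:R) / (k_g g)%:R).

Definition c_f (kappa : R) (K : nat) : R :=
  if K == 0%N then 0
  else 4 * kappa / (L2norm (Pi_perp 0 (toC f)) ^+ 2 * b_pred K (toC f) ^+ 2).

Definition k_star (kappa : R) (K n : nat) : nat :=
  let s := [seq k <- iota 1 n | c_f kappa K * k%:R * Lambda_ phi k < n%:R] in
  if s is [::] then `|Num.ceil ((k_g g)%:R * ln (2 + n)%:R : R)|%N
  else \max_(k <- s) k.

Definition rate_term (n k : nat) : R :=
  Num.max (b_ k (toC f) ^+ 2)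
    (Num.max (k%:R * Lambda_ phi k / n%:R) (exp_term k)).

(* minimum over 1 <= k <= n, for 1 <= n *)
Definition rate_a (n : nat) : R :=
  \big[Num.min/rate_term n 1]_(1 <= k < n.+1) rate_term n k.

End Rates.

(* Main.v *)
(** By Parseval the loss of a trigonometric series splits over the frequencies,
and the noise of [ftilde k] is [|| ftilde k - Pi_ k f ||^2 = 2/n^2 N], where [N]
is the squared Euclidean norm of a sum of [n] independent centred vectors of
R^(2k).  Conditioning successively on the past, [exp (th * min N L)] has a
bounded expectation for suitable [th] and [L]; this gives a Talagrand-type tail
for [N], whence [E \sum_k (|| ftilde k - Pi_ k f ||^2 - pen k / 4)_+ = O(1/n)].

For both kinds of weights [w_l <= exp (- n (c_l - c_k))] whenever
[c_k <= c_l], [c] being the contrast.  Comparing [l] with a fixed [k], either the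
error of [ftilde l] is controlled by that of [ftilde k], or [w_l] is so small
that its contribution is negligible.  Hence for every [1 <= k <= n] the risk is
at most [10 pen k + 3 || f - Pi_ k f ||^2 + C/n].  In case (np) take for [k] the
minimiser of the rate; in case (p) take [k = min n (max K 1)], for which every
term is [O(1/n)]. *)

From HB Require Import structures.
Require Import Defs.
From mathcomp Require Import all_boot all_order all_algebra.
From mathcomp Require Import all_classical all_reals all_analysis.
From mathcomp Require Import measurable_realfun complex.
From mathcomp Require Import ring lra zify.
Set Implicit Arguments.
Unset Strict Implicit.
Unset Printing Implicit Defensive.
Import Order.TTheory GRing.Theory Num.Theory.
Import numFieldNormedType.Exports.
Local Open Scope classical_set_scope.
Local Open Scope ring_scope.
Local Open Scope complex_scope.

(** With [V = vmax phi k], the probabilistic part uses two properties of the centred vector formed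
    by the weighted cosines and sines of one observation. Its squared length is at most [4 k V], and
    its variance in a unit direction is at most a constant times [V], with no factor [k]. The second
    bound rests on the boundedness of [g]: a convolution of two square-integrable densities
    satisfies [g <= ||f||^2 + ||phi||^2]. The obstacle is that [V] may grow arbitrarily fast with
    [k] while the excesses of all [k <= n] must sum to [O(1/n)]. The deterministic bound of [N], of
    order [n^2 k V], has to be absorbed by a small probability. The origin of 84: in the scale of
    [N], the threshold [pen / 4] equals [kappa / 8] times [n k V lambda], and [84 / 8 = 21 / 2]
    exceeds the 8 in the price [exp (8 n k V th)] of the exponential moment. *)

Local Notation Re := complex.Re.
Local Notation Im := complex.Im.

(** * Conditioning on the past of an independent sequence *)

Section indep.
Context (R : realType) d (T : measurableType d) (P : probability T R).
Local Open Scope ereal_scope.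

(** Measurable rectangles are stable under intersection, generate the product sigma-algebra and
    include the whole space, where [m1] is finite; so uniqueness of measures applies with a constant
    exhausting sequence. *)
Lemma finite_measure_unique_prod d1 d2 (T1 : measurableType d1) (T2 : measurableType d2)
    (m1 m2 : {measure set (T1 * T2) -> \bar R}) :
  m1 setT < +oo ->
  (forall A B, measurable A -> measurable B -> m1 (A `*` B) = m2 (A `*` B)) ->
  forall X, measurable X -> m1 X = m2 X.
Proof.
move=> m1oo m12 X mX.
apply: (measure_unique [set A `*` B | A in measurable & B in measurable]
   (fun=> setT)) => //.
- by rewrite measurable_prod_measurableType.
- move=> _ _ [X1 mX1 [X2 mX2 <-]] [Y1 mY1 [Y2 mY2 <-]].
  by rewrite -setXI; exists (X1 `&` Y1); [exact: measurableI|
    exists (X2 `&` Y2); [exact: measurableI|]].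
- by move=> i; exists setT => //; exists setT => //; rewrite setXTT.
- by rewrite bigcup_const//; exists 0%N.
- by move=> _ [A mA [B mB <-]]; exact: m12.
Qed.

(** The state space of [m] observations as nested pairs. It is a dependent pair because the display
    changes with every product. *)
Fixpoint history (m : nat) : {d : measure_display & measurableType d} :=
  if m is m'.+1 then
    existT _ _ ((projT2 (history m') * (R : measurableType _))%type : measurableType _)
  else existT _ _ (unit : measurableType _).

Definition historyT m : measurableType _ := projT2 (history m).

Variable Y : nat -> {RV P >-> R}.

Fixpoint past (m : nat) (t : T) : historyT m :=
  if m is m'.+1 as m0 return historyT m0 then (past m' t, Y m' t) else tt.

Lemma measurable_past m : measurable_fun setT (past m).
Proof.
elim: m => [|m ih] /=; first exact: measurable_cst.
by apply: measurable_fun_pair => //; exact: measurable_funPT.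
Qed.

HB.instance Definition _ m :=
  isMeasurableFun.Build _ _ _ _ (past m) (@measurable_past m).

Variable n : nat.

(** Setting some of the [B i] to [setT] recovers the product formula for every subfamily of the
    first [n] variables. *)
Hypothesis indY : forall B : nat -> set R, (forall i, measurable (B i)) ->
  P (\bigcap_(i in `I_n) Y i @^-1` B i) = \prod_(i < n) P (Y i @^-1` B i).

Let future (B : nat -> set R) m := \bigcap_(i in [set i | (m <= i < n)%N]) Y i @^-1` B i.

Lemma futureS B m : (m < n)%N -> future B m = Y m @^-1` B m `&` future B m.+1.
Proof.
move=> mn; apply/seteqP; split=> t /=.
  move=> h; split; first by apply: h => /=; rewrite leqnn.
  by move=> i /= /andP[mi iN]; apply: h => /=; rewrite (ltnW mi).
move=> [h0 h] i /= /andP[mi iN]; move: mi; rewrite leq_eqVlt => /predU1P[<-//|mi].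
by apply: h => /=; rewrite mi.
Qed.

Lemma measurable_future B m : (forall i, measurable (B i)) -> measurable (future B m).
Proof.
move=> mB; rewrite /future; apply: bigcap_measurableType => i _.
by rewrite -[X in measurable X]setTI; exact: measurable_funPT.
Qed.

(** Induction on [m]. As functions of [A], both sides are finite measures: the law of the past under
    [P] restricted to the future event, and a multiple of the law of the past. By the induction
    hypothesis they agree on rectangles. *)
Lemma prob_past_future m (B : nat -> set R) (A : set (historyT m)) :
  (m <= n)%N -> (forall i, measurable (B i)) -> measurable A ->
  P (past m @^-1` A `&` future B m) =
  P (past m @^-1` A) * \prod_(m <= i < n) P (Y i @^-1` B i).
Proof.
elim: m A B => [|m ih] A B mn mB mA.
  have [->|->] : A = set0 \/ A = setT.
    have [At|At] := pselect (A tt); [right|left].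
      by apply/predeqP; case.
    by apply/predeqP; case.
  - by rewrite preimage_set0 set0I measure0 mul0e.
  - rewrite preimage_setT setTI probability_setT mul1e big_mkord -indY//; congr (P _).
have pfin (C : set T) : measurable C -> P C \is a fin_num.
  by move=> mC; exact: fin_num_measure.
have mYB i C : measurable C -> measurable (Y i @^-1` C).
  by move=> mC; rewrite -[X in measurable X]setTI; exact: measurable_funPT.
set p := \prod_(_ <= i < n) _.
have p0 : 0 <= p by rewrite /p; elim/big_ind: _ => // *; exact: mule_ge0.
have pE : p \is a fin_num.
  rewrite /p; elim/big_ind: _ => // [*|i _]; first by rewrite fin_numM.
  by apply: pfin; exact: mYB.
pose c : {nonneg R} := NngNum (fine_ge0 p0).
have cE : c%:num%:E = p by rewrite /= fineK.
have mF := measurable_future m.+1 mB.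
pose m1 := measure_function_pushforward__canonical__measure_function_Measure
  (mrestr P mF) (@measurable_past m.+1).
pose m2 := mscale c (distribution P (past m.+1)).
have rect (A1 : set (historyT m)) (B1 : set R) (C : nat -> set R) : measurable A1 -> measurable B1 ->
    (forall i, measurable (C i)) ->
    P (past m.+1 @^-1` (A1 `*` B1) `&` future C m.+1) =
    P (past m @^-1` A1) * P (Y m @^-1` B1) * \prod_(m.+1 <= i < n) P (Y i @^-1` C i).
  (* The last side of the rectangle is moved from the past to the future, where the induction
     hypothesis can see it. *)
  move=> mA1 mB1 mC; pose C' i := if i == m then B1 else C i.
  have mC' i : measurable (C' i) by rewrite /C'; case: ifP.
  have C'm : C' m = B1 by rewrite /C' eqxx.
  have C'i i : (m < i)%N -> C' i = C i by move=> mi; rewrite /C' gtn_eqF.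
  have -> : past m.+1 @^-1` (A1 `*` B1) `&` future C m.+1 =
      past m @^-1` A1 `&` future C' m.
    rewrite (futureS C')// C'm setIA; congr (_ `&` _).
    by rewrite /future; apply: eq_bigcapr => i /= /andP[mi _]; rewrite C'i.
  rewrite ih ?(ltnW mn)// big_ltn// C'm muleA; congr (_ * _).
  by apply: eq_big_nat => i /andP[mi _]; rewrite C'i.
have -> : P (past m.+1 @^-1` A `&` future B m.+1) = m1 A by [].
have -> : P (past m.+1 @^-1` A) * p = m2 A by rewrite /m2 /mscale cE muleC.
apply: finite_measure_unique_prod => //.
  have -> : m1 setT = P (past m.+1 @^-1` setT `&` future B m.+1) by [].
  rewrite preimage_setT setTI ltey_eq.
  by rewrite pfin.
move=> A1 B1 mA1 mB1.
have -> : m1 (A1 `*` B1) =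
  P (past m.+1 @^-1` (A1 `*` B1) `&` future B m.+1) by [].
rewrite [RHS](_ : _ = c%:num%:E * P (past m.+1 @^-1` (A1 `*` B1)))//.
rewrite cE muleC rect//; congr (_ * _).
have := rect A1 B1 (fun=> setT) mA1 mB1 (fun=> measurableT).
have -> : future (fun=> setT) m.+1 = setT by rewrite -subTset => t _ i _.
rewrite setIT => ->.
by rewrite big1 ?mule1// => i _; rewrite preimage_setT probability_setT.
Qed.

Lemma law_past_next m : (m < n)%N -> forall A, measurable A ->
  (distribution P (past m) \x distribution P (Y m)) A =
  distribution P (past m.+1) A.
Proof.
move=> mn; apply: product_measure_unique => A B mA mB.
pose C i := if i == m then B else setT.
have mC i : measurable (C i) by rewrite /C; case: ifP.
have Cm : C m = B by rewrite /C eqxx.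
have Ci i : (m < i)%N -> C i = setT by move=> mi; rewrite /C gtn_eqF.
rewrite [LHS](_ : _ = P (past m.+1 @^-1` (A `*` B)))//.
have -> : past m.+1 @^-1` (A `*` B) = past m @^-1` A `&` future C m.
  rewrite (futureS C)// Cm setIA.
  rewrite [future _ _](_ : _ = setT) ?setIT// -subTset => t _ i /= /andP[mi _].
  by rewrite Ci.
rewrite prob_past_future ?(ltnW mn)// big_ltn// Cm.
rewrite big_nat big1 ?mule1// => i /andP[mi _].
by rewrite Ci// preimage_setT probability_setT.
Qed.

(** This replaces conditioning on the past: the fresh observation is integrated out under its own
    law while the past stays frozen. It is Tonelli for the product law of [past m] and [Y m]. *)
Lemma integral_past_next m (F : historyT m * R -> \bar R) :
  (m < n)%N -> measurable_fun setT F -> (forall x, 0 <= F x) ->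
  \int[P]_t F (past m t, Y m t) =
  \int[P]_t \int[distribution P (Y m)]_y F (past m t, y).
Proof.
move=> mn mF F0.
have mXY : measurable_fun setT (fun t => (past m t, Y m t)).
  by apply: measurable_fun_pair => //; exact: measurable_funPT.
transitivity (\int[pushforward P (past m.+1)]_z F z).
  by rewrite (ge0_integral_pushforward mXY)//; apply: eq_integral.
transitivity (\int[distribution P (past m) \x distribution P (Y m)]_z F z).
  by apply: eq_measure_integral => A mA _; exact: esym (law_past_next mn mA).
rewrite fubini_tonelli1// [LHS](ge0_integral_pushforward (@measurable_past m))//.
- exact: measurable_fun_fubini_tonelli_F.
- by move=> y _; exact: integral_ge0.
Qed.

End indep.

(** * Exponential moments of the norm of a sum *)

(** Since [exp (- u) >= 1 - u] and the quadratic is nonnegative, it suffices that the quadratic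
    times [1 - u] is at least 1; that product is [1 + u^2 (1 - 2 u)]. *)
Lemma expR_le_quadratic (R : realType) (u : R) :
  `|u| <= 2^-1 -> expR u <= 1 + u + 2 * u ^+ 2.
Proof.
rewrite ler_norml => /andP[u1 u2].
have h : 1 - u <= expR (- u) by have := expR_ge1Dx (- u).
have e0 := expR_gt0 u.
rewrite -(ler_pM2r (_ : 0 < expR (- u))) ?expR_gt0// expRN mulfV ?gt_eqF//.
rewrite -expRN; apply: le_trans (_ : (1 + u + 2 * u ^+ 2) * (1 - u) <= _); last first.
  by apply: ler_wpM2l => //; nra.
have -> : (1 + u + 2 * u ^+ 2) * (1 - u) = 1 + u ^+ 2 * (1 - 2 * u) by ring.
by rewrite lerDl mulr_ge0 ?sqr_ge0//; lra.
Qed.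

(** The quadratic [A x^2 + 2 C x + B] is a sum of squares. It is evaluated at its minimiser, or, if
    [A = 0], at a point where the linear function would be negative unless [C = 0]. *)
Lemma sum_sqr_CS (R : realType) (I : finType) (a b : I -> R) :
  (\sum_i a i * b i) ^+ 2 <= (\sum_i a i ^+ 2) * (\sum_i b i ^+ 2).
Proof.
set A := \sum_i a i ^+ 2; set B := \sum_i b i ^+ 2; set C := \sum_i a i * b i.
have A0 : 0 <= A by apply: sumr_ge0 => i _; exact: sqr_ge0.
have h x : 0 <= A * x ^+ 2 + 2 * C * x + B.
  have -> : A * x ^+ 2 + 2 * C * x + B = \sum_i (a i * x + b i) ^+ 2.
    rewrite /A /B /C mulr_suml -mulrA mulr_suml mulr_sumr -!big_split/=.
    by apply: eq_bigr => i _; ring.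
  by apply: sumr_ge0 => i _; exact: sqr_ge0.
move: A0; rewrite le_eqVlt => /predU1P[A0|A0].
  have [->|C0] := eqVneq C 0; first by rewrite -A0 mul0r expr0n.
  have := h (- (B + 1) / (2 * C)); rewrite -A0 mul0r add0r.
  have -> : 2 * C * (- (B + 1) / (2 * C)) = - (B + 1) by field.
  by move=> ?; exfalso; lra.
have := h (- C / A).
have -> : A * (- C / A) ^+ 2 + 2 * C * (- C / A) + B = (A * B - C ^+ 2) / A.
  by field; rewrite gt_eqF.
by rewrite pmulr_lge0 ?invr_gt0// subr_ge0.
Qed.

Lemma integral_prob_cst (R : realType) d (T : measurableType d)
    (P : probability T R) (r : R) : (\int[P]_t r%:E = r%:E)%E.
Proof.
rewrite integral_cst// [X in (_ * X)%E](_ : _ = 1%E) ?mule1//.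
exact: probability_setT.
Qed.

Section step.
Context (R : realType) (G : probability R R).
Context (I : finType) (xi : I -> R -> R).
Hypothesis mxi : forall i, measurable_fun setT (xi i).

Let ip (s : I -> R) y := \sum_i s i * xi i y.

Lemma measurable_ip s : measurable_fun setT (ip s).
Proof.
by apply: measurable_sum => i; apply: measurable_funM => //; exact: measurable_cst.
Qed.

Variables (B tau : R).
Hypothesis xiB : forall y, \sum_i xi i y ^+ 2 <= B.
(** Centring and variance are merged into one condition. As [1 + x + 2 x^2] is always positive, only
    integrals of nonnegative functions occur. *)
Hypothesis xitau : forall s : I -> R,
  (\int[G]_y (1 + ip s y + 2 * ip s y ^+ 2)%:E <= (1 + tau * \sum_i s i ^+ 2)%:E)%E.

(* Truncating at [L] keeps the linear term [2 th <s, xi>] at most 1/2 in absolute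
   value, which is what [expR_le_quadratic] needs; if [|s|^2] exceeds [L], the bound
   is trivial.  Truncation thus plays the part of a stopping time. *)
Lemma mgf_step (th th' L : R) (s : I -> R) :
  0 <= th -> 0 <= L -> 0 <= tau -> th + 4 * th ^+ 2 * tau <= th' -> 16 * th ^+ 2 * L * B <= 1 ->
  (\int[G]_y (expR (th * Num.min (\sum_i (s i + xi i y) ^+ 2) L))%:E
   <= (expR (th * B) * expR (th' * Num.min (\sum_i s i ^+ 2) L))%:E)%E.
Proof.
move=> th0 L0 tau0 thth' thLB.
set N := \sum_i s i ^+ 2.
have N0 : 0 <= N by apply: sumr_ge0 => i _; exact: sqr_ge0.
have B0 : 0 <= B by apply: le_trans (xiB 0); apply: sumr_ge0 => i _; exact: sqr_ge0.
have mint : measurable_fun setT (fun y => (expR (th * Num.min (\sum_i (s i + xi i y) ^+ 2) L))%:E).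
  apply/measurable_EFinP; apply: measurableT_comp => //.
  apply: measurable_funM; first exact: measurable_cst.
  apply: measurable_minr; last exact: measurable_cst.
  apply: measurable_sum => i; apply: measurable_funX.
  by apply: measurable_funD => //; exact: measurable_cst.
have [NL|LN] := lerP N L; last first.
  apply: (@le_trans _ _ (\int[G]_y (expR (th * L))%:E)%E).
    apply: ge0_le_integral => //.
    by move=> y _; rewrite lee_fin ler_expR ler_wpM2l// ge_min lexx orbT.
  rewrite integral_prob_cst lee_fin -expRD ler_expR.
  apply: le_trans (_ : th' * L <= _); last by rewrite lerDr mulr_ge0.
  by apply: ler_wpM2r => //; apply: le_trans thth'; rewrite lerDl !mulr_ge0 ?sqr_ge0.
(* In [th |s + xi|^2 = th |s|^2 + 2 th <s, xi> + th |xi|^2] the middle term is the product of [xi]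
   with [s2]. *)
pose s2 i := 2 * th * s i.
have s2E : \sum_i s2 i ^+ 2 = 4 * th ^+ 2 * N.
  by rewrite mulr_sumr; apply: eq_bigr => i _; rewrite /s2; ring.
(* By Cauchy-Schwarz the square is at most [4 th^2 |s|^2 B]; with [|s|^2 <= L] the last hypothesis
   bounds this by [1/4]. *)
have small y : `|ip s2 y| <= 2^-1.
  rewrite -(ler_pXn2r (n := 2)) ?nnegrE//.
  rewrite real_normK ?num_real//.
  apply: (le_trans (sum_sqr_CS _ _)); rewrite s2E.
  apply: (@le_trans _ _ (4 * th ^+ 2 * L * B)).
    apply: ler_pM => //; first by rewrite !mulr_ge0 ?sqr_ge0.
      by apply: sumr_ge0 => i _; exact: sqr_ge0.
    by apply: ler_wpM2l => //; rewrite mulr_ge0 ?sqr_ge0.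
  have E : 2^-1 ^+ 2 - 4 * th ^+ 2 * L * B = 4^-1 * (1 - 16 * th ^+ 2 * L * B) :> R.
    by field.
  by rewrite -subr_ge0 E mulr_ge0 ?invr_ge0// subr_ge0.
pose K := expR (th * N + th * B).
have K0 : 0 <= K by exact: expR_ge0.
have quad0 y : 0 <= 1 + ip s2 y + 2 * ip s2 y ^+ 2.
  by have := small y; rewrite ler_norml => /andP[? ?]; have := sqr_ge0 (ip s2 y); lra.
have mquad : measurable_fun setT (fun y => (1 + ip s2 y + 2 * ip s2 y ^+ 2)%:E).
  apply/measurable_EFinP; apply: measurable_funD.
    by apply: measurable_funD; [exact: measurable_cst|exact: measurable_ip].
  apply: measurable_funM; first exact: measurable_cst.
  by apply: measurable_funX; exact: measurable_ip.
apply: (@le_trans _ _ (\int[G]_y (K%:E * (1 + ip s2 y + 2 * ip s2 y ^+ 2)%:E))%E).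
  apply: ge0_le_integral => //.
  - by apply: emeasurable_funM => //; exact: measurable_cst.
  - move=> y _; rewrite -EFinM lee_fin.
    apply: (@le_trans _ _ (K * expR (ip s2 y))); last first.
      by apply: ler_wpM2l => //; exact: expR_le_quadratic.
    rewrite /K -expRD ler_expR.
    apply: (@le_trans _ _ (th * \sum_i (s i + xi i y) ^+ 2)).
      by apply: ler_wpM2l => //; rewrite ge_min lexx.
    have -> : \sum_i (s i + xi i y) ^+ 2 =
       N + 2 * ip s y + \sum_i xi i y ^+ 2.
      by rewrite /N /ip mulr_sumr -!big_split/=; apply: eq_bigr => i _; ring.
    have -> : ip s2 y = 2 * th * ip s y.
      by rewrite /ip mulr_sumr; apply: eq_bigr => i _; rewrite /s2; ring.
    have := ler_wpM2l th0 (xiB y); lra.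
rewrite ge0_integralZl_EFin//; last by move=> y _; rewrite lee_fin.
apply: (@le_trans _ _ (K%:E * (1 + tau * \sum_i s2 i ^+ 2)%:E)%E).
  by apply: lee_wpmul2l; [rewrite lee_fin|exact: xitau].
rewrite -EFinM lee_fin.
apply: (@le_trans _ _ (K * expR (tau * \sum_i s2 i ^+ 2))).
  by apply: ler_wpM2l => //; exact: expR_ge1Dx.
rewrite /K -!expRD ler_expR s2E.
have := ler_wpM2r N0 thth'; lra.
Qed.
End step.

Section concentration.
Context (R : realType) d (T : measurableType d) (P : probability T R).
Context (Y : nat -> {RV P >-> R}) (n : nat).
Hypothesis indY : forall B : nat -> set R, (forall i, measurable (B i)) ->
  (P (\bigcap_(i in `I_n) Y i @^-1` B i) = \prod_(i < n) P (Y i @^-1` B i))%E.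
Context (I : finType) (xi : I -> R -> R) (B tau : R).
Hypothesis mxi : forall i, measurable_fun setT (xi i).
Hypothesis xiB : forall y, \sum_i xi i y ^+ 2 <= B.
Hypothesis tau0 : 0 <= tau.
Hypothesis xitau : forall m, (m < n)%N -> forall s : I -> R,
  (\int[distribution P (Y m)]_y
     (1 + \sum_i s i * xi i y + 2 * (\sum_i s i * xi i y) ^+ 2)%:E
   <= (1 + tau * \sum_i s i ^+ 2)%:E)%E.

(** Partial sums as functions of the history, the form in which [integral_past_next] can be applied
    to them. *)
Fixpoint walk (m : nat) : historyT R m -> I -> R :=
  if m is m'.+1 as m0 return historyT R m0 -> I -> R
  then fun x i => walk x.1 i + xi i x.2 else fun _ _ => 0.

Lemma walk_past m t i : walk (past Y m t) i = \sum_(l < m) xi i (Y l t).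
Proof. by elim: m => [|m ih] /=; rewrite ?big_ord0// ih big_ord_recr. Qed.

Lemma measurable_walk m i : measurable_fun setT (fun x : historyT R m => walk x i).
Proof.
elim: m => [|m ih] /=; first exact: measurable_cst.
apply: measurable_funD; first exact: (measurableT_comp ih measurable_fst).
exact: (measurableT_comp (mxi i) measurable_snd).
Qed.

(** Every exponent in use is at most [2 th], and each step costs a factor [exp (2 th B)]. The
    condition with 16 makes the variance term [4 (2 th)^2 tau] at most [th / n], the amount by which
    the exponent drops at one step. The condition with 64 is that of [mgf_step] at the exponent
    [2 th]. *)
Lemma mgf_truncated_sqnorm (th L : R) : (0 < n)%N ->
  0 <= th -> 0 <= L -> 16 * n%:R * tau * th <= 1 -> 64 * th ^+ 2 * L * B <= 1 ->
  (\int[P]_t (expR (th * Num.min (\sum_i (\sum_(l < n) xi i (Y l t)) ^+ 2) L))%:E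
   <= (expR (2 * n%:R * th * B))%:E)%E.
Proof.
move=> n0 th0 L0 thtau thLB.
have B0 : 0 <= B by apply: le_trans (xiB 0); apply: sumr_ge0 => i _; exact: sqr_ge0.
have nR : 0 < n%:R :> R by rewrite ltr0n.
(* the exponent decreases from [2 th] to [th], paying for the loss at each step *)
pose thm m : R := th * (2 - m%:R / n%:R).
have thm0 m : (m <= n)%N -> 0 <= thm m <= 2 * th.
  move=> mn; rewrite /thm; have : 0 <= (m%:R / n%:R : R) <= 1.
    by rewrite divr_ge0//= ler_pdivrMr// mul1r ler_nat.
  move=> /andP[x0 x1]; rewrite mulr_ge0 ?subr_ge0//=; last by apply: le_trans x1 _; rewrite ler1n.
  by rewrite mulrC ler_wpM2r// gerBl.
suff H m : (m <= n)%N -> (\int[P]_t (expR (thm m * Num.min (\sum_i walk (past Y m t) i ^+ 2) L))%:E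
   <= (expR (2 * m%:R * th * B))%:E)%E.
  have := H n (leqnn n); have -> : thm n = th by rewrite /thm divff ?gt_eqF//; ring.
  move=> h; apply: le_trans h; rewrite le_eqVlt; apply/orP; left; apply/eqP.
  apply: eq_integral => t _.
  have -> // : \sum_i (\sum_(l < n) xi i (Y l t)) ^+ 2 =
    \sum_i walk (past Y n t) i ^+ 2.
  by apply: eq_bigr => i _; rewrite walk_past.
have msq k : measurable_fun setT (fun x : historyT R k => \sum_i walk x i ^+ 2).
  by apply: measurable_sum => i; apply: measurable_funX; exact: measurable_walk.
elim: m => [|m ih] mn.
  rewrite [leLHS](_ : _ = \int[P]_t (1 : R)%:E)%E; last first.
    apply: eq_integral => t _; rewrite big1 => [|i _]; last by rewrite /= expr0n.
    by rewrite (min_idPl L0) mulr0 expR0.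
  by rewrite mulr0 !mul0r expR0 integral_prob_cst.
have {}ih := ih (ltnW mn).
pose F (z : historyT R m * R) :=
  (expR (thm m.+1 * Num.min (\sum_i (walk z.1 i + xi i z.2) ^+ 2) L))%:E.
have mF : measurable_fun setT F.
  apply/measurable_EFinP; apply: measurableT_comp => //.
  apply: measurable_funM; first exact: measurable_cst.
  by apply: measurable_minr; [exact: (msq m.+1)|exact: measurable_cst].
rewrite [leLHS](_ : _ = \int[P]_t F (past Y m t, Y m t))%E//.
rewrite (integral_past_next indY mn mF); last by move=> z; rewrite lee_fin expR_ge0.
have mG : measurable_fun setT (fun t => (expR (thm m * Num.min (\sum_i walk (past Y m t) i ^+ 2) L))%:E).
  apply/measurable_EFinP; apply: measurableT_comp => //.
  apply: measurable_funM; first exact: measurable_cst.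
  apply: measurable_minr; last exact: measurable_cst.
  by apply: (measurableT_comp (msq m)); exact: measurable_past.
have e0 : 0 <= expR (2 * th * B) by exact: expR_ge0.
apply: (@le_trans _ _ (\int[P]_t ((expR (2 * th * B))%:E *
   (expR (thm m * Num.min (\sum_i walk (past Y m t) i ^+ 2) L))%:E))%E).
  apply: ge0_le_integral => //.
  - by move=> t _; apply: integral_ge0 => y _; rewrite lee_fin expR_ge0.
  - have mFF : measurable_fun setT (fubini_F (distribution P (Y m)) F).
      apply: measurable_fun_fubini_tonelli_F => //.
      by move=> z; rewrite lee_fin expR_ge0.
    exact: (measurableT_comp mFF (@measurable_past _ _ _ P Y m)).
  - by apply: emeasurable_funM => //; exact: measurable_cst.
  - move=> t _; have /andP[t1 t2] := thm0 _ mn.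
    have hF y : F (past Y m t, y) = (expR (thm m.+1 *
        Num.min (\sum_i (walk (past Y m t) i + xi i y) ^+ 2) L))%:E by [].
    under eq_integral do rewrite hF.
    have h := @mgf_step _ (distribution P (Y m)) I xi mxi B tau xiB (xitau mn)
      (thm m.+1) (thm m) L (walk (past Y m t)).
    apply: (le_trans (h t1 L0 tau0 _ _)); clear h.
    + have -> : thm m = thm m.+1 + th / n%:R.
        by rewrite /thm -[in RHS]natr1; field; rewrite gt_eqF.
      rewrite lerD2l ler_pdivlMr//.
      have : thm m.+1 ^+ 2 <= 4 * th ^+ 2 by rewrite (_ : 4 * _ = (2 * th) ^+ 2) ?ler_pXn2r ?nnegrE//; [lra|ring].
      move=> h; apply: (@le_trans _ _ (4 * (4 * th ^+ 2) * tau * n%:R)).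
        by rewrite ler_pM2r// ler_wpM2r// ler_wpM2l.
      have := ler_wpM2l th0 thtau; lra.
    + have : thm m.+1 ^+ 2 <= 4 * th ^+ 2 by rewrite (_ : 4 * _ = (2 * th) ^+ 2) ?ler_pXn2r ?nnegrE//; [lra|ring].
      move=> h; apply: le_trans thLB.
      have := ler_wpM2r B0 (ler_wpM2r L0 h); lra.
    + rewrite -EFinM lee_fin; apply: ler_wpM2r; first exact: expR_ge0.
      by rewrite ler_expR ler_wpM2r.
rewrite ge0_integralZl_EFin//.
apply: (@le_trans _ _ ((expR (2 * th * B))%:E * (expR (2 * m%:R * th * B))%:E)%E).
  by apply: lee_wpmul2l; rewrite ?lee_fin.
rewrite -EFinM lee_fin -expRD ler_expR -natr1; lra.
Qed.

(** Pointwise, the positive part of [N - c] is at most the prefactor times [exp (th min(N, L))]: for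
    [N <= L] use [x <= th^-1 exp (th x)] at [x = N - c]; for [N > L] use the deterministic bound
    [D]. *)
Lemma excess_sqnorm (th L c D : R) : (0 < n)%N ->
  0 < th -> 0 <= L -> 0 <= c -> 0 <= D ->
  16 * n%:R * tau * th <= 1 -> 64 * th ^+ 2 * L * B <= 1 ->
  (forall t, let N := \sum_i (\sum_(l < n) xi i (Y l t)) ^+ 2 in L < N -> N <= D) ->
  (\int[P]_t (Num.max (\sum_i (\sum_(l < n) xi i (Y l t)) ^+ 2 - c) 0)%:E
   <= ((th^-1 * expR (- (th * c)) + D * expR (- (th * L)))
       * expR (2 * n%:R * th * B))%:E)%E.
Proof.
move=> n0 th0 L0 c0 D0 thtau thLB ND.
pose N t := \sum_i (\sum_(l < n) xi i (Y l t)) ^+ 2.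
pose K := th^-1 * expR (- (th * c)) + D * expR (- (th * L)).
have K0 : 0 <= K.
  by rewrite addr_ge0// mulr_ge0 ?expR_ge0// invr_ge0 ltW.
have mN : measurable_fun setT N.
  apply: measurable_sum => i; apply: measurable_funX.
  by apply: measurable_sum => l; apply: measurableT_comp.
have mE : measurable_fun setT (fun t => (expR (th * Num.min (N t) L))%:E).
  apply/measurable_EFinP; apply: measurableT_comp => //.
  apply: measurable_funM; first exact: measurable_cst.
  by apply: measurable_minr => //; exact: measurable_cst.
apply: (@le_trans _ _ (\int[P]_t (K%:E * (expR (th * Num.min (N t) L))%:E))%E).
  apply: ge0_le_integral => //.
  - by move=> t _; rewrite lee_fin le_max lexx orbT.
  - apply/measurable_EFinP; apply: measurable_maxr; last exact: measurable_cst.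
    by apply: measurable_funB => //; exact: measurable_cst.
  - by apply: emeasurable_funM => //; exact: measurable_cst.
  - move=> t _; rewrite -EFinM lee_fin -/(N t) /K.
    have N0 : 0 <= N t by apply: sumr_ge0 => i _; exact: sqr_ge0.
    rewrite mulrDl -mulrA -expRD -mulrA -expRD.
    have [NL|LN] := lerP (N t) L.
      rewrite ler_wpDr ?mulr_ge0 ?expR_ge0// ge_max; apply/andP; split.
        rewrite ler_pdivlMl//.
        have := expR_ge1Dx (- (th * c) + th * N t); lra.
      by rewrite mulr_ge0 ?expR_ge0// invr_ge0 ltW.
    rewrite addNr expR0 mulr1 ler_wpDl ?mulr_ge0 ?expR_ge0 ?invr_ge0 ?(ltW th0)//.
    rewrite ge_max D0 andbT; have := ND t LN; rewrite -/(N t); lra.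
rewrite ge0_integralZl_EFin// EFinM.
apply: lee_wpmul2l; first by rewrite lee_fin.
by apply: mgf_truncated_sqnorm => //; exact: ltW.
Qed.
End concentration.

(** * A pathwise oracle inequality *)

Section oracle.
Context {R : realType}.

Lemma mulr_expRN_le (x : R) : 0 < x -> x * expR (- x) <= 6 / x ^+ 2.
Proof.
move=> x0; have h := expR_ge1Dxn 2 (ltW x0).
rewrite expRN ler_pdivrMr ?expR_gt0// mulrAC ler_pdivlMr ?exprn_gt0//.
have -> : x * x ^+ 2 = 6 * (x ^+ 3 / 6) by field.
rewrite ler_pM2l//; apply: le_trans h.
by rewrite (_ : 3`!%:R = 6 :> R)// lerDr.
Qed.

Lemma mulr_expRN_le1 (x : R) : x * expR (- x) <= 1.
Proof.
rewrite expRN ler_pdivrMr ?expR_gt0// mul1r.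
by apply: le_trans (expR_ge1Dx x); rewrite lerDr.
Qed.

(** The induction carries the sharper bound [2 - 2 / (m + 1)], which telescopes. *)
Lemma sum_inv_sqr_le2 (n : nat) : \sum_(1 <= l < n.+1) (l%:R ^+ 2)^-1 <= 2 :> R.
Proof.
have H m : \sum_(1 <= l < m.+1) (l%:R ^+ 2)^-1 <= 2 - 2 / m.+1%:R :> R.
  elim: m => [|m ih]; first by rewrite big_geq// divr1 subrr.
  rewrite big_nat_recr//=; apply: (le_trans (lerD ih (lexx _))).
  have m0 : 0 < m.+1%:R :> R by rewrite ltr0n.
  rewrite -[m.+2%:R]natr1; set x : R := m.+1%:R in m0 *.
  have x1 : 1 <= x by rewrite /x ler1n.
  rewrite -subr_ge0.
  have -> : 2 - 2 / (x + 1) - (2 - 2 / x + (x ^+ 2)^-1) =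
     (x - 1) / (x ^+ 2 * (x + 1)) by field; rewrite !gt_eqF//; lra.
  by rewrite divr_ge0 ?subr_ge0// mulr_ge0 ?sqr_ge0//; lra.
by apply: (le_trans (H n)); rewrite gerBl divr_ge0.
Qed.

(* Per pair [{i, -i}] of frequencies, [T], [F] and [D] are the squared moduli of the
   coefficients of the estimator, of [f] and of their difference; [B k] is the
   squared bias and [S] bounds the excess of the noise over [pen / 4]. *)
Variables (n : nat) (w c pen T F D : nat -> R) (a beta S : R).
Hypothesis w_ge0 : forall k, 0 <= w k.
Hypothesis w_sum1 : \sum_(1 <= k < n.+1) w k = 1.
Hypothesis w_exp : forall k l, (0 < k <= n)%N -> (0 < l <= n)%N -> c k <= c l ->
  w l <= expR (- (n%:R * (c l - c k))).
Hypothesis cE : forall k, (0 < k <= n)%N -> c k = a - \sum_(1 <= i < k.+1) T i + pen k.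
Hypothesis pen_ge : forall k, (0 < k <= n)%N -> 4 * k%:R / n%:R <= pen k.
Hypotheses (F0 : forall i, 0 <= F i) (D0 : forall i, 0 <= D i).
Hypothesis TFD : forall i, T i <= 2 * F i + 2 * D i.
Hypothesis FTD : forall i, F i <= 2 * T i + 2 * D i.
Hypothesis DS : forall k, (0 < k <= n)%N -> \sum_(1 <= i < k.+1) D i <= pen k / 4 + S.
Hypothesis S0 : 0 <= S.

Let B k := beta - \sum_(1 <= i < k.+1) F i.
Hypothesis B0 : forall k, 0 <= B k.

(** The bound is proved for each [l] separately, as [w l * M] plus a remainder, and then summed with
    [w_sum1]. The remainders [4 / n] for [l < k] sum to at most [4 k / n], which [pen_ge] absorbs
    into the penalty; the others are summable in [l] and give [12 / n]. *)
Lemma oracle_inequality k : (0 < k <= n)%N ->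
  \sum_(1 <= l < n.+1) w l * (\sum_(1 <= i < l.+1) D i + B l)
  <= 10 * pen k + 3 * B k + 5 * S + 12 / n%:R.
Proof.
move=> kn; have [k0 k_n] := andP kn.
have n0 : (0 < n)%N by exact: leq_trans k_n.
have nR : 0 < n%:R :> R by rewrite ltr0n.
have pen0 l : (0 < l <= n)%N -> 0 <= pen l.
  by move=> ln; apply: le_trans (pen_ge ln); rewrite divr_ge0// mulr_ge0.
have pk0 := pen0 _ kn; have Bk0 := B0 k.
pose M := 6 * pen k + 3 * B k + 5 * S.
have split_sum (G : nat -> R) l m : (l <= m)%N -> \sum_(1 <= i < m.+1) G i =
    \sum_(1 <= i < l.+1) G i + \sum_(l.+1 <= i < m.+1) G i.
  by move=> lm; rewrite (@big_cat_nat _ _ _ l.+1)//.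
have sum_ge0 (G : nat -> R) p q : (forall i, 0 <= G i) -> 0 <= \sum_(p <= i < q) G i.
  by move=> G0; apply: sumr_ge0.
have term l : (0 < l <= n)%N -> w l * (\sum_(1 <= i < l.+1) D i + B l) <=
    w l * M + (if (l < k)%N then 4 / n%:R else 6 / n%:R * (l%:R ^+ 2)^-1).
  move=> ln; have [l0 l_n] := andP ln.
  have pl0 := pen0 _ ln.
  have lR : 1 <= l%:R :> R by rewrite ler1n.
  have [lk|kl] := ltnP l k.
  - have lk' := ltnW lk.
    pose x := \sum_(l.+1 <= i < k.+1) F i.
    have x0 : 0 <= x by exact: sum_ge0.
    have BlE : B l = B k + x by rewrite /B (split_sum F _ _ lk') /x; lra.
    have Dl : \sum_(1 <= i < l.+1) D i <= pen k / 4 + S.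
      apply: le_trans (DS kn); rewrite (split_sum D _ _ lk') lerDl.
      exact: sum_ge0.
    (* By [FTD] and [DS], [c l - c k] is at least [x / 2 - 5 pen k / 4 - S]. The threshold is where
       this reaches [x / 4]; below it the extra bias [x] fits into [M]. *)
    have [xs|xs] := leP x (5 * pen k + 4 * S).
      rewrite ler_wpDr ?divr_ge0// ler_wpM2l// BlE /M; lra.
    have cc : x / 4 <= c l - c k.
      rewrite !cE// (split_sum T _ _ lk').
      have : x <= 2 * \sum_(l.+1 <= i < k.+1) T i + 2 * (pen k / 4 + S).
        apply: (@le_trans _ _ (\sum_(l.+1 <= i < k.+1) (2 * T i + 2 * D i))).
          by apply: ler_sum.
        rewrite big_split/= -!mulr_sumr lerD2l ler_pM2l//.
        apply: le_trans (DS kn); rewrite (split_sum D _ _ lk') lerDr.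
        exact: sum_ge0.
      lra.
    have wl : w l <= expR (- (n%:R * x / 4)).
      apply: le_trans (w_exp kn ln _) _; first by rewrite -subr_ge0; lra.
      by rewrite ler_expR lerN2 -mulrA ler_pM2l.
    have : w l * x <= 4 / n%:R.
      apply: (@le_trans _ _ (4 / n%:R * ((n%:R * x / 4) * expR (- (n%:R * x / 4))))).
        rewrite (_ : 4 / n%:R * _ = expR (- (n%:R * x / 4)) * x); last by field; rewrite gt_eqF.
        exact: ler_wpM2r.
      by rewrite ler_piMr ?divr_ge0// mulr_expRN_le1.
    have : w l * (\sum_(1 <= i < l.+1) D i + B k) <= w l * M.
      have h u v p q : u <= p / 4 + q -> 0 <= v -> 0 <= p -> 0 <= q ->
        u + v <= 6 * p + 3 * v + 5 * q :> R by lra.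
      by rewrite ler_wpM2l// h.
    by move=> h1 h2; rewrite BlE addrA mulrDr; exact: lerD h1 h2.
  - have Dl := DS ln.
    have BlE : B k = B l + \sum_(k.+1 <= i < l.+1) F i.
      by rewrite /B (split_sum F _ _ kl); lra.
    have Fkl : 0 <= \sum_(k.+1 <= i < l.+1) F i by exact: sum_ge0.
    have Bl0 := B0 l.
    (* By [TFD] and [DS], [c l - c k] is at least [pen l / 2 - E], hence at least [pen l / 4] as
       soon as [pen l > 4 E]. *)
    pose E := pen k + 2 * B k + 2 * S.
    have r0 : 0 <= 6 / n%:R * (l%:R ^+ 2)^-1 :> R.
      by rewrite mulr_ge0 ?divr_ge0// invr_ge0 sqr_ge0.
    have [ps|ps] := leP (pen l) (4 * E).
      have h u v b r p q t : u <= t / 4 + q -> t <= 4 * (p + 2 * b + 2 * q) ->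
        b = v + r -> 0 <= r -> 0 <= v -> 0 <= p -> 0 <= q ->
        u + v <= 6 * p + 3 * b + 5 * q :> R by lra.
      by rewrite ler_wpDr// ler_wpM2l//; apply: h Dl ps BlE Fkl Bl0 pk0 S0.
    have cc : pen l / 4 <= c l - c k.
      rewrite !cE// (split_sum T _ _ kl).
      have : \sum_(k.+1 <= i < l.+1) T i <=
          2 * \sum_(k.+1 <= i < l.+1) F i + 2 * (pen l / 4 + S).
        apply: (@le_trans _ _ (\sum_(k.+1 <= i < l.+1) (2 * F i + 2 * D i))).
          by apply: ler_sum.
        rewrite big_split/= -!mulr_sumr lerD2l ler_pM2l//.
        apply: le_trans (DS ln); rewrite (split_sum D _ _ kl) lerDr.
        exact: sum_ge0.
      by rewrite /E in ps; lra.
    have wl : w l <= expR (- (n%:R * pen l / 4)).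
      apply: le_trans (w_exp kn ln _) _; first by rewrite -subr_ge0; lra.
      by rewrite ler_expR lerN2 -mulrA ler_pM2l.
    (* [pen_ge] gives [y >= l], so the cubic decay in [mulr_expRN_le] leaves a remainder of order
       [1 / (n l^2)], summable over [l]. *)
    pose y := n%:R * pen l / 4.
    have ly : l%:R <= y.
      have := pen_ge ln; rewrite ler_pdivrMr// /y => ?.
      rewrite ler_pdivlMr//; lra.
    have y0 : 0 < y by apply: lt_le_trans ly; lra.
    have : w l * (pen l / 4) <= 6 / n%:R * (l%:R ^+ 2)^-1.
      apply: (@le_trans _ _ (n%:R^-1 * (y * expR (- y)))).
        rewrite (_ : _^-1 * _ = expR (- y) * (pen l / 4)); last by rewrite /y; field; rewrite gt_eqF.
        by apply: ler_wpM2r => //; rewrite divr_ge0.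
      rewrite [6 / n%:R]mulrC -[leRHS]mulrA ler_wpM2l ?invr_ge0//.
      apply: (le_trans (mulr_expRN_le y0)); rewrite ler_pM2l// lef_pV2 ?posrE ?exprn_gt0//; last by lra.
      by rewrite lerXn2r ?nnegrE//; lra.
    have : w l * (\sum_(1 <= i < l.+1) D i + B l) <= w l * (M + pen l / 4).
      have h u v b r p q : u <= p / 4 + q -> b = v + r -> 0 <= r -> 0 <= v -> 0 <= p -> 0 <= q -> 0 <= pen k ->
        u + v <= 6 * pen k + 3 * b + 5 * q + p / 4 :> R by lra.
      by rewrite ler_wpM2l//; apply: h Dl BlE Fkl Bl0 pl0 S0 pk0.
    rewrite [w l * (M + _)]mulrDr => h1 h2; apply: (le_trans h1).
    by rewrite lerD2l.
apply: (@le_trans _ _ (\sum_(1 <= l < n.+1) (w l * M +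
    (4 / n%:R * (l < k)%N%:R + 6 / n%:R * (l%:R ^+ 2)^-1)))).
  rewrite big_nat [leRHS]big_nat; apply: ler_sum => l ln.
  apply: (le_trans (term l ln)); rewrite lerD2l; case: ltnP => _.
    by rewrite mulr1 lerDl mulr_ge0 ?divr_ge0// invr_ge0 sqr_ge0.
  by rewrite mulr0 add0r.
rewrite !big_split/= -mulr_suml w_sum1 mul1r -!mulr_sumr.
have h1 : \sum_(1 <= l < n.+1) (l < k)%N%:R <= k%:R :> R.
  rewrite -natr_sum ler_nat.
  apply: (@leq_trans (\sum_(0 <= l < n.+1) (l < k))%N).
    by rewrite [leqRHS]big_ltn// leq_addl.
  rewrite (@big_cat_nat _ _ _ k)//=; last by rewrite (leq_trans k_n).
  rewrite [X in (_ + X)%N]big_nat [X in (_ + X)%N]big1 ?addn0; last first.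
    by move=> i /andP[ki _]; rewrite ltnNge ki.
  rewrite big_nat (eq_bigr (fun=> 1%N)) => [|i /andP[_ ->]//].
  by rewrite -big_nat sum_nat_const_nat subn0 muln1.
have h2 := sum_inv_sqr_le2 n.
have h3 : 4 / n%:R * \sum_(1 <= l < n.+1) (l < k)%N%:R <= 4 * pen k.
  apply: (@le_trans _ _ (4 / n%:R * k%:R)); first by rewrite ler_wpM2l ?divr_ge0.
  by have := pen_ge kn; rewrite mulrAC; lra.
have h4 : 6 / n%:R * \sum_(1 <= l < n.+1) (l%:R ^+ 2)^-1 <= 12 / n%:R :> R.
  apply: (@le_trans _ _ (6 / n%:R * 2)); first by rewrite ler_wpM2l ?divr_ge0.
  by rewrite mulrAC -natrM.
have h u v p b q r : u <= 4 * p -> v <= r ->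
  6 * p + 3 * b + 5 * q + (u + v) <= 10 * p + 3 * b + 5 * q + r :> R by lra.
exact: h.
Qed.

End oracle.

(** * Choice of the exponent and of the truncation level *)

Section series.
Context {R : realType}.

(** The square root of [t^6 <= 6! exp t] at [t = ln x]. A cube is wanted because it dominates the
    square of the logarithm met in [exp_sqrt_summable]. *)
Lemma ln_cube_le_sqrt : exists2 K : R, 0 < K &
  forall x, 1 <= x -> ln x ^+ 3 <= K * Num.sqrt x.
Proof.
have [F F0 HF] : exists2 F : R, 0 < F & forall t : R, 0 <= t -> t ^+ 6 <= F * expR t.
  exists 6`!%:R => [|t t0]; first by rewrite ltr0n fact_gt0.
  rewrite mulrC -ler_pdivrMr ?ltr0n ?fact_gt0//.
  by apply: le_trans (expR_ge1Dxn 5 t0); rewrite lerDr.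
exists (Num.sqrt F) => [|x x1]; first by rewrite sqrtr_gt0.
have x0 : 0 < x by apply: lt_le_trans x1.
have t0 : 0 <= ln x by exact: ln_ge0.
rewrite -(sqrtrM _ (ltW F0)) -[leLHS]ger0_norm ?exprn_ge0// -sqrtr_sqr.
rewrite ler_wsqrtr// -exprM.
by have := HF _ t0; rewrite lnK// posrE.
Qed.

(** Beyond [T] one has [b t >= a + 2] and [t >= 1], so the cubic wins; up to [T] the constant
    does. *)
Lemma quad_le_cube (a b : R) : 0 <= a -> 0 < b ->
  exists2 C, 0 <= C & forall t, 0 <= t -> a * t ^+ 2 + 2 * t <= b * t ^+ 3 + C.
Proof.
move=> a0 b0; pose T := (a + 2) / b + 1.
have T1 : 1 <= T by rewrite lerDr divr_ge0 ?addr_ge0// ltW.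
exists ((a + 2) * T ^+ 2) => [|t t0]; first by rewrite mulr_ge0 ?sqr_ge0 ?addr_ge0.
have bT : a + 2 <= b * T by rewrite mulrDr mulr1 mulrCA divff ?gt_eqF// mulr1 lerDl ltW.
have [tT|Tt] := leP t T.
  have h1 : t ^+ 2 <= T ^+ 2 by rewrite lerXn2r ?nnegrE//; lra.
  have h2 : t <= T ^+ 2 by apply: le_trans tT _; rewrite expr2 ler_peMl//; lra.
  have h3 : 0 <= b * t ^+ 3 by rewrite mulr_ge0 ?exprn_ge0// ltW.
  have := ler_wpM2l a0 h1; lra.
have t1 : 1 <= t by lra.
have h1 : t <= t ^+ 2 by rewrite expr2 ler_peMl.
have h2 : (a + 2) * t ^+ 2 <= b * t ^+ 3.
  have -> : b * t ^+ 3 = (b * t) * t ^+ 2 by ring.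
  apply: ler_wpM2r; first exact: sqr_ge0.
  by apply: le_trans bT _; apply: ler_wpM2l; exact: ltW.
have h3 : 0 <= (a + 2) * T ^+ 2 by rewrite mulr_ge0 ?sqr_ge0 ?addr_ge0.
lra.
Qed.

(** With [t = ln (k + 2)], [b sqrt k] dominates a multiple of [t^3], hence [a t^2 + 2 t] up to a
    constant; the term [2 t] supplies the factor [(k + 2)^-2]. *)
Lemma exp_sqrt_summable (a b : R) : 0 <= a -> 0 < b ->
  exists2 C, 0 <= C & forall k : nat, (0 < k)%N ->
  expR (a * ln (k + 2)%:R ^+ 2) * expR (- (b * Num.sqrt k%:R)) <= C * (k%:R ^+ 2)^-1.
Proof.
move=> a0 b0; have [K K0 HK] := ln_cube_le_sqrt.
have bK : 0 < b / (2 * K) by rewrite divr_gt0// mulr_gt0.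
have [C C0 H] := quad_le_cube a0 bK.
exists (expR C) => [|k k0]; first exact: expR_ge0.
have kR : 0 < k%:R :> R by rewrite ltr0n.
set x : R := (k + 2)%:R; have xE : x = k%:R + 2 by rewrite /x natrD.
have k1 : 1 <= k%:R :> R by rewrite ler1n.
have x0 : 0 < x by rewrite xE; lra.
have x1 : 1 <= x by rewrite xE; lra.
have sx : Num.sqrt x <= 2 * Num.sqrt k%:R.
  rewrite -(ler_pXn2r (n := 2)) ?nnegrE ?mulr_ge0 ?sqrtr_ge0//.
  by rewrite exprMn !sqr_sqrtr ?ltW// xE; lra.
have h := H (ln x) (ln_ge0 x1).
have h2 : b / (2 * K) * ln x ^+ 3 <= b * Num.sqrt k%:R.
  apply: (@le_trans _ _ (b / (2 * K) * (K * (2 * Num.sqrt k%:R)))); last first.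
    by rewrite le_eqVlt; apply/orP; left; apply/eqP; field; rewrite gt_eqF.
  rewrite ler_pM2l//; apply: le_trans (HK x x1) _.
  by rewrite ler_pM2l.
have : expR (a * ln x ^+ 2) * expR (- (b * Num.sqrt k%:R)) <= expR C * (x ^+ 2)^-1.
  have -> : (x ^+ 2)^-1 = expR (- (2 * ln x)).
    by rewrite expRN mulr_natl mulr2n expRD lnK ?posrE// expr2.
  rewrite -!expRD ler_expR.
  lra.
move=> h3; apply: (le_trans h3); rewrite ler_wpM2l ?expR_ge0// lef_pV2 ?posrE ?exprn_gt0//.
by rewrite lerXn2r ?nnegrE ?ltW// xE; lra.
Qed.

(* When [lam] dominates [ln m], the penalty alone beats the factor [k V] and no
   effective truncation is needed ([L] is the trivial bound of [N]).  Otherwise [V]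
   is at most [exp (O (ln x ^ 2))], and the larger [th], of order [1 / (n V sqrt k)],
   makes the tail smaller than [exp (- c sqrt k)]. *)
Lemma truncation_choice (Gam : R) : 2 <= Gam ->
  exists2 C, 0 <= C & forall (k n : nat) (V lam : R), (0 < k)%N -> (k <= n)%N -> 1 <= V ->
  lam = ln (Num.max (k%:R * V) (k + 2)%:R) ^+ 2 / ln (k + 2)%:R ^+ 2 ->
  exists th L D, [/\ 0 < th, 0 <= L, 0 <= D, 16 * n%:R * (2 * Gam * V) * th <= 1 &
    64 * th ^+ 2 * L * (4 * k%:R * V) <= 1] /\
    (n%:R ^+ 2 * (4 * k%:R * V) <= L \/ n%:R ^+ 2 * (4 * k%:R * V) <= D) /\
  forall c, 21 / 2 * n%:R * k%:R * V * lam <= c ->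
   2 / n%:R ^+ 2 * ((th^-1 * expR (- (th * c)) + D * expR (- (th * L)))
     * expR (2 * n%:R * th * (4 * k%:R * V)))
   <= C / n%:R * (k%:R ^+ 2)^-1 + C / n%:R ^+ 2.
Proof.
move=> G2; have G0 : 0 < Gam by lra.
(* [12 Gam] bounds [ln (k V)] relative to [ln (k + 2) ^ 2] in the second regime. The rates
   [1 / (16 Gam)] and [1 / 8] are what remains there, against [sqrt k] and [sqrt n], of the two
   exponents once the price of the exponential moment is deducted. *)
have a0 : 0 <= 12 * Gam by lra.
have b1 : 0 < (16 * Gam)^-1 by rewrite invr_gt0; lra.
have b2 : 0 < 8^-1 :> R by rewrite invr_gt0.
have [C1 C10 H1] := exp_sqrt_summable a0 b1.
have [C2 C20 H2] := exp_sqrt_summable a0 b2.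
pose C := 64 * Gam * expR 1 + 64 * Gam * C1 + 8 * C2.
have CA : 64 * Gam * expR 1 <= C.
  by rewrite /C -addrA lerDl addr_ge0// mulr_ge0//; lra.
have CB : 64 * Gam * C1 <= C.
  have h : 0 <= 64 * Gam * expR 1 by rewrite mulr_ge0 ?expR_ge0//; lra.
  by rewrite /C; lra.
have CC : 8 * C2 <= C.
  have h : 0 <= 64 * Gam * expR 1 by rewrite mulr_ge0 ?expR_ge0//; lra.
  have h' : 0 <= 64 * Gam * C1 by rewrite mulr_ge0//; lra.
  by rewrite /C; lra.
have C0 : 0 <= C by apply: le_trans CC; rewrite mulr_ge0.
exists C => // k n V lam k0 kn V1 lamE.
have k1 : 1 <= k%:R :> R by rewrite ler1n.
have kR : 0 < k%:R :> R by rewrite ltr0n.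
have nR : 0 < n%:R :> R by rewrite ltr0n (leq_trans k0).
have knR : k%:R <= n%:R :> R by rewrite ler_nat.
have V0 : 0 < V by lra.
set x : R := (k + 2)%:R in lamE.
have xE : x = k%:R + 2 by rewrite /x natrD.
have x0 : 0 < x by rewrite xE; lra.
set m := Num.max (k%:R * V) x in lamE; set l := ln m in lamE.
have xm : x <= m by rewrite le_max lexx orbT.
have kVm : k%:R * V <= m by rewrite le_max lexx.
have m0 : 0 < m by apply: lt_le_trans xm.
have lx0 : 0 < ln x by rewrite ln_gt0// xE; lra.
have lxl : ln x <= l by rewrite ler_ln.
have l0 : 0 < l by lra.
have lamx : lam * ln x ^+ 2 = l ^+ 2.
  by rewrite lamE divfK// sqrf_eq0 gt_eqF.
have lam1 : 1 <= lam.
  by rewrite lamE ler_pdivlMr ?exprn_gt0// mul1r lerXn2r ?nnegrE ?(ltW lx0)// ltW.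
have kVe : k%:R * V <= expR l by rewrite lnK.
have kV0 : 0 < k%:R * V by rewrite mulr_gt0.
have nkV : 0 < n%:R * k%:R * V by rewrite !mulr_gt0.
have [big|small] := leP (4 * Gam * (l + 2 * ln x)) lam.
- pose th := (32 * n%:R * Gam * k%:R * V)^-1.
  have den0 : 0 < 32 * n%:R * Gam * k%:R * V by rewrite !mulr_gt0.
  have th0 : 0 < th by rewrite invr_gt0.
  exists th, (n%:R ^+ 2 * (4 * k%:R * V)), 0; split; [split=> //|split; first by left].
  + by rewrite !mulr_ge0 ?ltW// exprn_gt0.
  + rewrite (_ : _ * th = k%:R^-1); first by rewrite invf_le1.
    by rewrite /th; field; rewrite !gt_eqF.
  + rewrite (_ : _ * _ = (Gam ^+ 2)^-1); last by rewrite /th; field; rewrite !gt_eqF.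
    by rewrite invf_le1 ?exprn_gt0// exprn_ege1//; lra.
  + move=> c hc; rewrite mul0r addr0.
    apply: ler_wpDr; first by rewrite divr_ge0// sqr_ge0.
    (* Hence [exp (- th c)] is at most [1 / (m x^2)]: the factor [1 / m] cancels the [k V] in
       [th^-1], and [1 / x^2] is summable in [k]. *)
    have thc : l + 2 * ln x <= th * c.
      have h1 : th * (21 / 2 * n%:R * k%:R * V * lam) <= th * c by rewrite ler_pM2l.
      have h2 : th * (21 / 2 * n%:R * k%:R * V * lam) = 21 / 64 / Gam * lam.
        by rewrite /th; field; rewrite !gt_eqF.
      have h3 : 21 / 64 / Gam * (4 * Gam * (l + 2 * ln x)) <= 21 / 64 / Gam * lam.
        by rewrite ler_pM2l// divr_gt0.
      have h4 : 21 / 64 / Gam * (4 * Gam * (l + 2 * ln x)) = 21 / 16 * (l + 2 * ln x).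
        by field; rewrite gt_eqF.
      lra.
    have thB : 2 * n%:R * th * (4 * k%:R * V) <= 1.
      rewrite (_ : _ * _ = (4 * Gam)^-1); last by rewrite /th; field; rewrite !gt_eqF.
      by rewrite invf_le1; lra.
    apply: (@le_trans _ _ (2 / n%:R ^+ 2 * (th^-1 * expR (- (l + 2 * ln x)) * expR 1))).
      apply: ler_wpM2l; first by rewrite divr_ge0 ?sqr_ge0.
      have thi0 : 0 <= th^-1 by rewrite invr_ge0 ltW.
      apply: ler_pM; [exact: mulr_ge0|exact: expR_ge0| |by rewrite ler_expR].
      by apply: ler_wpM2l => //; rewrite ler_expR lerN2.
    have -> : expR (- (l + 2 * ln x)) = m^-1 * (x ^+ 2)^-1.
      by rewrite opprD expRD !expRN lnK ?posrE// mulr_natl mulr2n expRD lnK ?posrE// expr2.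
    apply: (@le_trans _ _ (64 * Gam * expR 1 / n%:R * ((k%:R * V) / m) * (x ^+ 2)^-1)).
      rewrite le_eqVlt; apply/orP; left; apply/eqP.
      by rewrite /th invrK; field; rewrite !gt_eqF.
    apply: ler_pM; rewrite ?invr_ge0 ?sqr_ge0//.
    * by rewrite !mulr_ge0 ?expR_ge0 ?invr_ge0 ?ltW.
    * apply: (@le_trans _ _ (64 * Gam * expR 1 / n%:R)).
        by rewrite ler_piMr ?divr_ge0 ?mulr_ge0 ?expR_ge0 ?(ltW G0)// ler_pdivrMr// mul1r.
      by rewrite ler_pM2r ?invr_gt0.
    * by rewrite lef_pV2 ?posrE ?exprn_gt0// lerXn2r ?nnegrE ?ltW// xE; lra.
(* Here [lam < 4 Gam (l + 2 ln x) <= 12 Gam l]; multiplying by [ln x ^ 2] gives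
   [l^2 <= 12 Gam l ln x ^ 2], and one [l] cancels. *)
- have kVe2 : k%:R * V <= expR (12 * Gam * ln x ^+ 2).
    apply: (le_trans kVe); rewrite ler_expR.
    have h1 : lam <= 12 * Gam * l by have := ler_wpM2l (ltW G0) lxl; lra.
    have h2 : l ^+ 2 <= 12 * Gam * l * ln x ^+ 2 by rewrite -lamx ler_wpM2r ?sqr_ge0.
    by rewrite -(ler_pM2r l0) -expr2; apply: (le_trans h2); rewrite le_eqVlt; apply/orP; left; apply/eqP; ring.
  pose r := Num.sqrt (k%:R : R).
  have r0 : 0 < r by rewrite sqrtr_gt0.
  have r2 : r ^+ 2 = k%:R by rewrite sqr_sqrtr ?ltW.
  have r1 : 1 <= r by rewrite -(ler_pXn2r (n := 2)) ?nnegrE ?(ltW r0)// expr1n r2.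
  pose q := Num.sqrt (n%:R : R).
  have q0 : 0 < q by rewrite sqrtr_gt0.
  have q2 : q ^+ 2 = n%:R by rewrite sqr_sqrtr ?ltW.
  have rq : r <= q by rewrite ler_wsqrtr.
  pose th := (32 * n%:R * Gam * V * r)^-1.
  have den0 : 0 < 32 * n%:R * Gam * V * r by rewrite !mulr_gt0.
  have th0 : 0 < th by rewrite invr_gt0.
  (* This truncation level is the largest allowed: it turns the constraint with 64 into an
     equality. *)
  exists th, (4 * n%:R ^+ 2 * Gam ^+ 2 * V), (n%:R ^+ 2 * (4 * k%:R * V)).
  split; [split=> //|split; first by right].
  + by rewrite !mulr_ge0 ?exprn_ge0 ?ltW.
  + by rewrite !mulr_ge0 ?exprn_ge0 ?ltW.
  + rewrite (_ : _ * th = r^-1); first by rewrite invf_le1.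
    by rewrite /th; field; rewrite !gt_eqF.
  + rewrite -r2 (_ : _ * _ = 1)//; by rewrite /th; field; rewrite !gt_eqF.
  + move=> c hc.
    have thB : 2 * n%:R * th * (4 * k%:R * V) = r / (4 * Gam).
      by rewrite -r2 /th; field; rewrite !gt_eqF.
    (* The gain [21 / 64] exceeds the price [16 / 64] of [thB], both in units of [r / Gam]; the
       proof keeps [4 / 64] of the difference. *)
    have thc : 21 / 64 * r / Gam <= th * c.
      have h1 : th * (21 / 2 * n%:R * k%:R * V * lam) <= th * c by rewrite ler_pM2l.
      have h2 : th * (21 / 2 * n%:R * k%:R * V * lam) = 21 / 64 * r / Gam * lam.
        by rewrite -r2 /th; field; rewrite !gt_eqF.
      apply: le_trans h1; rewrite h2 ler_peMr// divr_ge0 ?mulr_ge0 ?(ltW r0)//; lra.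
    have thL : th * (4 * n%:R ^+ 2 * Gam ^+ 2 * V) = n%:R * Gam / (8 * r).
      by rewrite /th; field; rewrite !gt_eqF.
    rewrite thB thL (mulrDl _ _ (expR (r / (4 * Gam)))) (mulrDr (2 / n%:R ^+ 2)).
    apply: lerD.
    * rewrite -[X in _ * X <= _]mulrA -expRD.
      apply: (@le_trans _ _ (2 / n%:R ^+ 2 * (th^-1 * expR (- ((16 * Gam)^-1 * r))))).
        apply: ler_wpM2l; first by rewrite divr_ge0 ?sqr_ge0.
        apply: ler_wpM2l; [by rewrite invr_ge0 ltW|rewrite ler_expR].
        have -> : (16 * Gam)^-1 * r = 4 / 64 * r / Gam by field; rewrite gt_eqF.
        have -> : r / (4 * Gam) = 16 / 64 * r / Gam by field; rewrite gt_eqF.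
        have : 0 <= r / Gam by rewrite divr_ge0 ?ltW.
        have e (a : R) : a * r / Gam = a * (r / Gam) by rewrite mulrA.
        by move: thc; rewrite !e; lra.
      have h := H1 k k0; rewrite -/x -/r in h.
      have : k%:R * V * expR (- ((16 * Gam)^-1 * r)) <= C1 * (k%:R ^+ 2)^-1.
        by apply: le_trans h; rewrite ler_wpM2r ?expR_ge0.
      move=> {}h.
      apply: (@le_trans _ _ (64 * Gam / n%:R * (k%:R * V * expR (- ((16 * Gam)^-1 * r))))).
        rewrite /th invrK.
        apply: (@le_trans _ _ (64 * Gam / n%:R * (r * V * expR (- ((16 * Gam)^-1 * r))))).
          by rewrite le_eqVlt; apply/orP; left; apply/eqP; field; rewrite gt_eqF.
        rewrite ler_wpM2l ?divr_ge0 ?mulr_ge0 ?(ltW G0)// ler_wpM2r ?expR_ge0// ler_wpM2r ?(ltW V0)//.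
        by rewrite -r2 expr2 ler_peMr// ltW.
      apply: (@le_trans _ _ (64 * Gam / n%:R * (C1 * (k%:R ^+ 2)^-1))).
        by rewrite ler_wpM2l// divr_ge0 ?mulr_ge0 ?(ltW G0).
      rewrite mulrA ler_wpM2r ?invr_ge0 ?sqr_ge0// mulrAC ler_wpM2r// invr_ge0 ltW//.
    * rewrite -[X in _ * X <= _]mulrA -expRD.
      have -> : 2 / n%:R ^+ 2 * (n%:R ^+ 2 * (4 * k%:R * V) * expR (- (n%:R * Gam / (8 * r)) + r / (4 * Gam)))
        = 8 * (k%:R * V * expR (- (n%:R * Gam / (8 * r)) + r / (4 * Gam))).
        by field; rewrite gt_eqF.
      (* Summability is invoked at [n] instead of [k]: beyond the truncation the exponent is of
         order [n / sqrt k >= sqrt n], which yields the term [C / n^2]. *)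
      have h := H2 n (leq_trans k0 kn); rewrite -/q in h.
      have lnx : ln x <= ln (n + 2)%:R.
        by rewrite ler_ln ?posrE// ?ltr0n ?addn_gt0 ?orbT// /x ler_nat leq_add2r.
      apply: (@le_trans _ _ (8 * (C2 * (n%:R ^+ 2)^-1))); last first.
        by rewrite mulrA ler_wpM2r// invr_ge0 sqr_ge0.
      rewrite ler_pM2l//; apply: le_trans h.
      apply: ler_pM; rewrite ?expR_ge0 ?(ltW kV0)//.
        apply: (le_trans kVe2); rewrite ler_expR ler_wpM2l//.
        by rewrite lerXn2r ?nnegrE ?(ltW lx0)//; apply: le_trans lnx; exact: ltW.
      rewrite ler_expR.
      have h1 : q * Gam / 8 <= n%:R * Gam / (8 * r).
        have -> : n%:R * Gam / (8 * r) = q * Gam / 8 * (q / r).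
          by rewrite -q2; field; rewrite gt_eqF.
        have qr : 1 <= q / r by rewrite ler_pdivlMr// mul1r.
        have qG : 0 <= q * Gam / 8 by rewrite divr_ge0// mulr_ge0// ltW.
        by rewrite ler_peMr.
      have h2 : r / (4 * Gam) <= q / 8.
        apply: ler_pM => //; first exact: ltW.
          by rewrite invr_ge0; lra.
        by rewrite lef_pV2 ?posrE//; lra.
      have := ler_wpM2l (ltW q0) G2; lra.
Qed.

End series.

(** * The Hilbert space L^2([0,1)) and Fourier coefficients *)

Section L2_theory.
Context {R : realType}.
Local Notation mu := (@lebesgue_measure R).
Local Notation U := (@unit_itv R : set (measurableTypeR R)).

Lemma unit_itvE : U = `[0, 1[%classic.
Proof. by apply/seteqP; split=> x /=; rewrite in_itv. Qed.

Lemma measurable_unit_itv : measurable U.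
Proof. by rewrite unit_itvE. Qed.
Local Hint Resolve measurable_unit_itv : core.

Lemma mu_unit_itv : mu U = 1%E.
Proof. by rewrite unit_itvE lebesgue_measure_itv/= lte01 oppr0 adde0. Qed.

Lemma cabsE (z : R[i]) : cabs z ^+ 2 = Re z ^+ 2 + Im z ^+ 2.
Proof. by case: z => a b /=; rewrite sqr_sqrtr// addr_ge0 ?sqr_ge0. Qed.

Lemma Re_sum (I : Type) (r : seq I) (F : I -> R[i]) :
  Re (\sum_(i <- r) F i) = \sum_(i <- r) Re (F i).
Proof.
elim: r => [|i r ih]; first by rewrite !big_nil.
by rewrite !big_cons -ih; case: (F i) (\sum_(_ <- _) _) => [? ?] [? ?].
Qed.

Lemma Im_sum (I : Type) (r : seq I) (F : I -> R[i]) :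
  Im (\sum_(i <- r) F i) = \sum_(i <- r) Im (F i).
Proof.
elim: r => [|i r ih]; first by rewrite !big_nil.
by rewrite !big_cons -ih; case: (F i) (\sum_(_ <- _) _) => [? ?] [? ?].
Qed.

Definition sq_integrable (a : R -> R) :=
  measurable_fun U a /\ mu.-integrable U (EFin \o (fun x => a x ^+ 2)).

Lemma sq_integrableM a b : sq_integrable a -> sq_integrable b ->
  mu.-integrable U (EFin \o (fun x => a x * b x)).
Proof.
move=> [ma ia] [mb ib].
apply: (le_integrable measurable_unit_itv _ _ (integrableD measurable_unit_itv ia ib)).
  by apply/measurable_EFinP; exact: measurable_funM.
move=> x _ /=; rewrite lee_fin normrM.
rewrite [leRHS]ger0_norm ?addr_ge0 ?sqr_ge0//.
rewrite -(real_normK (num_real (a x))) -(real_normK (num_real (b x))).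
have := sqr_ge0 (`|a x| - `|b x|); have := normr_ge0 (a x); have := normr_ge0 (b x); nra.
Qed.

Lemma sq_integrableD a b : sq_integrable a -> sq_integrable b ->
  sq_integrable (fun x => a x + b x).
Proof.
move=> sa sb; have iab := sq_integrableM sa sb; case: sa sb => [ma ia] [mb ib].
split; first exact: measurable_funD.
have := integrableD measurable_unit_itv (integrableD measurable_unit_itv ia ib)
  (integrableZl measurable_unit_itv 2 iab).
apply: eq_integrable => // x _ /=; rewrite -EFinM -!EFinD; congr EFin; ring.
Qed.

Lemma sq_integrableZ k a : sq_integrable a -> sq_integrable (fun x => k * a x).
Proof.
move=> [ma ia]; split; first exact: measurable_funM.
apply: eq_integrable (integrableZl measurable_unit_itv (k ^+ 2) ia) => // x _ /=.
by rewrite -EFinM exprMn.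
Qed.

Lemma sq_integrable_bounded (a : R -> R) (M : R) : measurable_fun U a ->
  (forall x, U x -> `|a x| <= M) -> sq_integrable a.
Proof.
move=> ma aM; split=> //.
have U0 : U 0 by rewrite /unit_itv /= lexx ltr01.
have M0 : 0 <= M by apply: le_trans (aM 0 U0).
apply: measurable_bounded_integrable => //.
- by have := ltry (1 : R); rewrite -mu_unit_itv.
- exact: measurable_funX.
- exists (M ^+ 2); split; first exact: num_real.
  move=> y My x Ux /=; apply: le_trans (ltW My).
  by rewrite normrX lerXn2r ?nnegrE// aM.
Qed.

Lemma in_L2P (h : R -> R[i]) : in_L2 h <->
  sq_integrable (fun x => Re (h x)) /\ sq_integrable (fun x => Im (h x)).
Proof.
split.
- move=> [mr mi h2].
  have mh : measurable_fun U (fun x => (cabs (h x) ^+ 2)%:E).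
    apply/measurable_EFinP; rewrite (_ : (fun _ => _) = fun x => Re (h x) ^+ 2 + Im (h x) ^+ 2).
      by apply: measurable_funD; exact: measurable_funX.
    by apply/funext => x; rewrite cabsE.
  have ih : mu.-integrable U (fun x => (cabs (h x) ^+ 2)%:E).
    apply/integrableP; split => //.
    by under eq_integral do rewrite /= ger0_norm ?sqr_ge0//.
  split; split=> //; apply: (le_integrable measurable_unit_itv _ _ ih).
  - by apply/measurable_EFinP; exact: measurable_funX.
  - by move=> x _; rewrite /= lee_fin !ger0_norm ?sqr_ge0// cabsE lerDl sqr_ge0.
  - by apply/measurable_EFinP; exact: measurable_funX.
  - by move=> x _; rewrite /= lee_fin !ger0_norm ?sqr_ge0// cabsE lerDr sqr_ge0.
- move=> [[mr ir] [mi ii]]; split=> //.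
  have := integrableD measurable_unit_itv ir ii => /integrableP[_].
  by under eq_integral do rewrite /= ger0_norm ?addr_ge0 ?sqr_ge0// -cabsE.
Qed.

Definition c_integrable (h : R -> R[i]) :=
  mu.-integrable U (EFin \o (fun x => Re (h x))) /\
  mu.-integrable U (EFin \o (fun x => Im (h x))).

Lemma eq_cintegral (h h' : R -> R[i]) : h =1 h' -> cintegral h = cintegral h'.
Proof. by move=> hh; congr cintegral; apply/funext. Qed.

Lemma cintegralD (h h' : R -> R[i]) : c_integrable h -> c_integrable h' ->
  cintegral (fun x => h x + h' x) = cintegral h + cintegral h'.
Proof.
move=> [hr hi] [hr' hi']; rewrite /cintegral; apply/eqP; rewrite eq_complex /=.
apply/andP; split; apply/eqP; rewrite -RintegralD//; apply: eq_Rintegral => x _.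
  by case: (h x) (h' x) => ? ? [].
by case: (h x) (h' x) => ? ? [].
Qed.

Lemma cintegralZ c (h : R -> R[i]) : c_integrable h ->
  cintegral (fun x => c * h x) = c * cintegral h.
Proof.
move=> [hr hi]; rewrite /cintegral; case: c => a b; apply/eqP; rewrite eq_complex /=.
apply/andP; split; apply/eqP; rewrite -!RintegralZl//.
- rewrite -RintegralB//; last 2 first.
  + exact: (integrableZl measurable_unit_itv a hr).
  + exact: (integrableZl measurable_unit_itv b hi).
  by apply: eq_Rintegral => x _; case: (h x).
- rewrite -RintegralD//; last 2 first.
  + exact: (integrableZl measurable_unit_itv a hi).
  + exact: (integrableZl measurable_unit_itv b hr).
  by apply: eq_Rintegral => x _; case: (h x).
Qed.

Lemma cintegralJ (h : R -> R[i]) : c_integrable h ->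
  cintegral (fun x => (h x)^*) = (cintegral h)^*.
Proof.
move=> [hr hi]; rewrite /cintegral; apply/eqP; rewrite eq_complex /=.
apply/andP; split; apply/eqP.
  by apply: eq_Rintegral => x _; case: (h x).
rewrite -mulN1r -RintegralZl//; apply: eq_Rintegral => x _.
by case: (h x) => a b /=; rewrite mulN1r.
Qed.

Lemma c_integrable_mulJ (h h' : R -> R[i]) : in_L2 h -> in_L2 h' ->
  c_integrable (fun x => h x * (h' x)^*).
Proof.
move=> /in_L2P[hr hi] /in_L2P[hr' hi']; split.
  have := integrableD measurable_unit_itv (sq_integrableM hr hr') (sq_integrableM hi hi').
  apply: eq_integrable => // x _ /=; rewrite -EFinD; congr EFin.
  by case: (h x) (h' x) => a b [u v] /=; ring.
have := integrableB measurable_unit_itv (sq_integrableM hi hr') (sq_integrableM hr hi').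
apply: eq_integrable => // x _ /=; rewrite -EFinB; congr EFin.
by case: (h x) (h' x) => a b [u v] /=; ring.
Qed.

Lemma in_L2D (h h' : R -> R[i]) : in_L2 h -> in_L2 h' -> in_L2 (fun x => h x + h' x).
Proof.
move=> /in_L2P[hr hi] /in_L2P[hr' hi']; apply/in_L2P.
split; [move: (sq_integrableD hr hr')|move: (sq_integrableD hi hi')]; congr sq_integrable;
  by apply/funext => x; case: (h x) (h' x) => ? ? [].
Qed.

Lemma in_L2Z c (h : R -> R[i]) : in_L2 h -> in_L2 (fun x => c * h x).
Proof.
move=> /in_L2P[hr hi]; apply/in_L2P; split.
  move: (sq_integrableD (sq_integrableZ (Re c) hr) (sq_integrableZ (- Im c) hi)).
  congr sq_integrable; apply/funext => x; case: c (h x) => a b [u v] /=; ring.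
move: (sq_integrableD (sq_integrableZ (Re c) hi) (sq_integrableZ (Im c) hr)).
congr sq_integrable; apply/funext => x; case: c (h x) => a b [u v] /=; ring.
Qed.

Lemma in_L2N (h : R -> R[i]) : in_L2 h -> in_L2 (fun x => - h x).
Proof.
by move=> /(in_L2Z (-1)); congr in_L2; apply/funext => x; rewrite mulN1r.
Qed.

Lemma in_L2_0 : in_L2 (fun _ : R => 0 : R[i]).
Proof.
apply/in_L2P; split; apply: (@sq_integrable_bounded _ 0) => //; by move=> x _; rewrite normr0.
Qed.

Lemma in_L2_sum I (s : seq I) (P : pred I) (h : I -> R -> R[i]) :
  (forall i, P i -> in_L2 (h i)) -> in_L2 (fun x => \sum_(i <- s | P i) h i x).
Proof.
move=> hL; elim: s => [|i s ih].
  by move: in_L2_0; congr in_L2; apply/funext => x; rewrite big_nil.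
have [Pi|Pi] := boolP (P i); last first.
  by move: ih; congr in_L2; apply/funext => x; rewrite big_cons (negPf Pi).
by move: (in_L2D (hL i Pi) ih); congr in_L2; apply/funext => x; rewrite big_cons Pi.
Qed.

Lemma innerDl (h1 h2 h : R -> R[i]) : in_L2 h1 -> in_L2 h2 -> in_L2 h ->
  inner (fun x => h1 x + h2 x) h = inner h1 h + inner h2 h.
Proof.
move=> L1 L2 L; rewrite /inner -cintegralD; try exact: c_integrable_mulJ.
by apply: eq_cintegral => x; rewrite mulrDl.
Qed.

Lemma innerZl c (h1 h : R -> R[i]) : in_L2 h1 -> in_L2 h ->
  inner (fun x => c * h1 x) h = c * inner h1 h.
Proof.
move=> L1 L; rewrite /inner -cintegralZ; last exact: c_integrable_mulJ.
by apply: eq_cintegral => x; rewrite mulrA.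
Qed.

Lemma inner0l (h : R -> R[i]) : inner (fun=> 0) h = 0.
Proof.
rewrite /inner /cintegral; apply/eqP; rewrite eq_complex /=.
by apply/andP; split; apply/eqP;
  under eq_Rintegral do rewrite mul0r/=; rewrite Rintegral_cst//= mul0r.
Qed.

Lemma innerBl (h1 h2 h : R -> R[i]) : in_L2 h1 -> in_L2 h2 -> in_L2 h ->
  inner (fun x => h1 x - h2 x) h = inner h1 h - inner h2 h.
Proof.
move=> L1 L2 L; rewrite innerDl//; last exact: in_L2N.
congr (_ + _); rewrite -mulN1r -innerZl//.
by congr inner; apply/funext => x; rewrite mulN1r.
Qed.

Lemma inner_suml I (s : seq I) (P : pred I) (g : I -> R -> R[i]) (h : R -> R[i]) :
  (forall i, P i -> in_L2 (g i)) -> in_L2 h ->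
  inner (fun x => \sum_(i <- s | P i) g i x) h = \sum_(i <- s | P i) inner (g i) h.
Proof.
move=> gL hL; elim: s => [|i s ih].
  rewrite big_nil -[RHS](inner0l h); congr inner.
  by apply/funext => x; rewrite big_nil.
rewrite big_cons; case: ifPn => Pi; last first.
  by rewrite -ih; congr inner; apply/funext => x; rewrite big_cons (negPf Pi).
rewrite -ih -innerDl//; [|exact: gL|exact: in_L2_sum].
by congr inner; apply/funext => x; rewrite big_cons Pi.
Qed.

Lemma innerC (h h' : R -> R[i]) : in_L2 h -> in_L2 h' -> inner h' h = (inner h h')^*.
Proof.
move=> L L'; rewrite /inner -cintegralJ; last exact: c_integrable_mulJ.
by apply: eq_cintegral => x; rewrite rmorphM /= conjcK mulrC.
Qed.

Lemma L2norm_sqr (h : R -> R[i]) : L2norm h ^+ 2 = \int[mu]_(x in U) (cabs (h x) ^+ 2).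
Proof. by rewrite sqr_sqrtr//; apply: Rintegral_ge0 => x _; exact: sqr_ge0. Qed.

Lemma inner_self (h : R -> R[i]) : inner h h = (L2norm h ^+ 2)%:C.
Proof.
rewrite L2norm_sqr /inner /cintegral; apply/eqP; rewrite eq_complex /=.
apply/andP; split; apply/eqP.
  apply: eq_Rintegral => x _; rewrite cabsE; case: (h x) => a b /=; ring.
under eq_Rintegral => x _.
  rewrite (_ : Im _ = 0); last by case: (h x) => a b /=; ring.
  over.
by rewrite Rintegral_cst//= mul0r.
Qed.

Lemma L2norm_distC (h h' : R -> R[i]) :
  L2norm (fun x => h x - h' x) = L2norm (fun x => h' x - h x).
Proof.
rewrite /L2norm; congr Num.sqrt; apply: eq_Rintegral => x _.
by rewrite -normcN opprB.
Qed.

End L2_theory.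

#[local] Hint Resolve measurable_unit_itv : core.

(** * Orthonormality of the exponentials and Pythagoras for trigonometric polynomials *)

Section fourier.
Context {R : realType}.
Local Notation mu := (@lebesgue_measure R).
Local Notation U := (@unit_itv R : set (measurableTypeR R)).

Lemma cos_sin_2pi_int (m : int) :
  cos (2 * pi * m%:~R : R) = 1 /\ sin (2 * pi * m%:~R : R) = 0.
Proof.
have H n : cos (2 * pi * n%:R : R) = 1 /\ sin (2 * pi * n%:R : R) = 0.
  have -> : 2 * pi * n%:R = 0 + (pi *+ 2) *+ n :> R
    by rewrite add0r -[RHS]mulr_natr; congr (_ * _); rewrite mulr_natl.
  by rewrite (periodicn (@cosD2pi R)) (periodicn (@sinD2pi R)) cos0 sin0.
case: m => n; first exact: H.
have [c s] := H n.+1; rewrite NegzE mulrNz mulrN cosN sinN.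
by rewrite c s oppr0.
Qed.

(** The antiderivatives [sin (k x) / k] and [- cos (k x) / k] take equal values at 0 and 1. *)
Lemma Rintegral_cos_sin (k : R) : k != 0 -> cos k = 1 -> sin k = 0 ->
  \int[mu]_(x in U) cos (k * x) = 0 /\ \int[mu]_(x in U) sin (k * x) = 0.
Proof.
move=> k0 ck sk.
have ftc (f F : R -> R) : (forall x : R, is_derive x (1 : R) F (f x)) -> continuous f -> F 1 = F 0 ->
    \int[mu]_(x in U) f x = 0.
  move=> dF cf F10.
  have cF : continuous F.
    by move=> x; apply: differentiable_continuous; apply/derivable1_diffP; case: (dF x).
  have := @continuous_FTC2 R f F 0 1 ltr01.
  rewrite F10 subee// => h; rewrite unit_itvE Rintegral_itv_bndo_bndc.
    rewrite /Rintegral h//.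
    - exact: continuous_subspaceT.
    - split=> [x _| |]; first by case: (dF x).
        by apply: cvg_at_right_filter; exact: cF.
      by apply: cvg_at_left_filter; exact: cF.
    - by move=> x _; rewrite derive1E; case: (dF x).
  have i01 : mu.-integrable `[0, 1]%classic (EFin \o f).
    apply: continuous_compact_integrable; first exact: segment_compact.
    exact: continuous_subspaceT.
  by apply: integrableS i01 => //; exact: subset_itv_co_cc.
have clin : continuous (fun x : R => k * x) by move=> x; apply: mulrl_continuous.
have dlin (x : R) : is_derive x (1 : R) (fun x : R => k * x) k.
  apply: (is_derive_eq (is_deriveZ k (is_derive_id x 1))).
  by rewrite /GRing.scale/= mulr1.
split.
- apply: (ftc _ (fun x => k^-1 * sin (k * x))).
  + move=> x; have d2 := is_derive1_comp (is_derive_sin (k * x)) (dlin x).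
    by apply: (is_derive_eq (is_deriveZ k^-1 d2)); rewrite /GRing.scale/=; field.
  + by move=> x; apply: continuous_comp; [exact: clin|exact: continuous_cos].
  + by rewrite mulr1 mulr0 sk sin0.
- apply: (ftc _ (fun x => - k^-1 * cos (k * x))).
  + move=> x; have d2 := is_derive1_comp (is_derive_cos (k * x)) (dlin x).
    by apply: (is_derive_eq (is_deriveZ (- k^-1) d2)); rewrite /GRing.scale/=; field.
  + by move=> x; apply: continuous_comp; [exact: clin|exact: continuous_sin].
  + by rewrite mulr1 mulr0 ck cos0.
Qed.

Lemma e_M j l (x : R) : e_ j x * (e_ l x)^* = e_ (j - l) x.
Proof.
rewrite /e_ (_ : - (2 * pi * (j - l)%:~R * x) =
  - (2 * pi * j%:~R * x) - - (2 * pi * l%:~R * x)); last by rewrite intrB; ring.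
apply/eqP; rewrite eq_complex /= cosB sinB; apply/andP; split; apply/eqP; ring.
Qed.

Lemma e_0 (x : R) : e_ 0 x = 1.
Proof. by rewrite /e_ mulr0 mul0r oppr0 cos0 sin0. Qed.

Lemma continuous_mulr (k : R) : continuous (fun x : R => k * x).
Proof. by move=> x; apply: mulrl_continuous. Qed.

Lemma measurable_cosM (k : R) : measurable_fun setT (fun x : R => cos (k * x)).
Proof.
apply: continuous_measurable_fun => x.
by apply: continuous_comp; [exact: continuous_mulr|exact: continuous_cos].
Qed.

Lemma measurable_sinM (k : R) : measurable_fun setT (fun x : R => sin (k * x)).
Proof.
apply: continuous_measurable_fun => x.
by apply: continuous_comp; [exact: continuous_mulr|exact: continuous_sin].
Qed.

Lemma Re_e j (x : R) : Re (e_ j x) = cos (2 * pi * j%:~R * x).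
Proof. by rewrite /= cosN. Qed.

Lemma Im_e j (x : R) : Im (e_ j x) = - sin (2 * pi * j%:~R * x).
Proof. by rewrite /= sinN. Qed.

Lemma in_L2_e j : in_L2 (@e_ R j).
Proof.
apply/in_L2P; split; apply: (@sq_integrable_bounded _ _ 1).
- under eq_fun do rewrite Re_e; apply: measurable_funTS; exact: measurable_cosM.
- by move=> x _; rewrite Re_e ler_norml cos_geN1 cos_le1.
- under eq_fun do rewrite Im_e; apply: measurable_funTS.
  by apply: measurableT_comp => //; exact: measurable_sinM.
- by move=> x _; rewrite Im_e normrN ler_norml sin_geN1 sin_le1.
Qed.

Lemma cintegral_e (m : int) : cintegral (@e_ R m) = (m == 0)%:R.
Proof.
have [->|m0] := eqVneq m 0.
  rewrite (eq_cintegral e_0) /cintegral /= !(Rintegral_cst _ measurable_unit_itv).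
  have -> : fine (mu U) = 1 by rewrite [X in fine X]mu_unit_itv.
  by rewrite !mulr1.
pose k : R := 2 * pi * m%:~R.
have k0 : k != 0.
  apply: mulf_neq0; last by rewrite intr_eq0.
  by apply: mulf_neq0; [rewrite pnatr_eq0|exact: lt0r_neq0 (pi_gt0 R)].
have [ck sk] := cos_sin_2pi_int m.
have [ic isn] := Rintegral_cos_sin k0 ck sk.
have iRe : \int[mu]_(x in U) Re (e_ m x) = 0.
  by rewrite -[RHS]ic; apply: eq_Rintegral => x _; rewrite Re_e.
have iIm : \int[mu]_(x in U) Im (e_ m x) = 0.
  rewrite -[RHS](mulr0 (-1)) -isn -RintegralZl//.
    by apply: eq_Rintegral => x _; rewrite Im_e mulN1r.
  have := sq_integrableM (proj2 ((in_L2P _).1 (in_L2_e m)))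
    (proj1 ((in_L2P _).1 (in_L2_e 0))).
  move=> /(integrableZl measurable_unit_itv (-1)).
  apply: eq_integrable => // x _; rewrite /comp -EFinM; congr EFin.
  by rewrite Im_e e_0 mulr1 mulN1r opprK.
by rewrite /cintegral iRe iIm.
Qed.

Lemma inner_e j l : inner (@e_ R j) (e_ l) = (j == l)%:R.
Proof.
rewrite /inner (eq_cintegral (fun x => e_M j l x)) cintegral_e.
by rewrite subr_eq0.
Qed.

Lemma coef_e j l : coef (@e_ R j) l = (j == l)%:R.
Proof. exact: inner_e. Qed.

Definition trig (s : seq int) (a : int -> R[i]) : R -> R[i] :=
  fun x => \sum_(j <- s) a j * e_ j x.

Lemma in_L2_trig s a : in_L2 (trig s a).
Proof. by apply: in_L2_sum => j _; apply: in_L2Z; exact: in_L2_e. Qed.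

Lemma inner_trig s a h : in_L2 h ->
  inner (trig s a) h = \sum_(j <- s) a j * conjc (coef h j).
Proof.
move=> hL; rewrite inner_suml//; last by move=> j _; apply: in_L2Z; exact: in_L2_e.
apply: eq_bigr => j _; rewrite innerZl//; last exact: in_L2_e.
by rewrite (innerC hL)//; exact: in_L2_e.
Qed.

Lemma coef_trig s a l : uniq s -> coef (trig s a) l = if l \in s then a l else 0.
Proof.
move=> us; rewrite /coef inner_trig; last exact: in_L2_e.
under eq_bigr => j _ do rewrite coef_e eq_sym.
have H (b : bool) : (b%:R : R[i])^* = b%:R by case: b; rewrite ?conjc1 ?conjc0.
under eq_bigr => j _ do rewrite H.
have [ls|ls] := boolP (l \in s).
  rewrite (bigD1_seq l)//= eqxx mulr1 big1 ?addr0// => j /negPf ->.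
  by rewrite mulr0.
rewrite big_seq big1// => j js; have [jl|_] := eqVneq j l; last by rewrite mulr0.
by rewrite jl (negPf ls) in js.
Qed.

Lemma coefB (h h' : R -> R[i]) j : in_L2 h -> in_L2 h' ->
  coef (fun x => h x - h' x) j = coef h j - coef h' j.
Proof. by move=> L L'; rewrite /coef innerBl//; exact: in_L2_e. Qed.

Lemma cabs_sqrC (z : R[i]) : (cabs z ^+ 2)%:C = z * z^*.
Proof. by rewrite cabsE; case: z => a b; apply/eqP; rewrite eq_complex /=; apply/andP; split; apply/eqP; ring. Qed.

(** Pythagoras: the first sum is the error inside the span, the bracket is the squared distance of
    [h] to the span. The norm of a projection error, the norm of a trigonometric polynomial and the
    loss are all instances. *)
Lemma L2norm_trigB s a h : uniq s -> in_L2 h ->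
  L2norm (fun x => trig s a x - h x) ^+ 2 =
  \sum_(j <- s) cabs (a j - coef h j) ^+ 2 +
  (L2norm h ^+ 2 - \sum_(j <- s) cabs (coef h j) ^+ 2).
Proof.
move=> us hL; apply: (@complexI R).
have pL := in_L2_trig s a.
have qL : in_L2 (fun x => trig s a x - h x) by apply: in_L2D => //; exact: in_L2N.
rewrite -inner_self innerBl// inner_trig// (innerC qL hL) innerBl// inner_trig//.
rewrite inner_self.
have -> : \sum_(j <- s) a j * conjc (coef (fun x => trig s a x - h x) j) =
    \sum_(j <- s) a j * conjc (a j - coef h j).
  rewrite big_seq [RHS]big_seq; apply: eq_bigr => j js.
  by rewrite coefB// coef_trig// js.
rewrite [in LHS](rmorphB (@conjc R)) [X in _ - (_ - X)](_ : _ = (L2norm h ^+ 2)%:C);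
  last exact: conjc_real.
rewrite (rmorph_sum (@conjc R)).
rewrite !(rmorphD (real_complex R)) (rmorphN (real_complex R)) !(rmorph_sum (real_complex R)).
rewrite opprB addrA [RHS]addrA [in LHS]addrAC [in RHS]addrAC; congr (_ + _).
rewrite -!sumrB; apply: eq_bigr => j _.
rewrite [RHS](_ : _ = (a j - coef h j) * conjc (a j - coef h j) - coef h j * conjc (coef h j));
  last by congr (_ - _); exact: cabs_sqrC.
move: (coef h j) (a j) => [c1 c2] [a1 a2].
by apply/eqP; rewrite eq_complex /=; apply/andP; split; apply/eqP; ring.
Qed.
End fourier.

(** * Projections onto the span of the low frequencies *)

Section projections.
Context {R : realType}.

Lemma cabs0_sqr : cabs (0 : R[i]) ^+ 2 = 0.
Proof. by rewrite cabsE /= !expr0n addr0. Qed.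

Lemma mem_freqs k (j : int) : (j \in freqs k) = (`|j| <= k)%N.
Proof.
apply/mapP/idP => [[i +]|jk].
  by rewrite mem_iota add0n => /andP[_ ik] ->; lia.
exists (`|(j + k%:Z)%R|%N); last by lia.
by rewrite mem_iota; lia.
Qed.

Lemma uniq_freqs k : uniq (freqs k).
Proof. by rewrite map_inj_uniq ?iota_uniq// => i j; lia. Qed.

Lemma sum_freqs (V : nmodType) k (F : int -> V) :
  \sum_(j <- freqs k) F j = F 0 + \sum_(1 <= i < k.+1) (F i%:Z + F (- i%:Z)).
Proof.
elim: k => [|k ih].
  by rewrite big_geq// addr0 /freqs /= big_cons big_nil addr0 subrr.
have E : perm_eq (freqs k.+1) (k.+1%:Z :: - k.+1%:Z :: freqs k).
  apply: uniq_perm; [exact: uniq_freqs| |]; last first.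
    by move=> j; rewrite mem_freqs 2!in_cons mem_freqs; lia.
  rewrite 2!cons_uniq in_cons !mem_freqs uniq_freqs andbT; apply/andP; split; lia.
rewrite big_nat_recr//= addrA -ih addrC (perm_big _ E) 2!big_cons.
exact: addrA.
Qed.

Lemma trig_eq (s : seq int) (a b : int -> R[i]) : {in s, a =1 b} -> trig s a = trig s b.
Proof.
by move=> ab; apply/funext => x; apply: eq_big_seq => j js; rewrite ab.
Qed.

(** Testing orthogonality against each [e_ l] determines the coefficients of any candidate. The
    partial Fourier sum is a candidate, so [xget] does not return its default value. *)
Lemma Pi_E k (h : R -> R[i]) : in_L2 h -> Pi_ k h = trig (freqs k) (coef h).
Proof.
move=> hL; rewrite /Pi_ /orthproj.
have pL := @in_L2_trig R (freqs k).
case: xgetP => [p _ [[a pE] ph]|].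
  rewrite pE -/(trig _ _); apply: trig_eq => l lk.
  have : inner (fun x => h x - p x) (e_ l) = 0.
    apply: ph; exists (fun j => (j == l)%:R); apply/funext => x.
    rewrite (bigD1_seq l) ?uniq_freqs//= eqxx mul1r big1 ?addr0// => j /negPf ->.
    by rewrite mul0r.
  rewrite -/(coef _ l) coefB//; last by rewrite pE; exact: pL.
  rewrite pE -/(trig _ _) coef_trig ?uniq_freqs// lk => /eqP.
  by rewrite subr_eq0 => /eqP.
move=> /(_ (trig (freqs k) (coef h))) []; split; first by exists (coef h).
move=> s [a ->]; rewrite -/(trig _ _).
have qL : in_L2 (fun x => h x - trig (freqs k) (coef h) x).
  by apply: in_L2D => //; apply: in_L2N; exact: pL.
rewrite (innerC (pL a) qL) inner_trig// big_seq big1 ?conjc0// => j jk.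
by rewrite coefB// coef_trig ?uniq_freqs// jk subrr conjc0 mulr0.
Qed.

Lemma L2norm_Pi_perp k (h : R -> R[i]) : in_L2 h ->
  L2norm (Pi_perp k h) ^+ 2 =
  L2norm h ^+ 2 - \sum_(j <- freqs k) cabs (coef h j) ^+ 2.
Proof.
move=> hL; rewrite /Pi_perp Pi_E// L2norm_distC L2norm_trigB ?uniq_freqs//.
by rewrite big1 ?add0r// => j _; rewrite subrr cabs0_sqr.
Qed.

Lemma L2norm_trig k a :
  L2norm (trig (freqs k) a : R -> R[i]) ^+ 2 = \sum_(j <- freqs k) cabs (a j) ^+ 2.
Proof.
have c0 j : coef (fun _ : R => 0 : R[i]) j = 0 by exact: inner0l.
have s0 : \sum_(j <- freqs k) cabs (coef (fun _ : R => 0 : R[i]) j) ^+ 2 = 0.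
  by rewrite big1// => j _; rewrite c0 cabs0_sqr.
have n0 : L2norm (fun _ : R => 0 : R[i]) ^+ 2 = 0.
  rewrite L2norm_sqr; under eq_Rintegral do rewrite cabs0_sqr.
  by rewrite Rintegral_cst ?mul0r//; exact: measurable_unit_itv.
have := L2norm_trigB a (uniq_freqs k) (@in_L2_0 R).
rewrite s0 n0 subrr addr0; under eq_bigr do rewrite c0 subr0.
by move=> <-; congr (L2norm _ ^+ 2); apply/funext => x; rewrite subr0.
Qed.

End projections.

(** * Circular convolution *)

Section translation.
Context {R : realType}.
Local Notation mu := (@lebesgue_measure R).
Local Open Scope ereal_scope.

Lemma measurable_addr_cst (c : R) :
  measurable_fun setT ((fun x => x + c)%R : measurableTypeR R -> measurableTypeR R).
Proof. exact: (@measurable_funD _ (measurableTypeR R) R setT id (cst c)). Qed.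

Lemma lebesgue_measure_shift (c : R) (A : set (measurableTypeR R)) : measurable A ->
  pushforward mu ((fun x => x + c)%R : measurableTypeR R -> measurableTypeR R) A = mu A.
Proof.
move=> mA; pose m := measure_function_pushforward__canonical__measure_function_Measure
  mu (measurable_addr_cst c).
apply/esym; apply: (lebesgue_measure_unique (mu := m)) => // X [[a b]] _ <-.
rewrite [RHS](_ : _ = mu (`](a - c)%R, (b - c)%R]%classic : set (measurableTypeR R))).
  rewrite !lebesgue_measure_itv/= !lte_fin ltrD2r.
  by case: ifPn => // _; congr EFin; ring.
congr (mu _); apply/seteqP; split => x /=; rewrite !in_itv/=; lra.
Qed.

Lemma ge0_integral_shift (c : R) (h : R -> \bar R) :
  measurable_fun setT h -> (forall x, 0 <= h x) ->
  \int[mu]_x h (x + c)%R = \int[mu]_x h x.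
Proof.
move=> mh h0.
pose m := measure_function_pushforward__canonical__measure_function_Measure
  mu (measurable_addr_cst c).
transitivity (\int[m]_x h x).
  by rewrite [RHS](ge0_integral_pushforward (measurable_addr_cst c)).
by apply: (@eq_measure_integral _ _ _ _ mu m) => A mA _; exact: lebesgue_measure_shift.
Qed.

Lemma ge0_integral_refl (c : R) (h : R -> \bar R) :
  measurable_fun setT h -> (forall x, 0 <= h x) ->
  \int[mu]_x h (c - x)%R = \int[mu]_x h x.
Proof.
move=> mh h0; rewrite -[RHS](ge0_integral_shift c)//.
pose k x := h (x + c)%R.
have mk : measurable_fun setT (k : measurableTypeR R -> \bar R).
  exact: (measurableT_comp mh (measurable_addr_cst c)).
have mN : measurable_fun setT (-%R : measurableTypeR R -> measurableTypeR R).
  exact: oppr_measurable.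
pose m := measure_function_pushforward__canonical__measure_function_Measure mu mN.
transitivity (\int[m]_x k x).
  rewrite [RHS](ge0_integral_pushforward mN)//; last by move=> x _; exact: h0.
  by apply: eq_integral => x _; rewrite /k /= addrC.
by apply: (@eq_measure_integral _ _ _ _ mu m) => A mA _; exact: lebesgue_measureN.
Qed.

End translation.

Section periodization.
Context {R : realType}.
Local Notation mu := (@lebesgue_measure R).
Local Notation U := (@unit_itv R : set (measurableTypeR R)).

Definition zero_ext (f : R -> R) : R -> R := f \_ U.

(** The values on (-1, 1) of the 1-periodic extension of [f]. Two terms are enough for differences
    of points of [0, 1). *)
Definition periodized (f : R -> R) : R -> R := fun z => zero_ext f z + zero_ext f (z + 1).

Lemma zero_extE f x : zero_ext f x = if (0 <= x < 1) then f x else 0.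
Proof.
rewrite /zero_ext patchE; case: ifPn => [/set_mem ->//|h].
by case: ifPn => // h'; exfalso; move: h; rewrite mem_set.
Qed.

Lemma measurable_zero_ext f : measurable_fun U f -> measurable_fun (setT : set (measurableTypeR R)) (zero_ext f).
Proof. by move=> mf; apply/(measurable_restrictT _ measurable_unit_itv). Qed.

Lemma measurable_periodized f : measurable_fun U f -> measurable_fun (setT : set (measurableTypeR R)) (periodized f).
Proof.
move=> /measurable_zero_ext mf; apply: measurable_funD => //.
exact: (measurableT_comp mf (measurable_addr_cst 1)).
Qed.

Lemma frac_unit (x : R) : -1 < x < 1 ->
  x - (Num.floor x)%:~R = if 0 <= x then x else x + 1.
Proof.
move=> /andP[x1 x2]; case: ifPn => x0.
  by rewrite (@floor_def _ _ 0) ?subr0// add0r x0 x2.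
rewrite (@floor_def _ _ (-1)) ?opprK// addNr; move: x0; rewrite -ltNge => ->.
by rewrite (ltW x1).
Qed.

Lemma periodizedE f (y s : R) : 0 <= y < 1 -> 0 <= s < 1 ->
  f (y - s - (Num.floor (y - s))%:~R) = periodized f (y - s).
Proof.
move=> /andP[y0 y1] /andP[s0 s1]; rewrite frac_unit; last by lra.
rewrite /periodized !zero_extE; case: (leP 0 (y - s)) => h /=.
  rewrite (_ : _ < 1 = true); last by lra.
  by rewrite [X in if X then _ else 0](_ : _ = false) ?addr0//; apply/negbTE; lra.
rewrite add0r (_ : (0 <= y - s + 1 < 1) = true)//; lra.
Qed.

(** The two summands have disjoint supports, so the cross term vanishes. *)
Lemma periodized_sqr f z : periodized f z ^+ 2 = zero_ext f z ^+ 2 + zero_ext f (z + 1) ^+ 2.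
Proof.
rewrite /periodized !zero_extE; case: ifPn => h1; case: ifPn => h2; rewrite ?addr0 ?add0r ?expr0n ?addr0 ?add0r//.
by exfalso; lra.
Qed.

Lemma integral_zero_ext (k : R -> R) :
  (\int[mu]_(x in U) (k x)%:E = \int[mu]_x (zero_ext k x)%:E)%E.
Proof. by rewrite integral_mkcond; apply: eq_integral => x _; rewrite /zero_ext restrict_EFin. Qed.

(** Invariance of the circle under [s -> y - s]. On the line the integrand splits into [A] and [B],
    reflected about different points; for [x] and [y] in [0, 1) exactly one of [y - x] and
    [y + 1 - x] lies in [0, 1), so the pieces recombine. *)
Lemma ge0_integral_periodized_refl (h : R -> R) (y : R) : 0 <= y < 1 ->
  measurable_fun U h -> (forall x, U x -> 0 <= h x) ->
  (\int[mu]_(s in U) (periodized h (y - s))%:E = \int[mu]_(x in U) (h x)%:E)%E.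
Proof.
move=> y01 mh h0.
have h00 x : 0 <= zero_ext h x by rewrite zero_extE; case: ifPn => // /h0.
have mh0 := measurable_zero_ext mh.
pose u (z : R) : R := if 0 <= z < 1 then 1 else 0.
have u0 z : 0 <= u z by rewrite /u; case: ifPn.
have mu_ : measurable_fun (setT : set (measurableTypeR R)) u.
  have m1 : measurable_fun U (fun=> 1 : R) by exact: measurable_cst.
  have := measurable_zero_ext m1.
  by congr measurable_fun; apply/funext => x; rewrite zero_extE.
rewrite [RHS]integral_zero_ext.
pose A (x : R) : \bar R := (zero_ext h x * u (y - x))%:E.
pose B (x : R) : \bar R := (zero_ext h x * u (y + 1 - x))%:E.
have mcu c : measurable_fun (setT : set (measurableTypeR R)) (fun x => u (c - x)).
  apply: (measurableT_comp mu_).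
  exact: (@measurable_funB _ (measurableTypeR R) R setT (cst c) id).
have mA : measurable_fun (setT : set (measurableTypeR R)) A.
  by apply/measurable_EFinP; apply: measurable_funM.
have mB : measurable_fun (setT : set (measurableTypeR R)) B.
  by apply/measurable_EFinP; apply: measurable_funM.
have A0 x : (0 <= A x)%E by rewrite lee_fin mulr_ge0.
have B0 x : (0 <= B x)%E by rewrite lee_fin mulr_ge0.
transitivity (\int[mu]_s (A (y - s)%R + B (y + 1 - s)%R))%E.
  rewrite integral_mkcond; apply: eq_integral => s _.
  rewrite patchE /A /B -EFinD /periodized !subKr.
  case: ifPn => [/set_mem Us|Us].
    by rewrite /u Us !mulr1 addrAC.
  by rewrite /u ifF ?mulr0 ?addr0//; apply/negP => Us'; move: Us; rewrite mem_set.
rewrite ge0_integralD//; last 2 first.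
- by apply: (measurableT_comp mA); exact: (@measurable_funB _ (measurableTypeR R) R setT (cst y) id).
- by apply: (measurableT_comp mB); exact: (@measurable_funB _ (measurableTypeR R) R setT (cst (y + 1)) id).
rewrite (ge0_integral_refl y mA A0) (ge0_integral_refl (y + 1) mB B0).
rewrite -ge0_integralD//; apply: eq_integral => x _.
rewrite /A /B -EFinD; congr EFin; rewrite -mulrDr zero_extE.
case: ifPn => [/andP[x0 x1]|_]; last by rewrite mul0r.
move: y01 => /andP[y0 y1]; rewrite (_ : u _ + u _ = 1) ?mulr1// /u.
by case: ifPn => h1; case: ifPn => h2; rewrite ?addr0 ?add0r//; exfalso; move: h1 h2; lra.
Qed.

(** Invariance of the circle under rotation by [s], with the splitting used for the reflection;
    periodicity of [k] lets the two translated pieces share the factor [k (x + s)]. *)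
Lemma ge0_integral_periodized_shift (h k : R -> R) (s : R) : 0 <= s < 1 ->
  measurable_fun U h -> (forall x, U x -> 0 <= h x) ->
  measurable_fun (setT : set (measurableTypeR R)) k -> (forall x, 0 <= k x) -> (forall x, k (x + 1) = k x) ->
  (\int[mu]_(y in U) (periodized h (y - s) * k y)%:E =
   \int[mu]_(x in U) (h x * k (x + s)%R)%:E)%E.
Proof.
move=> s01 mh h0 mk k0 kp.
have h00 x : 0 <= zero_ext h x by rewrite zero_extE; case: ifPn => // /h0.
have mh0 := measurable_zero_ext mh.
have e0 x : zero_ext (fun x => h x * k (x + s)) x = zero_ext h x * k (x + s).
  by rewrite !zero_extE; case: ifPn; rewrite ?mul0r.
rewrite [RHS]integral_zero_ext.
pose u (z : R) : R := if 0 <= z < 1 then 1 else 0.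
have u0 z : 0 <= u z by rewrite /u; case: ifPn.
have mu_ : measurable_fun (setT : set (measurableTypeR R)) u.
  have m1 : measurable_fun U (fun=> 1 : R) by exact: measurable_cst.
  have := measurable_zero_ext m1.
  by congr measurable_fun; apply/funext => x; rewrite zero_extE.
pose A (x : R) : \bar R := (zero_ext h x * (u (x + s) * k (x + s)))%:E.
pose B (x : R) : \bar R := (zero_ext h x * (u (x + (s - 1)) * k (x + (s - 1))))%:E.
have mck c : measurable_fun (setT : set (measurableTypeR R)) (fun x => u (x + c) * k (x + c)).
  by apply: measurable_funM; [apply: (measurableT_comp mu_)|apply: (measurableT_comp mk)];
    exact: measurable_addr_cst.
have mA : measurable_fun (setT : set (measurableTypeR R)) A.
  by apply/measurable_EFinP; apply: measurable_funM.
have mB : measurable_fun (setT : set (measurableTypeR R)) B.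
  by apply/measurable_EFinP; apply: measurable_funM.
have A0 x : (0 <= A x)%E by rewrite lee_fin !mulr_ge0.
have B0 x : (0 <= B x)%E by rewrite lee_fin !mulr_ge0.
transitivity (\int[mu]_y (A (y + - s)%R + B (y + (1 - s))%R))%E.
  rewrite integral_mkcond; apply: eq_integral => y _.
  rewrite patchE /A /B -EFinD /periodized.
  rewrite (_ : y - s + s = y) ?subrK// (_ : y + (1 - s) + (s - 1) = y); last by ring.
  rewrite (_ : y + (1 - s) = y - s + 1); last by ring.
  case: ifPn => [/set_mem Us|Us].
    by rewrite /u Us !mul1r mulrDl.
  by rewrite /u ifF ?mul0r ?mulr0 ?addr0//; apply/negP => Us'; move: Us; rewrite mem_set.
rewrite ge0_integralD//; last 2 first.
- by apply: (measurableT_comp mA); exact: measurable_addr_cst.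
- by apply: (measurableT_comp mB); exact: measurable_addr_cst.
rewrite (ge0_integral_shift (- s) mA A0) (ge0_integral_shift (1 - s) mB B0).
rewrite -ge0_integralD//; apply: eq_integral => x _.
rewrite e0 /A /B -EFinD; congr EFin; rewrite -mulrDr zero_extE.
case: ifPn => [/andP[x0 x1]|_]; last by rewrite !mul0r.
congr (_ * _); have -> : k (x + (s - 1)) = k (x + s) by rewrite -kp; congr k; ring.
move: s01 => /andP[s0 s1]; rewrite -mulrDl (_ : u _ + u _ = 1) ?mul1r// /u.
by case: ifPn => h1; case: ifPn => h2; rewrite ?addr0 ?add0r//; exfalso; move: h1 h2; lra.
Qed.

End periodization.

Section convolution.
Context {R : realType}.
Local Notation mu := (@lebesgue_measure R).
Local Notation U := (@unit_itv R : set (measurableTypeR R)).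
Local Notation LR := (measurableTypeR R).

Lemma integral_sqr_density (f : R -> R) : in_L2 (toC f) ->
  (\int[mu]_(x in U) (f x ^+ 2)%:E = (L2norm (toC f) ^+ 2)%:E)%E.
Proof.
move=> fL; have /in_L2P[[_ if2] _] := fL.
rewrite L2norm_sqr /Rintegral fineK; last first.
  have := integrable_fin_num measurable_unit_itv if2.
  by congr (_ \is a fin_num); apply: eq_integral => x _; rewrite cabsE /= expr0n addr0.
by apply: eq_integral => x _; rewrite cabsE /= expr0n addr0.
Qed.

Variables f phi : R -> R.
Hypotheses (df : density_L2 f) (dphi : density_L2 phi).
Local Notation g := (cconv f phi).

Let mf : measurable_fun U f. Proof. by case: df. Qed.
Let mphi : measurable_fun U phi. Proof. by case: dphi. Qed.
Let f0 x : U x -> 0 <= f x. Proof. by case: df => _ + _ _; exact. Qed.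
Let phi0 x : U x -> 0 <= phi x. Proof. by case: dphi => _ + _ _; exact. Qed.

Lemma periodized_ge0 z : 0 <= periodized f z.
Proof. by rewrite /periodized !zero_extE addr_ge0//; case: ifPn => // /f0. Qed.

Lemma measurable_periodized_subr y : measurable_fun (setT : set LR) (fun s => periodized f (y - s)).
Proof.
apply: (measurableT_comp (measurable_periodized mf)).
exact: (@measurable_funB _ LR R setT (cst y) id).
Qed.

Definition conv_bound : R := L2norm (toC f) ^+ 2 + L2norm (toC phi) ^+ 2.

Lemma conv_bound_ge0 : 0 <= conv_bound.
Proof. by rewrite addr_ge0 ?sqr_ge0. Qed.

(** Pointwise [a b <= a^2 + b^2]. The square of the periodization is the periodization of the
    square, whose integral in [s] is [||f||^2] whatever [y] is. *)
Lemma integral_periodized_mul_le y : U y ->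
  (\int[mu]_(s in U) (periodized f (y - s) * phi s)%:E <= conv_bound%:E)%E.
Proof.
move=> Uy.
have fL : in_L2 (toC f) by case: df.
have pL : in_L2 (toC phi) by case: dphi.
have mp := measurable_funTS (measurable_periodized_subr y) : measurable_fun U _.
rewrite /conv_bound EFinD -!integral_sqr_density//.
rewrite -(ge0_integral_periodized_refl (h := fun x => f x ^+ 2) Uy); last 2 first.
- exact: measurable_funX.
- by move=> x _; exact: sqr_ge0.
have p2 z : periodized (fun x => f x ^+ 2) z = periodized f z ^+ 2.
  by rewrite periodized_sqr /periodized !zero_extE; case: ifPn; case: ifPn; rewrite ?expr0n.
rewrite [X in (_ <= X + _)%E](_ : _ = \int[mu]_(s in U) (periodized f (y - s) ^+ 2)%:E)%E;
  last by apply: eq_integral => s _; rewrite p2.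
rewrite -ge0_integralD//; last 4 first.
- by move=> x _; rewrite lee_fin sqr_ge0.
- by apply/measurable_EFinP; exact: measurable_funX.
- by move=> x _; rewrite lee_fin sqr_ge0.
- by apply/measurable_EFinP; exact: measurable_funX.
apply: ge0_le_integral => //.
- by move=> s Us; rewrite lee_fin mulr_ge0 ?periodized_ge0// phi0.
- by apply/measurable_EFinP; exact: measurable_funM.
- by apply/measurable_EFinP; apply: measurable_funD; exact: measurable_funX.
- move=> s Us; rewrite -EFinD lee_fin.
  have := sqr_ge0 (periodized f (y - s) - phi s); have := mulr_ge0 (periodized_ge0 (y - s)) (phi0 Us).
  by rewrite sqrrB; lra.
Qed.

Lemma integral_periodized_mul_ge0 y : (0 <= \int[mu]_(s in U) (periodized f (y - s) * phi s)%:E)%E.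
Proof. by apply: integral_ge0 => s Us; rewrite lee_fin mulr_ge0 ?periodized_ge0// phi0. Qed.

Lemma cconvE y : U y ->
  ((g y)%:E = \int[mu]_(s in U) (periodized f (y - s) * phi s)%:E)%E.
Proof.
move=> Uy; rewrite /cconv /Rintegral.
have E : (\int[mu]_(s in U) (f (y - s - (Num.floor (y - s))%:~R) * phi s)%:E =
  \int[mu]_(s in U) (periodized f (y - s) * phi s)%:E)%E.
  by apply: eq_integral => s /set_mem Us; rewrite periodizedE.
rewrite [X in fine X]E fineK// ge0_fin_numE ?integral_periodized_mul_ge0//.
by apply: le_lt_trans (integral_periodized_mul_le Uy) _; rewrite ltry.
Qed.

Lemma cconv_ge0 y : U y -> 0 <= g y.
Proof. by move=> Uy; rewrite -lee_fin cconvE// integral_periodized_mul_ge0. Qed.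

Lemma cconv_le y : U y -> g y <= conv_bound.
Proof. by move=> Uy; rewrite -lee_fin cconvE// integral_periodized_mul_le. Qed.

Let u z : R := zero_ext (cst 1) z.
Let u0 z : 0 <= u z. Proof. by rewrite /u zero_extE; case: ifPn. Qed.
Let mu_ : measurable_fun (setT : set LR) u.
Proof. by apply: measurable_zero_ext; exact: measurable_cst. Qed.

(** The integrand of the double integral of [g k], extended by zero to the plane so that Tonelli
    applies without domain restrictions. *)
Let H (k : R -> R) (z : LR * LR) : \bar R :=
  (u z.1 * k z.1 * (periodized f (z.1 - z.2) * zero_ext phi z.2))%:E.

Let mH k : measurable_fun (setT : set LR) k -> measurable_fun setT (H k).
Proof.
move=> mk; apply/measurable_EFinP; apply: measurable_funM.
  apply: measurable_funM; first exact: (measurableT_comp mu_ measurable_fst).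
  exact: (measurableT_comp mk measurable_fst).
apply: measurable_funM; last exact: (measurableT_comp (measurable_zero_ext mphi) measurable_snd).
apply: (measurableT_comp (measurable_periodized mf)).
exact: (@measurable_funB _ (LR * LR)%type R setT fst snd).
Qed.

Let H0 k : (forall x, 0 <= k x) -> forall z, (0 <= H k z)%E.
Proof.
move=> k0 z; rewrite lee_fin !mulr_ge0 ?periodized_ge0// zero_extE.
by case: ifPn => // /phi0.
Qed.

Lemma integral_cconv_section (k : R -> R) (y : R) :
  (forall x, 0 <= k x) ->
  ((zero_ext (fun y => g y * k y) y)%:E = \int[mu]_s H k (y, s))%E.
Proof.
move=> k0; rewrite zero_extE; case: ifPn => Uy; last first.
  rewrite (eq_integral (cst 0%E)) ?integral0// => s _.
  by rewrite /H /u /= zero_extE (negPf Uy) !mul0r.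
rewrite EFinM cconvE// muleC -ge0_integralZl_EFin//; last 2 first.
- by move=> s Us; rewrite lee_fin mulr_ge0 ?periodized_ge0// phi0.
- apply/measurable_EFinP; apply: measurable_funM => //.
  exact: measurable_funTS (measurable_periodized_subr y).
under eq_integral do rewrite -EFinM.
rewrite integral_zero_ext; apply: eq_integral => s _; rewrite /H /u /= !zero_extE Uy mul1r.
by case: ifPn; rewrite ?mulr0.
Qed.

Lemma measurable_cconv : measurable_fun U g.
Proof.
have m1 : measurable_fun (setT : set LR) (cst 1 : R -> R) by exact: measurable_cst.
have k0 (x : R) : 0 <= cst 1 x :> R by [].
have := @measurable_fun_fubini_tonelli_F _ _ _ _ _ mu (H (cst 1)) (mH m1) (H0 k0).
move=> mF; have : measurable_fun U (fun y => fine (fubini_F mu (H (cst 1)) y)).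
  by apply: measurable_funTS; apply: measurableT_comp mF.
apply: eq_measurable_fun => y /set_mem Uy.
rewrite /fubini_F -integral_cconv_section//= zero_extE.
by rewrite mulr1 (_ : (0 <= y < 1) = true).
Qed.

(** Tonelli followed by rotation invariance in the inner integral: [g] is the law of a sum modulo 1,
    tested against a periodic [k]. *)
Lemma integral_cconv_mul (k : R -> R) :
  measurable_fun (setT : set LR) k -> (forall x, 0 <= k x) -> (forall x, k (x + 1) = k x) ->
  (\int[mu]_(y in U) (g y * k y)%:E =
   \int[mu]_(s in U) ((phi s)%:E * \int[mu]_(x in U) (f x * k (x + s)%R)%:E))%E.
Proof.
move=> mk k0 kp; rewrite integral_zero_ext.
under eq_integral do rewrite integral_cconv_section//.
rewrite (fubini_tonelli (H k) (mH mk) (H0 k0)) [RHS]integral_mkcond.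
apply: eq_integral => s _; rewrite patchE.
case: ifPn => [/set_mem Us|Us]; last first.
  rewrite (eq_integral (cst 0%E)) ?integral0// => y _.
  rewrite /H /= [zero_ext phi s]zero_extE ifF ?mulr0//.
  by apply/negP => Us'; move: Us; rewrite mem_set.
rewrite -(ge0_integral_periodized_shift Us mf f0 mk k0 kp) -ge0_integralZl_EFin//; last 3 first.
- by move=> y _; rewrite lee_fin mulr_ge0 ?periodized_ge0.
- apply/measurable_EFinP; apply: measurable_funM; last exact: measurable_funTS.
  apply: measurable_funTS; apply: (measurableT_comp (measurable_periodized mf)).
  exact: measurable_addr_cst.
- exact: phi0.
under [RHS]eq_integral do rewrite -EFinM.
rewrite [RHS]integral_zero_ext; apply: eq_integral => y _; rewrite /H /u !zero_extE /=.
have -> : (0 <= s < 1) = true by [].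
by case: ifPn => _; rewrite ?mul0r// mul1r; congr EFin; ring.
Qed.

End convolution.

(** * Fourier coefficients of densities and of their convolution *)

Section coef_convolution.
Context {R : realType}.
Local Notation mu := (@lebesgue_measure R).
Local Notation U := (@unit_itv R : set (measurableTypeR R)).
Local Notation LR := (measurableTypeR R).

Lemma integrable_mul_bounded (h k : R -> R) (M : R) : mu.-integrable U (EFin \o h) ->
  measurable_fun (setT : set LR) k -> (forall x, `|k x| <= M) ->
  mu.-integrable U (EFin \o (fun x => h x * k x)).
Proof.
move=> ih mk kM.
apply: (le_integrable measurable_unit_itv _ _ (integrableZl measurable_unit_itv M ih)).
  apply/measurable_EFinP; apply: measurable_funM; last exact: measurable_funTS.
  by apply/measurable_EFinP; exact: (measurable_int _ ih).
move=> x _ /=; rewrite lee_fin !normrM mulrC ler_wpM2r//.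
by apply: le_trans (kM x) _; rewrite ler_norm.
Qed.

Lemma integral_mul_cos_sin (h : R -> R) (a A B D : R) :
  mu.-integrable U (EFin \o h) ->
  (\int[mu]_(x in U) (h x * (A + B * cos (a * x) + D * sin (a * x)))%:E =
   (A * \int[mu]_(x in U) h x + B * \int[mu]_(x in U) (h x * cos (a * x))
     + D * \int[mu]_(x in U) (h x * sin (a * x)))%:E)%E.
Proof.
move=> ih.
have ic : mu.-integrable U (EFin \o (fun x => h x * cos (a * x))).
  apply: (integrable_mul_bounded (M := 1)) => //; first exact: measurable_cosM.
  by move=> x; rewrite ler_norml cos_geN1 cos_le1.
have isn : mu.-integrable U (EFin \o (fun x => h x * sin (a * x))).
  apply: (integrable_mul_bounded (M := 1)) => //; first exact: measurable_sinM.
  by move=> x; rewrite ler_norml sin_geN1 sin_le1.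
have iA := integrableZl measurable_unit_itv A ih.
have iB := integrableZl measurable_unit_itv B ic.
have iD := integrableZl measurable_unit_itv D isn.
rewrite -!RintegralZl// -RintegralD// -RintegralD//;
  last exact: (integrableD measurable_unit_itv iA iB).
rewrite /Rintegral fineK; last first.
  exact: (integrable_fin_num measurable_unit_itv (integrableD measurable_unit_itv (integrableD measurable_unit_itv iA iB) iD)).
by apply: eq_integral => x _; congr EFin; ring.
Qed.

Lemma integrable_density (f : R -> R) : density_L2 f ->
  mu.-integrable U (EFin \o f) /\ \int[mu]_(x in U) f x = 1.
Proof.
move=> [mf f0 f1 _]; split; last by rewrite /Rintegral f1.
apply/integrableP; split; first exact/measurable_EFinP.
have -> : (\int[mu]_(x in U) `|(EFin \o f) x| = \int[mu]_(x in U) (f x)%:E)%E.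
  by apply: eq_integral => x /set_mem Ux; rewrite /= ger0_norm// f0.
by rewrite [X in (X < _)%E]f1 ltry.
Qed.

Lemma Re_coef (f : R -> R) j : Re (coef (toC f) j) =
  \int[mu]_(x in U) (f x * cos (2 * pi * j%:~R * x)).
Proof.
by apply: eq_Rintegral => x _ /=; rewrite mul0r subr0 cosN.
Qed.

Lemma Im_coef (f : R -> R) j : Im (coef (toC f) j) =
  \int[mu]_(x in U) (f x * sin (2 * pi * j%:~R * x)).
Proof.
by apply: eq_Rintegral => x _ /=; rewrite mul0r addr0 sinN opprK.
Qed.

Lemma coef_opp (f : R -> R) j : density_L2 f ->
  coef (toC f) (- j) = conjc (coef (toC f) j).
Proof.
move=> /integrable_density[fi _].
apply/eqP; rewrite eq_complex; apply/andP; split; apply/eqP.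
  rewrite [RHS](_ : _ = Re (coef (toC f) j)); last by case: (coef _ _).
  rewrite !Re_coef; apply: eq_Rintegral => x _.
  by rewrite mulrNz mulrN mulNr cosN.
rewrite [RHS](_ : _ = - Im (coef (toC f) j)); last by case: (coef _ _).
rewrite !Im_coef -[RHS]mulN1r -RintegralZl//.
  by apply: eq_Rintegral => x _; rewrite mulrNz mulrN mulNr sinN mulrN mulN1r.
apply: (integrable_mul_bounded (M := 1)) => //; first exact: measurable_sinM.
by move=> x; rewrite ler_norml sin_geN1 sin_le1.
Qed.

Variables f phi : R -> R.
Hypotheses (df : density_L2 f) (dphi : density_L2 phi).
Local Notation g := (cconv f phi).

(** The conditions on [a] make the test function 1-periodic, its sign brings it under
    [integral_cconv_mul], and the addition formulas separate [x] from [s]. *)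
Lemma integral_cconv_trig (a A B D : R) : cos a = 1 -> sin a = 0 ->
  (forall x, 0 <= A + B * cos (a * x) + D * sin (a * x)) ->
  (\int[mu]_(y in U) (g y * (A + B * cos (a * y) + D * sin (a * y)))%:E =
   (let Cf := \int[mu]_(x in U) (f x * cos (a * x)) in
    let Sf := \int[mu]_(x in U) (f x * sin (a * x)) in
    let Cp := \int[mu]_(x in U) (phi x * cos (a * x)) in
    let Sp := \int[mu]_(x in U) (phi x * sin (a * x)) in
    A + B * (Cf * Cp - Sf * Sp) + D * (Sf * Cp + Cf * Sp))%:E)%E.
Proof.
move=> ca sa k0; set k := fun x => A + B * cos (a * x) + D * sin (a * x).
have [fi f1] := integrable_density df; have [pi_ p1] := integrable_density dphi.
have mk : measurable_fun (setT : set LR) k.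
  apply: measurable_funD; first apply: measurable_funD; first exact: measurable_cst.
    by apply: measurable_funM; [exact: measurable_cst|exact: measurable_cosM].
  by apply: measurable_funM; [exact: measurable_cst|exact: measurable_sinM].
have kp x : k (x + 1) = k x.
  rewrite /k mulrDr mulr1 cosD sinD ca sa; ring.
rewrite (integral_cconv_mul df dphi mk k0 kp).
pose Cf := \int[mu]_(x in U) (f x * cos (a * x)).
pose Sf := \int[mu]_(x in U) (f x * sin (a * x)).
pose Cp := \int[mu]_(x in U) (phi x * cos (a * x)).
pose Sp := \int[mu]_(x in U) (phi x * sin (a * x)).
rewrite [RHS](_ : _ = (A + B * (Cf * Cp - Sf * Sp) + D * (Sf * Cp + Cf * Sp))%:E)//.
transitivity (\int[mu]_(s in U) (phi s * (A + (B * Cf + D * Sf) * cos (a * s)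
    + (D * Cf - B * Sf) * sin (a * s)))%:E)%E; last first.
  by rewrite integral_mul_cos_sin// p1 mulr1 -/Cp -/Sp; congr EFin; ring.
apply: eq_integral => s _; rewrite EFinM; congr (_ * _)%E.
transitivity (\int[mu]_(x in U) (f x * (A + (B * cos (a * s) + D * sin (a * s)) * cos (a * x)
    + (D * cos (a * s) - B * sin (a * s)) * sin (a * x)))%:E)%E; last first.
  by rewrite integral_mul_cos_sin// f1 mulr1 -/Cf -/Sf; congr EFin; ring.
by apply: eq_integral => x _; rewrite /k (mulrDr a) cosD sinD; congr EFin; ring.
Qed.

Lemma integrable_cconv : mu.-integrable U (EFin \o g) /\ \int[mu]_(x in U) g x = 1.
Proof.
have h : (\int[mu]_(y in U) (g y)%:E = 1)%E.
  transitivity (\int[mu]_(y in U) (g y * (1 + 0 * cos (0 * y) + 0 * sin (0 * y)))%:E)%E.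
    by apply: eq_integral => y _; rewrite !mul0r !addr0 mulr1.
  rewrite integral_cconv_trig ?cos0 ?sin0//=.
  by rewrite !mul0r !addr0.
split; last by rewrite /Rintegral h.
apply/integrableP; split; first by apply/measurable_EFinP; exact: measurable_cconv.
have -> : (\int[mu]_(x in U) `|(EFin \o g) x| = \int[mu]_(x in U) (g x)%:E)%E.
  by apply: eq_integral => x /set_mem Ux; rewrite /= ger0_norm// cconv_ge0.
by rewrite [X in (X < _)%E]h ltry.
Qed.

(** The nonnegative test functions [1 + cos] and [1 + sin] yield the real and the imaginary part;
    the contribution of the constant 1 cancels because [g], [f] and [phi] have mass 1. *)
Lemma coef_cconv j : coef (toC g) j = coef (toC f) j * coef (toC phi) j.
Proof.
have [ca sa] := @cos_sin_2pi_int R j.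
have [gi g1] := integrable_cconv.
apply/eqP; rewrite eq_complex; apply/andP; split; apply/eqP.
  have k0 (x : R) : 0 <= 1 + 1 * cos (2 * pi * j%:~R * x) + 0 * sin (2 * pi * j%:~R * x).
    by rewrite mul0r addr0; have := cos_geN1 (2 * pi * j%:~R * x); lra.
  have := integral_cconv_trig ca sa k0.
  rewrite integral_mul_cos_sin// g1 => h; move: (EFin_inj h); rewrite -!Re_coef -!Im_coef.
  by move: (coef (toC g) j) (coef (toC f) j) (coef (toC phi) j) => [? ?] [? ?] [? ?] /=; lra.
have k0 (x : R) : 0 <= 1 + 0 * cos (2 * pi * j%:~R * x) + 1 * sin (2 * pi * j%:~R * x).
  by rewrite mul0r addr0; have := sin_geN1 (2 * pi * j%:~R * x); lra.
have := integral_cconv_trig ca sa k0.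
rewrite integral_mul_cos_sin// g1 => h; move: (EFin_inj h); rewrite -!Re_coef -!Im_coef.
by move: (coef (toC g) j) (coef (toC f) j) (coef (toC phi) j) => [? ?] [? ?] [? ?] /=; lra.
Qed.

End coef_convolution.

(** * The noise of the estimators *)

Section law.
Context {R : realType}.
Local Notation mu := (@lebesgue_measure R).
Local Notation U := (@unit_itv R : set (measurableTypeR R)).
Local Notation LR := (measurableTypeR R).

Lemma integral_density (nu : probability R R) (g h : R -> R) :
  measurable_fun U g -> (forall x, U x -> 0 <= g x) ->
  (forall A, measurable A -> nu A = \int[mu]_(y in A `&` U) (g y)%:E)%E ->
  measurable_fun setT h -> (forall x, 0 <= h x) ->
  (\int[nu]_y (h y)%:E = \int[mu]_(y in U) (h y * g y)%:E)%E.
Proof.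
move=> mg g0 nuE mh h0.
have mg0 := measurable_zero_ext mg.
have g00 x : 0 <= zero_ext g x by rewrite zero_extE; case: ifPn => // /g0.
(* layer cake: [h y] is the length of [{t | 0 <= t < h y}], then exchange integrals *)
pose b (y t : R) : bool := (0 <= t) && (t < h y).
pose I (y t : R) : R := if b y t then 1 else 0.
have I0 y t : 0 <= I y t by rewrite /I; case: ifP.
have mI : measurable_fun setT (fun z : R * LR => (I z.1 z.2)%:E).
  apply/measurable_EFinP; apply: measurable_fun_ifT => //.
  apply: measurable_and.
    by apply: measurable_fun_ler => //; exact: measurable_snd.
  apply: measurable_fun_ltr; first exact: measurable_snd.
  exact: (measurableT_comp mh measurable_fst).
have mIg : measurable_fun setT (fun z : LR * LR => (I z.1 z.2 * zero_ext g z.1)%:E).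
  apply/measurable_EFinP; apply: measurable_funM.
    by apply/measurable_EFinP; exact: mI.
  exact: (measurableT_comp mg0 measurable_fst).
have intI y : (\int[mu]_t (I y t)%:E = (h y)%:E)%E.
  have <- : mu (`[0, h y[%classic : set LR) = (h y)%:E.
    rewrite lebesgue_measure_itv/= lte_fin oppr0 adde0.
    by case: ltP => // hy; congr EFin; apply/eqP; rewrite eq_le hy h0.
  rewrite -[in RHS](setIT `[0, h y[%classic) -integral_indic//; apply: eq_integral => t _.
  by rewrite indicE /I /b; congr EFin; case: ifPn => ht;
    [rewrite mem_set//= in_itv|rewrite memNset//= in_itv; apply/negP].
under eq_integral do rewrite -intI.
rewrite (fubini_tonelli (fun z : R * LR => (I z.1 z.2)%:E) mI)//; last first.
  by move=> z; rewrite lee_fin.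
transitivity (\int[mu]_t \int[mu]_y (I y t * zero_ext g y)%:E)%E.
  apply: eq_integral => t _ /=.
  pose A := [set y | b y t].
  have mA : measurable (A : set R).
    have mb : measurable_fun setT (fun y => b y t).
      apply: measurable_and; first exact: measurable_cst.
      by apply: measurable_fun_ltr => //; exact: measurable_cst.
    by have := mb measurableT [set true] Logic.I; rewrite setTI.
  transitivity (nu A).
    rewrite -(setIT A) -integral_indic//; apply: eq_integral => y _.
    by rewrite indicE /I; congr EFin; case: ifPn => hb;
      [rewrite mem_set|rewrite memNset//; apply/negP].
  rewrite nuE// integral_mkcond; apply: eq_integral => y _.
  rewrite patchE zero_extE /I; case: ifPn => [/set_mem[/= -> /= ->]|h1]; first by rewrite mul1r.
  case: ifPn; rewrite ?mul0r//; case: ifPn; rewrite ?mulr0// => h2 h3.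
  by exfalso; move: h1; rewrite mem_set.
rewrite -(fubini_tonelli (fun z : LR * LR => (I z.1 z.2 * zero_ext g z.1)%:E) mIg)//; last first.
  by move=> z; rewrite lee_fin mulr_ge0.
rewrite [RHS]integral_zero_ext; apply: eq_integral => y _ /=.
under eq_integral do rewrite mulrC EFinM.
rewrite ge0_integralZl_EFin//; last 2 first.
- by move=> t _; rewrite lee_fin.
- have mp : measurable_fun setT (fun t : LR => (y : R, t)).
    by apply: measurable_fun_pair => //; exact: measurable_cst.
  exact: (measurableT_comp mI mp).
rewrite intI -EFinM !zero_extE; case: ifPn; rewrite ?mul0r// => _.
by rewrite mulrC.
Qed.
End law.

(** * Length and variance of the noise vector of one observation *)

Section noise.
Context {R : realType}.
Local Notation mu := (@lebesgue_measure R).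
Local Notation U := (@unit_itv R : set (measurableTypeR R)).
Local Notation LR := (measurableTypeR R).

Variables f phi : R -> R.
Hypotheses (df : density_L2 f) (dphi : density_L2 phi).
Local Notation g := (cconv f phi).
Local Notation v := (v_ phi).

Lemma v_ge0 j : 0 <= v j.
Proof. by rewrite /v_ invr_ge0 sqr_ge0. Qed.

Lemma coef0_density (h : R -> R) : density_L2 h -> coef (toC h) 0 = 1.
Proof.
move=> dh; have [_ h1] := integrable_density dh.
apply/eqP; rewrite eq_complex; apply/andP; split; apply/eqP.
  rewrite Re_coef -[RHS]h1; apply: eq_Rintegral => x _.
  by rewrite mulr0 mul0r cos0 mulr1.
rewrite Im_coef; transitivity (\int[mu]_(x in U) (0 : R)).
  by apply: eq_Rintegral => x _; rewrite mulr0 mul0r sin0 mulr0.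
by rewrite (Rintegral_cst _ measurable_unit_itv) mul0r.
Qed.

Lemma le_vmax j k : (j <= k)%N -> v j <= vmax phi k.
Proof.
move=> jk; rewrite /vmax (_ : j = @Ordinal k.+1 j jk)//.
exact: (le_bigmax _ (fun j : 'I_k.+1 => v j)).
Qed.

Lemma vmax_ge1 k : 1 <= vmax phi k.
Proof.
apply: le_trans (le_vmax (leq0n k)).
by rewrite /v_ coef0_density// cabsE /= expr1n expr0n addr0 invr1.
Qed.

Let rg (j : nat) := Re (coef (toC g) j%:Z).
Let ig (j : nat) := Im (coef (toC g) j%:Z).

(* the variance of [e_j(Y)], with [Y] of density [g], is [1 - |g_j|^2] *)
Lemma cabs_coef_cconv_le1 (j : nat) : rg j ^+ 2 + ig j ^+ 2 <= 1.
Proof.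
have [gi g1] := integrable_cconv df dphi.
(* With [cos^2 + sin^2 = 1] these coefficients expand [(cos - rg)^2 + (sin - ig)^2]; its integral
   against [g] is nonnegative and equals [1 - rg^2 - ig^2]. *)
have := integral_mul_cos_sin (2 * pi * j%:~R) (1 + rg j ^+ 2 + ig j ^+ 2)
   (- 2 * rg j) (- 2 * ig j) gi.
rewrite g1 -Re_coef -Im_coef -/(rg j) -/(ig j) => h.
have : (0 <= (1 - (rg j ^+ 2 + ig j ^+ 2))%:E)%E.
  rewrite [X in X%:E](_ : _ = (1 + rg j ^+ 2 + ig j ^+ 2) * 1 + - 2 * rg j * rg j + - 2 * ig j * ig j); last by ring.
  rewrite -h; apply: integral_ge0 => x Ux; rewrite lee_fin.
  apply: mulr_ge0; first exact: cconv_ge0.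
  have := cos2Dsin2 (2 * pi * j%:~R * x).
  set c := cos _; set s := sin _.
  have := sqr_ge0 (c - rg j); have := sqr_ge0 (s - ig j); rewrite !sqrrB; lra.
by rewrite lee_fin subr_ge0.
Qed.

Section fixed_k.

Variable k : nat.

(* [p = (i, b)] is the frequency [i + 1] with its cosine ([b = true]) or sine part *)
Definition noise_basis (p : 'I_k * bool) (y : R) : R :=
  Num.sqrt (v p.1.+1) *
  (if p.2 then cos (2 * pi * p.1.+1%:~R * y) else sin (2 * pi * p.1.+1%:~R * y)).

Definition noise_mean (p : 'I_k * bool) : R :=
  Num.sqrt (v p.1.+1) * (if p.2 then rg p.1.+1 else ig p.1.+1).

Definition noise (p : 'I_k * bool) (y : R) : R := noise_basis p y - noise_mean p.

Lemma measurable_noise_basis p : measurable_fun setT (noise_basis p).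
Proof.
apply: measurable_funM; first exact: measurable_cst.
by case: p.2; [exact: measurable_cosM|exact: measurable_sinM].
Qed.

Lemma measurable_noise p : measurable_fun setT (noise p).
Proof.
by apply: measurable_funB; [exact: measurable_noise_basis|exact: measurable_cst].
Qed.

Lemma sum_pair_bool (F : 'I_k * bool -> R) :
  \sum_p F p = \sum_(i < k) (F (i, true) + F (i, false)).
Proof.
transitivity (\sum_(i < k) \sum_(b : bool) F (i, b)).
  by rewrite pair_bigA; apply: eq_bigr => -[].
by apply: eq_bigr => i _; rewrite big_bool.
Qed.

(** Per frequency, a point of the unit circle minus a point of the unit disc has squared length at
    most 4. *)
Lemma sum_noise_sqr_le y : \sum_p noise p y ^+ 2 <= 4 * k%:R * vmax phi k.
Proof.
rewrite sum_pair_bool.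
apply: (@le_trans _ _ (\sum_(i < k) 4 * vmax phi k)); last first.
  by rewrite sumr_const card_ord -[leLHS]mulr_natr; lra.
apply: ler_sum => i _; rewrite /noise /noise_basis /noise_mean /= -!mulrBr !exprMn.
rewrite !sqr_sqrtr ?v_ge0// -mulrDr mulrC.
set c := cos _; set s := sin _.
have cs : c ^+ 2 + s ^+ 2 = 1 by rewrite cos2Dsin2.
have rs := cabs_coef_cconv_le1 i.+1.
apply: ler_pM; rewrite ?v_ge0 ?addr_ge0 ?sqr_ge0//; last exact: le_vmax.
have := sqr_ge0 (c + rg i.+1); have := sqr_ge0 (s + ig i.+1).
by rewrite !sqrrB !sqrrD; lra.
Qed.

Variable s : 'I_k * bool -> R.

Let q y := \sum_p s p * noise_basis p y.
Let c0 := \sum_p s p * noise_mean p.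
Let cc (i : 'I_k) : R[i] := (Num.sqrt (v i.+1) * s (i, true)) +i* (Num.sqrt (v i.+1) * s (i, false)).
(* [q] is the real part of the trigonometric polynomial [qc], so Parseval bounds
   its second moment *)
Let qc (y : R) : R[i] := \sum_(i < k) cc i * e_ i.+1%:Z y.

Let qE y : q y = Re (qc y).
Proof.
rewrite /q /qc Re_sum sum_pair_bool; apply: eq_bigr => i _.
by rewrite /noise_basis /= cosN sinN; ring.
Qed.

Let in_L2_qc : in_L2 qc.
Proof. by apply: in_L2_sum => i _; apply: in_L2Z; exact: in_L2_e. Qed.

Let in_L2_g : in_L2 (toC g).
Proof.
apply/in_L2P; split; last first.
  by apply: (@sq_integrable_bounded _ _ 0) => // x _; rewrite /= normr0.
apply: (@sq_integrable_bounded _ _ (conv_bound f phi)).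
  exact: measurable_cconv.
by move=> x Ux /=; rewrite ger0_norm ?cconv_le ?cconv_ge0.
Qed.

Let L2norm_qc : L2norm qc ^+ 2 = \sum_(i < k) cabs (cc i) ^+ 2.
Proof.
apply: (@complexI R); rewrite -inner_self.
have eL i : in_L2 (fun y => cc i * e_ i.+1%:Z y) by apply: in_L2Z; exact: in_L2_e.
rewrite {1}/qc inner_suml// (rmorph_sum (real_complex R)).
apply: eq_bigr => i _.
rewrite innerZl//; last exact: in_L2_e.
rewrite (innerC in_L2_qc) ?inner_suml//; try exact: in_L2_e.
have -> : \sum_(i0 < k) inner (fun x => cc i0 * e_ i0.+1%:Z x) (e_ i.+1%:Z) = cc i.
  rewrite (bigD1 i)//= innerZl ?inner_e ?eqxx ?mulr1; try exact: in_L2_e.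
  rewrite big1 ?addr0// => l li; rewrite innerZl ?inner_e; try exact: in_L2_e.
  rewrite (_ : (l.+1%:Z == i.+1%:Z) = false) ?mulr0//.
  by apply/negP => /eqP[] /ord_inj li'; rewrite li' eqxx in li.
by rewrite [RHS](_ : _ = cc i * conjc (cc i))//; exact: cabs_sqrC.
Qed.

Let q_bound y : `|q y| <= \sum_p `|s p * Num.sqrt (v p.1.+1)|.
Proof.
apply: le_trans (ler_norm_sum _ _ _) _; apply: ler_sum => p _.
rewrite /noise_basis mulrA normrM ler_piMr//.
by case: p.2; rewrite ler_norml ?cos_geN1 ?cos_le1 ?sin_geN1 ?sin_le1.
Qed.

Let mq : measurable_fun (setT : set LR) q.
Proof.
apply: measurable_sum => p; apply: measurable_funM; first exact: measurable_cst.
exact: measurable_noise_basis.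
Qed.

Let q_mean : \int[mu]_(y in U) (g y * q y) = c0.
Proof.
have -> : \int[mu]_(y in U) (g y * q y) = Re (inner qc (toC g)).
  by apply: eq_Rintegral => y _; rewrite qE; case: (qc y) => a b /=; ring.
rewrite {1}/qc inner_suml//; last by move=> i _; apply: in_L2Z; exact: in_L2_e.
rewrite Re_sum /c0 sum_pair_bool; apply: eq_bigr => i _.
rewrite innerZl//; last exact: in_L2_e.
rewrite (innerC in_L2_g)//; last exact: in_L2_e.
rewrite (_ : inner (toC g) (e_ i.+1%:Z) = coef (toC g) i.+1%:Z)//.
rewrite /noise_mean /rg /ig; move: (coef (toC g) i.+1%:Z) => [a b].
rewrite /cc; move: (Num.sqrt _) => r /=; ring.
Qed.

Let ig1 : mu.-integrable U (EFin \o g).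
Proof. exact: (integrable_cconv df dphi).1. Qed.

Let igq : mu.-integrable U (EFin \o (fun y => g y * q y)).
Proof. exact: (integrable_mul_bounded ig1 mq q_bound). Qed.

Let igq2 : mu.-integrable U (EFin \o (fun y => g y * q y ^+ 2)).
Proof.
apply: (integrable_mul_bounded ig1 (M := (\sum_p `|s p * Num.sqrt (v p.1.+1)|) ^+ 2)).
  exact: measurable_funX.
by move=> x; rewrite normrX lerXn2r ?nnegrE ?sumr_ge0.
Qed.

(** The supremum bound of [g] replaces the density by Lebesgue measure, after which orthonormality
    computes the integral. A factor [k] would be lost by using the length of the noise vector
    instead. *)
Let q2_le : \int[mu]_(y in U) (g y * q y ^+ 2) <= conv_bound f phi * (vmax phi k * \sum_p s p ^+ 2).
Proof.
have /in_L2P[[mqr iqr] [mqi iqi]] := in_L2_qc.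
have iq : mu.-integrable U (EFin \o (fun y => cabs (qc y) ^+ 2)).
  apply: eq_integrable (integrableD measurable_unit_itv iqr iqi) => // x _.
  by rewrite /= cabsE.
apply: (@le_trans _ _ (\int[mu]_(y in U) (conv_bound f phi * cabs (qc y) ^+ 2))).
  apply: le_Rintegral => //; first exact: (integrableZl measurable_unit_itv (conv_bound f phi) iq).
  move=> y Uy; apply: ler_pM; rewrite ?sqr_ge0 ?cconv_ge0 ?cconv_le//.
  by rewrite cabsE qE lerDl sqr_ge0.
rewrite RintegralZl// -L2norm_sqr L2norm_qc ler_wpM2l ?conv_bound_ge0//.
rewrite mulr_sumr sum_pair_bool; apply: ler_sum => i _.
rewrite cabsE /= !exprMn sqr_sqrtr ?v_ge0// -!mulrDr ler_wpM2r ?addr_ge0 ?sqr_ge0//.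
exact: le_vmax.
Qed.

(** This provides the hypothesis [xitau] of the concentration bound. Since [c0] is the mean of [q],
    the integral equals [1 - 2 c0^2] plus twice the second moment of [q]. *)
Lemma noise_variance (nu : probability R R) :
  (forall A, measurable A -> nu A = \int[mu]_(y in A `&` U) (g y)%:E)%E ->
  (\int[nu]_y (1 + \sum_p s p * noise p y + 2 * (\sum_p s p * noise p y) ^+ 2)%:E
   <= (1 + 2 * conv_bound f phi * vmax phi k * \sum_p s p ^+ 2)%:E)%E.
Proof.
move=> nuE.
have pE y : \sum_p s p * noise p y = q y - c0.
  by rewrite /q /c0 -sumrB; apply: eq_bigr => p _; rewrite mulrBr.
have mn : measurable_fun (setT : set LR) (fun y => 1 + (q y - c0) + 2 * (q y - c0) ^+ 2).
  have mqc : measurable_fun (setT : set LR) (fun y => q y - c0).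
    by apply: measurable_funB => //; exact: measurable_cst.
  apply: measurable_funD; first by apply: measurable_funD => //; exact: measurable_cst.
  by apply: measurable_funM; [exact: measurable_cst|exact: measurable_funX].
rewrite [leLHS](_ : _ = \int[nu]_y (1 + (q y - c0) + 2 * (q y - c0) ^+ 2)%:E)%E; last first.
  by apply: eq_integral => y _; rewrite pE.
rewrite (integral_density (measurable_cconv df dphi) (cconv_ge0 df dphi) nuE mn); last first.
  by move=> y; have := sqr_ge0 (q y - c0 + 2^-1); have := sqr_ge0 (q y - c0); rewrite sqrrD; lra.
have E : (\int[mu]_(y in U) ((1 + (q y - c0) + 2 * (q y - c0) ^+ 2) * g y)%:E =
   (((1 - c0 + 2 * c0 ^+ 2) * \int[mu]_(y in U) g y + (1 - 4 * c0) * \int[mu]_(y in U) (g y * q y))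
     + 2 * \int[mu]_(y in U) (g y * q y ^+ 2))%:E)%E.
  have i1 := integrableZl measurable_unit_itv (1 - c0 + 2 * c0 ^+ 2) ig1.
  have i2 := integrableZl measurable_unit_itv (1 - 4 * c0) igq.
  have i3 := integrableZl measurable_unit_itv 2 igq2.
  have i12 := integrableD measurable_unit_itv i1 i2.
  rewrite -!RintegralZl// -RintegralD// -RintegralD// /Rintegral fineK; last first.
    exact: (integrable_fin_num measurable_unit_itv (integrableD measurable_unit_itv i12 i3)).
  by apply: eq_integral => y _; congr EFin; ring.
rewrite E q_mean (integrable_cconv df dphi).2 lee_fin.
have := q2_le; have := sqr_ge0 c0; lra.
Qed.

End fixed_k.
End noise.

(** * Expected excess of the noise over a quarter of the penalty *)

Section excess.
Context {R : realType}.
Local Notation mu := (@lebesgue_measure R).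
Local Notation U := (@unit_itv R : set (measurableTypeR R)).

Variables f phi : R -> R.
Hypotheses (df : density_L2 f) (dphi : density_L2 phi).
Local Notation g := (cconv f phi).
Local Notation v := (v_ phi).

(* the factor 2 accounts for the frequencies [i] and [-i] *)
Definition sqdev n (y : 'I_n -> R) (i : nat) : R :=
  2 * (v i * cabs (ghat y i%:Z - coef (toC g) i%:Z) ^+ 2).

Lemma sqdev_ge0 n (y : 'I_n -> R) i : 0 <= sqdev y i.
Proof. by rewrite /sqdev mulr_ge0// mulr_ge0 ?sqr_ge0// v_ge0. Qed.

(** [ghat - g_j] is [1/n] times a sum of centred terms [e_ j (- y l) - g_j], whose real and
    imaginary parts are, up to the weight [sqrt (v j)], the cosine and sine coordinates of
    [noise]. *)
Lemma sum_sqdev n (y : 'I_n -> R) k : (0 < n)%N ->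
  \sum_(1 <= i < k.+1) sqdev y i =
  2 / n%:R ^+ 2 * \sum_(p : 'I_k * bool) (\sum_(l < n) noise f phi p (y l)) ^+ 2.
Proof.
move=> n0; have nR : n%:R != 0 :> R by rewrite pnatr_eq0 -lt0n.
rewrite sum_pair_bool mulr_sumr big_add1 /= big_mkord; apply: eq_bigr => i _.
rewrite /sqdev; set G := coef (toC g) i.+1%:Z.
pose z : R[i] := \sum_(l < n) (e_ i.+1%:Z (- y l) - G).
have -> : ghat y i.+1%:Z - G = (n%:R^-1)%:C * z.
  rewrite /ghat /z sumrB mulrBr sumr_const card_ord -[G *+ _]mulr_natl mulrA.
  have -> : ((n%:R : R)^-1)%:C = (n%:R : R[i])^-1.
    by rewrite (fmorphV (real_complex R)) (rmorph_nat (real_complex R)).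
  by rewrite mulVf ?mul1r// pnatr_eq0 -lt0n.
have -> : cabs ((n%:R^-1)%:C * z) ^+ 2 = (n%:R ^+ 2)^-1 * (Re z ^+ 2 + Im z ^+ 2).
  rewrite cabsE; case: z => a b /=; rewrite !mul0r subr0 addr0; field => //.
have -> : \sum_(l < n) noise f phi (i, true) (y l) = Num.sqrt (v i.+1) * Re z.
  rewrite /z Re_sum mulr_sumr; apply: eq_bigr => l _.
  rewrite /noise /noise_basis /noise_mean /= -mulrBr -/G; congr (_ * _).
  by rewrite mulrN opprK /G; case: (coef (toC g) i.+1%:Z).
have -> : \sum_(l < n) noise f phi (i, false) (y l) = Num.sqrt (v i.+1) * Im z.
  rewrite /z Im_sum mulr_sumr; apply: eq_bigr => l _.
  rewrite /noise /noise_basis /noise_mean /= -mulrBr -/G; congr (_ * _).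
  by rewrite mulrN opprK /G; case: (coef (toC g) i.+1%:Z).
rewrite !exprMn sqr_sqrtr ?v_ge0//; field => //.
Qed.

(** The summand 2 secures the condition [2 <= Gam] of [truncation_choice]. *)
Definition var_const : R := conv_bound f phi + 2.

(** The concentration bound indexes observations by [nat]; [inord] transports the sample, and
    independence is taken for the full index set. *)
Lemma iid_nat d (T : measurableType d) (P : probability T R) n
    (Y : 'I_n.+1 -> {RV P >-> R}) : iid_with_density g Y ->
  let Z := fun i : nat => Y (inord i) in
  (forall B : nat -> set R, (forall i, measurable (B i)) ->
   P (\bigcap_(i in `I_n.+1) Z i @^-1` B i) = \prod_(i < n.+1) P (Z i @^-1` B i))%E /\
  (forall i (A : set R), measurable A ->
    distribution P (Z i) A = \int[mu]_(y in A `&` U) (g y)%:E)%E.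
Proof.
move=> [ind law] Z; split; last by move=> i A mA; exact: law.
move=> B mB.
have := ind [set: 'I_n.+1]%SET (fun i : 'I_n.+1 => B i) (fun i => mB i).
rewrite (_ : \bigcap_(i in [set i | i \in [set: 'I_n.+1]%SET]) _ =
  \bigcap_(i in `I_n.+1) Z i @^-1` B i); last first.
  apply/seteqP; split => t /= h i.
    move=> /= iN; have := h (inord i); rewrite /Z /= inordK//; apply.
    by rewrite /= finset.in_setT.
  by move=> _; have := h i (ltn_ord i); rewrite /Z /= inord_val.
move=> ->; rewrite (eq_bigl xpredT) => [|i]; last by rewrite finset.in_setT.
by apply: eq_bigr => i _; rewrite /Z inord_val.
Qed.

Lemma expect_excess (kappa : R) : 84 <= kappa ->
  exists2 C, 0 <= C & forall n (k : nat), (0 < k <= n)%N ->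
  forall d (T : measurableType d) (P : probability T R) (Y : 'I_n -> {RV P >-> R}),
  iid_with_density g Y ->
  (\int[P]_t (Num.max (\sum_(1 <= i < k.+1) sqdev (fun l => Y l t) i
      - pen phi kappa n k / 4) 0)%:E <=
   (C / n%:R * (k%:R ^+ 2)^-1 + C / n%:R ^+ 2)%:E)%E.
Proof.
move=> k84.
have G2 : 2 <= var_const by rewrite /var_const lerDr conv_bound_ge0.
have [C C0 H] := truncation_choice G2.
exists C => // -[|n] k /andP[k0 kn]; first by move: kn; rewrite leqNgt k0.
move=> d T P Y iidY.
set V := vmax phi k; have V1 : 1 <= V by exact: vmax_ge1.
have nR : 0 < n.+1%:R :> R by rewrite ltr0n.
have [th [L [D [[th0 L0 D0 c1 c2] [LD bnd]]]]] :=
  H k n.+1 V (lambda_ phi k) k0 kn V1 erefl.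
(* The threshold [pen / 4] in the scale of [N], by [sum_sqdev]. *)
pose c := n.+1%:R ^+ 2 / 2 * (pen phi kappa n.+1 k / 4).
have lam0 : 0 <= lambda_ phi k by rewrite /lambda_ divr_ge0 ?sqr_ge0.
have cE : c = kappa / 8 * (n.+1%:R * k%:R * V * lambda_ phi k).
  rewrite /c /pen /Lambda_ -/V; field; exact: lt0r_neq0.
have nkV0 : 0 <= n.+1%:R * k%:R * V * lambda_ phi k.
  by rewrite mulr_ge0// mulr_ge0//; lra.
have c_ge : 21 / 2 * n.+1%:R * k%:R * V * lambda_ phi k <= c.
  rewrite cE (_ : 21 / 2 * _ * _ * _ * _ = 21 / 2 * (n.+1%:R * k%:R * V * lambda_ phi k)).
    by apply: ler_wpM2r => //; lra.
  by rewrite !mulrA.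
have kap0 : 0 <= kappa / 8 by lra.
have c0 : 0 <= c by rewrite cE mulr_ge0.
have [ind law] := iid_nat iidY.
pose Z := fun i : nat => Y (inord i).
have mxi (p : 'I_k * bool) := measurable_noise f phi p.
have xiB y := @sum_noise_sqr_le _ _ _ df dphi k y.
have tau0 : 0 <= 2 * var_const * V by rewrite !mulr_ge0//; lra.
have xitau m : (m < n.+1)%N -> forall s : 'I_k * bool -> R,
  (\int[distribution P (Z m)]_y
     (1 + \sum_i s i * noise f phi i y + 2 * (\sum_i s i * noise f phi i y) ^+ 2)%:E
   <= (1 + 2 * var_const * V * \sum_i s i ^+ 2)%:E)%E.
  move=> _ s; apply: (le_trans (noise_variance df dphi s (law m))).
  rewrite lee_fin lerD2l ler_wpM2r//.
    by apply: sumr_ge0 => i _; exact: sqr_ge0.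
  apply: ler_wpM2r; first exact: le_trans ler01 V1.
  by apply: ler_wpM2l => //; rewrite /var_const lerDl.
(* Cauchy-Schwarz over the observations gives [N <= n^2 B]. By [LD], either [L] is beyond this bound
   and [L < N] is impossible, or [D] is. *)
have ND : forall t, let N := \sum_(i : 'I_k * bool) (\sum_(l < n.+1) noise f phi i (Z l t)) ^+ 2 in L < N -> N <= D.
  move=> t N LN.
  have NB : N <= n.+1%:R ^+ 2 * (4 * k%:R * V).
    apply: (@le_trans _ _ (\sum_(i : 'I_k * bool) (n.+1%:R * \sum_(l < n.+1) noise f phi i (Z l t) ^+ 2))).
      apply: ler_sum => i _.
      have := sum_sqr_CS (fun l : 'I_n.+1 => noise f phi i (Z l t)) (fun=> 1).
      rewrite sumr_const card_ord expr1n -[1 *+ _]/(n.+1%:R) [leRHS]mulrC.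
      by under eq_bigr do rewrite mulr1.
    rewrite -mulr_sumr exchange_big/= expr2 -mulrA ler_pM2l//.
    apply: (@le_trans _ _ (\sum_(l < n.+1) 4 * k%:R * V)).
      by apply: ler_sum => l _; exact: xiB.
    by rewrite sumr_const card_ord -[leLHS]mulr_natl.
  by case: LD => LD; [move: (lt_le_trans LN (le_trans NB LD)); rewrite ltxx|exact: le_trans LD].
have := excess_sqnorm ind mxi xiB tau0 xitau (ltn0Sn n) th0 L0 c0 D0 c1 c2 ND.
pose N t := \sum_(i : 'I_k * bool) (\sum_(l < n.+1) noise f phi i (Z l t)) ^+ 2.
set E := (_ * expR (2 * _ * _ * _)) => h.
have mN : measurable_fun setT N.
  apply: measurable_sum => i; apply: measurable_funX.
  apply: measurable_sum => l; apply: measurableT_comp => //; exact: mxi.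
have n20 : 0 <= 2 / n.+1%:R ^+ 2 :> R by rewrite divr_ge0 ?sqr_ge0.
rewrite [leLHS](_ : _ = \int[P]_t ((2 / n.+1%:R ^+ 2)%:E * (Num.max (N t - c) 0)%:E))%E; last first.
  apply: eq_integral => t _; rewrite -EFinM; congr EFin.
  rewrite sum_sqdev// maxr_pMr// mulr0; congr (Num.max _ _).
  rewrite mulrBr; congr (_ - _); last by rewrite /c; field; exact: lt0r_neq0.
  congr (_ * _); apply: eq_bigr => i _; congr (_ ^+ 2).
  by apply: eq_bigr => l _; rewrite /Z inord_val.
rewrite ge0_integralZl_EFin//; last 2 first.
- by move=> t _; rewrite lee_fin le_max lexx orbT.
- apply/measurable_EFinP; apply: measurable_maxr; last exact: measurable_cst.
  by apply: measurable_funB => //; exact: measurable_cst.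
apply: (@le_trans _ _ ((2 / n.+1%:R ^+ 2)%:E * E%:E)%E).
  by apply: lee_wpmul2l; rewrite ?lee_fin.
rewrite -EFinM lee_fin; exact: bnd.
Qed.

End excess.

(** * Risk bounds *)

Section weights.
Context {R : realType}.

Lemma exists_min (c : nat -> R) (s : seq nat) : s != [::] ->
  exists2 k, k \in s & all (fun l => c k <= c l) s.
Proof.
elim: s => // a [|b s] ih _.
  by exists a; rewrite ?mem_head//= lexx.
have [k ks /allP kmin] := ih isT.
have [ak|ka] := leP (c a) (c k).
  exists a; first exact: mem_head.
  rewrite /= -/(all _ (b :: s)) lexx; apply/allP => l ls.
  exact: le_trans ak (kmin l ls).
exists k; first by rewrite in_cons ks orbT.
by apply/allP => l; rewrite in_cons => /predU1P[->|/kmin//]; exact: ltW.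
Qed.

(** A minimiser exists, so the filtered list is non-empty and the default 0 of [head] is not
    returned. *)
Lemma argminP n (c : nat -> R) : (0 < n)%N ->
  (0 < argmin n c <= n)%N /\ forall l, (0 < l <= n)%N -> c (argmin n c) <= c l.
Proof.
move=> n0; rewrite /argmin.
set s := [seq _ <- _ | _].
have : head 0%N s \in s.
  have [|k ks kmin] := exists_min c (s := iota 1 n); first by case: n n0 {s}.
  have : k \in s by rewrite mem_filter kmin.
  by case: s => //= a s _; exact: mem_head.
rewrite {2}/s mem_filter mem_iota add1n ltnS => /andP[/allP h1 h2]; split=> // l ln.
by apply: h1; rewrite mem_iota add1n ltnS.
Qed.

(** Bayesian weights: keep only the term [k] of the denominator and use [eta >= 1]. Model selection:
    a nonzero [w l] forces [c l <= c k], so the exponential is at least 1. *)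
Lemma weight_schemeP w n (c : nat -> R) : weight_scheme w -> (0 < n)%N ->
  [/\ forall k, 0 <= w n c k, \sum_(1 <= k < n.+1) w n c k = 1 &
    forall k l, (0 < k <= n)%N -> (0 < l <= n)%N -> c k <= c l ->
      w n c l <= expR (- (n%:R * (c l - c k)))].
Proof.
move=> [[eta eta0 ->]|->] n0.
- rewrite /bayes_weights; set E := fun l => expR (- (eta%:R * n%:R * c l)).
  have E0 l : 0 < E l by exact: expR_gt0.
  have le_sum k : (0 < k <= n)%N -> E k <= \sum_(1 <= l < n.+1) E l.
    move=> /andP[k0 kn]; rewrite (bigD1_seq k)/= ?iota_uniq//.
      by rewrite lerDl; apply: sumr_ge0 => l _; exact: ltW.
    by rewrite mem_index_iota k0 ltnS.
  have S0 : 0 < \sum_(1 <= l < n.+1) E l by apply: lt_le_trans (le_sum 1%N _); rewrite ?E0.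
  split.
  + by move=> k; rewrite divr_ge0// ltW// E0.
  + by rewrite -mulr_suml divff// gt_eqF.
  + move=> k l kn ln ckl; rewrite ler_pdivrMr//.
    apply: (@le_trans _ _ (expR (- (n%:R * (c l - c k))) * E k)); last first.
      by rewrite ler_wpM2l ?expR_ge0// le_sum.
    rewrite /E -expRD ler_expR.
    have e1 : 1 <= eta%:R :> R by rewrite ler1n.
    have : 0 <= (eta%:R - 1) * (n%:R * (c l - c k)).
      by rewrite !mulr_ge0 ?subr_ge0.
    lra.
- rewrite /ms_weights; have [an amin] := argminP c n0.
  split.
  + by move=> k.
  + rewrite (bigD1_seq (argmin n c))/= ?iota_uniq ?mem_index_iota ?ltnS//.
    by rewrite eqxx big1 ?addr0// => k /negPf ->.
  + move=> k l kn ln ckl; have [->|_] := eqVneq l (argmin n c); last exact: expR_ge0.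
    apply: (@le_trans _ _ (expR 0)); first by rewrite expR0.
    by rewrite ler_expR oppr_ge0 mulr_ge0_le0// subr_le0 amin.
Qed.

(** The variance under the weights [w] is nonnegative. *)
Lemma sum_convex_sqr n (w x : nat -> R) : (forall k, 0 <= w k) ->
  \sum_(1 <= k < n.+1) w k = 1 ->
  (\sum_(1 <= k < n.+1) w k * x k) ^+ 2 <= \sum_(1 <= k < n.+1) w k * x k ^+ 2.
Proof.
move=> w0 w1; set m := \sum_(_ <= _ < _) _ * x _.
have : 0 <= \sum_(1 <= k < n.+1) w k * (x k - m) ^+ 2.
  by apply: sumr_ge0 => k _; rewrite mulr_ge0 ?sqr_ge0.
rewrite (eq_bigr (fun k => w k * x k ^+ 2 + (- 2 * m) * (w k * x k) + m ^+ 2 * w k)) => [|k _]; last by ring.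
by rewrite !big_split/= -!mulr_sumr w1 -/m; lra.
Qed.

End weights.

(** * The aggregated estimator frequency by frequency *)

Section estimator.
Context {R : realType}.
Variables (f phi : R -> R) (kappa : R).

Definition ftilde_coef n (y : 'I_n -> R) (j : int) : R[i] :=
  if j == 0 then 1 else (coef (toC phi) j)^-1 * ghat y j.

Lemma ftildeE n (y : 'I_n -> R) k : ftilde phi y k = trig (freqs k) (ftilde_coef y).
Proof.
apply/funext => x; rewrite /trig (bigD1_seq 0) ?uniq_freqs ?mem_freqs//=.
rewrite /ftilde /ftilde_coef eqxx mul1r; congr (_ + _).
by apply: eq_bigr => j /negPf ->.
Qed.

Lemma big_freqs_le (V : nmodType) k n (F : int -> V) : (k <= n)%N ->
  \sum_(j <- freqs k) F j = \sum_(j <- freqs n | (`|j| <= k)%N) F j.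
Proof.
move=> kn.
have E : perm_eq (freqs k) [seq j <- freqs n | (`|j| <= k)%N].
  apply: uniq_perm; [exact: uniq_freqs|by rewrite filter_uniq// uniq_freqs|move=> j].
  by rewrite mem_filter !mem_freqs; case: leqP => //= jk; rewrite (leq_trans jk).
by rewrite (perm_big _ E) big_filter.
Qed.

Variables (w : nat -> (nat -> R) -> nat -> R) (n : nat) (y : 'I_n -> R).
Local Notation A := (ftilde_coef y).
Local Notation wk k := (w n (contrast phi kappa y) k).

(** Aggregation shrinks: the coefficient at [j] is multiplied by the total weight of the models
    [k >= |j|]. *)
Lemma ftilde_wE : ftilde_w phi kappa w y =
  trig (freqs n) (fun j => (\sum_(1 <= k < n.+1) wk k * (`|j| <= k)%N%:R)%:C * A j).
Proof.
apply/funext => x; rewrite /ftilde_w /trig.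
transitivity (\sum_(1 <= k < n.+1) \sum_(j <- freqs n)
   (wk k * (`|j| <= k)%N%:R)%:C * A j * e_ j x).
  rewrite big_nat [RHS]big_nat; apply: eq_bigr => k /andP[_]; rewrite ltnS => kn.
  rewrite ftildeE /trig (big_freqs_le _ kn) mulr_sumr big_mkcond/=.
  apply: eq_bigr => j _; case: ifP => _; first by rewrite mulr1 mulrA.
  by rewrite mulr0 (rmorph0 (real_complex R)) !mul0r.
rewrite exchange_big/=; apply: eq_bigr => j _.
by rewrite -!mulr_suml (rmorph_sum (real_complex R)).
Qed.

Lemma cabs_convex (x : nat -> R[i]) (u : nat -> R) : (forall k, 0 <= u k) ->
  \sum_(1 <= k < n.+1) u k = 1 ->
  cabs (\sum_(1 <= k < n.+1) (u k)%:C * x k) ^+ 2 <=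
  \sum_(1 <= k < n.+1) u k * cabs (x k) ^+ 2.
Proof.
move=> u0 u1; rewrite cabsE.
have -> : Re (\sum_(1 <= k < n.+1) (u k)%:C * x k) = \sum_(1 <= k < n.+1) u k * Re (x k).
  elim: (index_iota 1 n.+1) => [|k s ih]; first by rewrite !big_nil.
  rewrite !big_cons -ih; case: (x k) (\sum_(_ <- _) _) => [a b] [a' b'] /=; ring.
have -> : Im (\sum_(1 <= k < n.+1) (u k)%:C * x k) = \sum_(1 <= k < n.+1) u k * Im (x k).
  elim: (index_iota 1 n.+1) => [|k s ih]; first by rewrite !big_nil.
  rewrite !big_cons -ih; case: (x k) (\sum_(_ <- _) _) => [a b] [a' b'] /=; ring.
under [leRHS]eq_bigr do rewrite cabsE mulrDr.
by rewrite big_split/= lerD// sum_convex_sqr.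
Qed.

Hypothesis fL : in_L2 (toC f).
Hypothesis w0 : forall k, 0 <= wk k.
Hypothesis w1 : \sum_(1 <= k < n.+1) wk k = 1.

(** Jensen at every frequency. As the weights sum to 1, the error at [j] is the average of the
    errors of the [ftilde k], and for [|j| > k] that error is [- f_j], which is restored to the
    squared bias. *)
Lemma loss_le_average : loss f phi kappa w y <=
  \sum_(1 <= k < n.+1) wk k * (\sum_(j <- freqs k) cabs (A j - coef (toC f) j) ^+ 2
    + (L2norm (toC f) ^+ 2 - \sum_(j <- freqs k) cabs (coef (toC f) j) ^+ 2)).
Proof.
rewrite /loss ftilde_wE L2norm_trigB ?uniq_freqs//.
set N := L2norm (toC f) ^+ 2.
apply: (@le_trans _ _ (\sum_(j <- freqs n) \sum_(1 <= k < n.+1)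
   wk k * cabs ((`|j| <= k)%N%:R * A j - coef (toC f) j) ^+ 2
   + \sum_(1 <= k < n.+1) wk k * (N - \sum_(j <- freqs n) cabs (coef (toC f) j) ^+ 2))).
  apply: lerD; last by rewrite -mulr_suml w1 mul1r.
  apply: ler_sum => j _.
  apply: le_trans (cabs_convex (fun k => (`|j| <= k)%N%:R * A j - coef (toC f) j) w0 w1).
  rewrite le_eqVlt; apply/orP; left; apply/eqP; congr (cabs _ ^+ 2).
  under [RHS]eq_bigr do rewrite mulrBr mulrA.
  rewrite sumrB -!mulr_suml -(rmorph_sum (real_complex R)) w1 mul1r; congr (_ * _ - _).
  rewrite (rmorph_sum (real_complex R)); apply: eq_bigr => k _.
  by rewrite (rmorphM (real_complex R)) (rmorph_nat (real_complex R)).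
rewrite exchange_big/= -big_split/=.
rewrite big_nat [leRHS]big_nat; apply: ler_sum => k /andP[_]; rewrite ltnS => kn.
rewrite -mulr_sumr -mulrDr ler_wpM2l// !(big_freqs_le _ kn).
rewrite le_eqVlt; apply/orP; left; apply/eqP.
rewrite [X in X + (N - _)](bigID (fun j : int => (`|j| <= k)%N))/=.
rewrite [X in _ + (N - X) = _](bigID (fun j : int => (`|j| <= k)%N))/=.
have -> : \sum_(j <- freqs n | ~~ (`|j| <= k)%N) cabs ((`|j| <= k)%N%:R * A j - coef (toC f) j) ^+ 2 =
   \sum_(j <- freqs n | ~~ (`|j| <= k)%N) cabs (coef (toC f) j) ^+ 2.
  by apply: eq_bigr => j /negPf ->; rewrite mul0r sub0r normcN.
have -> : \sum_(j <- freqs n | (`|j| <= k)%N) cabs ((`|j| <= k)%N%:R * A j - coef (toC f) j) ^+ 2 =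
   \sum_(j <- freqs n | (`|j| <= k)%N) cabs (A j - coef (toC f) j) ^+ 2.
  by apply: eq_bigr => j ->; rewrite mul1r.
by ring.
Qed.

End estimator.

Section risk.
Context {R : realType}.
Variables (f phi : R -> R) (kappa : R).
Hypotheses (df : density_L2 f) (dphi : density_L2 phi).
Hypothesis phi_neq0 : forall j : int, coef (toC phi) j != 0.
Hypothesis kappa84 : 84 <= kappa.
Local Notation g := (cconv f phi).

Let fL : in_L2 (toC f). Proof. by case: df. Qed.

Lemma cabs_conj (z : R[i]) : cabs (conjc z) ^+ 2 = cabs z ^+ 2.
Proof. by rewrite !cabsE; case: z => a b /=; rewrite sqrrN. Qed.

Lemma ghat_opp n (y : 'I_n -> R) j : ghat y (- j) = conjc (ghat y j).
Proof.
rewrite /ghat (rmorphM (@conjc R)) (rmorph_sum (@conjc R)) (fmorphV (@conjc R)).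
rewrite (rmorph_nat (@conjc R)); congr (_ * _); apply: eq_bigr => l _.
have e_opp x : e_ (- j) x = conjc (e_ j x) :> R[i].
  by rewrite /e_ /= mulrNz mulrN mulNr opprK cosN sinN opprK.
exact: e_opp.
Qed.

Lemma lambda_ge1 k : (0 < k)%N -> 1 <= lambda_ phi k.
Proof.
move=> k0; rewrite /lambda_.
have x1 : 1 < (k + 2)%:R :> R by rewrite ltr1n addn2.
have lx0 : 0 < ln (k + 2)%:R :> R by rewrite ln_gt0.
have x0 : 0 < (k + 2)%:R :> R by apply: lt_trans x1.
set m := Num.max _ _.
have xm : (k + 2)%:R <= m by rewrite /m le_max lexx orbT.
have lxm : ln (k + 2)%:R <= ln m.
  by rewrite ler_ln ?posrE//; apply: lt_le_trans xm.
rewrite ler_pdivlMr ?exprn_gt0// mul1r lerXn2r ?nnegrE ?(ltW lx0)//.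
by apply: le_trans lxm; exact: ltW.
Qed.

Lemma Lambda_ge1 k : (0 < k)%N -> 1 <= Lambda_ phi k.
Proof.
move=> k0; rewrite /Lambda_; have := lambda_ge1 k0; have := vmax_ge1 dphi k.
by move=> h1 h2; apply: le_trans (ler_pM ler01 ler01 h2 h1); rewrite mulr1.
Qed.

Lemma pen_lb n k : (0 < k <= n)%N -> 4 * k%:R / n%:R <= pen phi kappa n k.
Proof.
move=> /andP[k0 kn]; rewrite /pen ler_wpM2r ?invr_ge0//.
have L1 := Lambda_ge1 k0.
have kap4 : 4 <= kappa by apply: le_trans kappa84; rewrite ler_nat.
apply: (@le_trans _ _ (kappa * k%:R)); first exact: ler_wpM2r.
by rewrite ler_peMr// mulr_ge0//; exact: le_trans kap4.
Qed.

Definition sqcoef (i : nat) : R :=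
  cabs (coef (toC f) i%:Z) ^+ 2 + cabs (coef (toC f) (- i%:Z)) ^+ 2.

Lemma L2norm_Pi_perp_nat k : L2norm (Pi_perp k (toC f)) ^+ 2 =
  L2norm (toC f) ^+ 2 - 1 - \sum_(1 <= i < k.+1) sqcoef i.
Proof.
rewrite L2norm_Pi_perp// sum_freqs coef0_density// cabsE /= expr1n expr0n addr0.
by rewrite opprD addrA.
Qed.

Lemma cabs_ftilde_coefB n (y : 'I_n -> R) j : j != 0 ->
  cabs (ftilde_coef phi y j - coef (toC f) j) ^+ 2 =
  (cabs (coef (toC phi) j) ^+ 2)^-1 * cabs (ghat y j - coef (toC g) j) ^+ 2.
Proof.
move=> j0; rewrite /ftilde_coef (negPf j0) coef_cconv//.
have -> : (coef (toC phi) j)^-1 * ghat y j - coef (toC f) j =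
  (coef (toC phi) j)^-1 * (ghat y j - coef (toC f) j * coef (toC phi) j).
  by rewrite mulrBr [coef (toC f) j * _]mulrC mulKf.
have cabsM (u v : R[i]) : cabs (u * v) ^+ 2 = cabs u ^+ 2 * cabs v ^+ 2.
  by rewrite !cabsE; case: u v => [a b] [c d] /=; ring.
rewrite cabsM; congr (_ * _).
have nz : cabs (coef (toC phi) j) ^+ 2 != 0.
  rewrite expf_neq0//; apply/eqP => h; have := phi_neq0 j.
  by rewrite (ComplexField.Normc.eq0_normc h) eqxx.
apply: (mulfI nz); rewrite -cabsM divff// divff//.
by rewrite cabsE /= expr1n expr0n addr0.
Qed.

Lemma cabs_ftilde_coefB_sum n (y : 'I_n -> R) i : (0 < i)%N ->
  cabs (ftilde_coef phi y i%:Z - coef (toC f) i%:Z) ^+ 2 +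
  cabs (ftilde_coef phi y (- i%:Z) - coef (toC f) (- i%:Z)) ^+ 2 = sqdev f phi y i.
Proof.
move=> i0; have iz : i%:Z != 0 by rewrite -lt0n.
have niz : - i%:Z != 0 by rewrite oppr_eq0.
rewrite (cabs_ftilde_coefB y iz) (cabs_ftilde_coefB y niz) (ghat_opp y i%:Z) (coef_opp i%:Z dphi).
have -> : coef (toC g) (- i%:Z) = conjc (coef (toC g) i%:Z).
  rewrite (coef_cconv df dphi) (coef_opp i%:Z df) (coef_opp i%:Z dphi).
  by rewrite (coef_cconv df dphi i%:Z) (rmorphM (@conjc R)).
by rewrite -(rmorphB (@conjc R)) !cabs_conj /sqdev /v_ -mulr2n -[LHS]mulr_natl.
Qed.

Lemma cabs_sqr_le (a b : R[i]) : cabs a ^+ 2 <= 2 * cabs b ^+ 2 + 2 * cabs (a - b) ^+ 2.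
Proof.
rewrite !cabsE; case: a b => [a1 a2] [b1 b2] /=.
rewrite -subr_ge0 (_ : _ - _ = (2 * b1 - a1) ^+ 2 + (2 * b2 - a2) ^+ 2); last by ring.
by rewrite addr_ge0 ?sqr_ge0.
Qed.

Lemma cabs_distC (a b : R[i]) : cabs (a - b) = cabs (b - a).
Proof. by rewrite -normcN opprB. Qed.

(** A sum stands in for the supremum over [k]: it dominates the excess of each single [k], and its
    expectation is bounded term by term. *)
Definition excess n (y : 'I_n -> R) : R :=
  \sum_(1 <= k < n.+1)
    Num.max (\sum_(1 <= i < k.+1) sqdev f phi y i - pen phi kappa n k / 4) 0.

Lemma loss_oracle (w : nat -> (nat -> R) -> nat -> R) n (y : 'I_n -> R) k :
  weight_scheme w -> (0 < k <= n)%N ->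
  loss f phi kappa w y <=
  10 * pen phi kappa n k + 3 * L2norm (Pi_perp k (toC f)) ^+ 2
   + 5 * excess y + 12 / n%:R.
Proof.
move=> sw kn; have n0 : (0 < n)%N by case/andP: kn => k0; exact: leq_trans.
have [w0 w1 wexp] := weight_schemeP (contrast phi kappa y) sw n0.
apply: le_trans (loss_le_average fL w0 w1) _.
pose T i : R := cabs (ftilde_coef phi y i%:Z) ^+ 2 + cabs (ftilde_coef phi y (- i%:Z)) ^+ 2.
(* The constant [-1] is the contribution of frequency 0, where every [ftilde l] has the coefficient
   1. *)
have cE l : (0 < l <= n)%N ->
    contrast phi kappa y l = -1 - \sum_(1 <= i < l.+1) T i + pen phi kappa n l.
  move=> _; rewrite /contrast ftildeE L2norm_trig sum_freqs /ftilde_coef eqxx cabsE /=.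
  by rewrite expr1n expr0n addr0 opprD.
have F0 i : 0 <= sqcoef i by rewrite addr_ge0 ?sqr_ge0.
(* The comparisons of [T], [F] and [D] are required at every index; at 0 the estimator is exact, so
   the deviation there is set to 0. *)
pose D i := if i == 0%N then 0 else sqdev f phi y i.
have DE l : \sum_(1 <= i < l.+1) D i = \sum_(1 <= i < l.+1) sqdev f phi y i.
  by apply: eq_big_nat => i /andP[i0 _]; rewrite /D gtn_eqF.
have D0 i : 0 <= D i by rewrite /D; case: ifP => // _; exact: sqdev_ge0.
have f0 : ftilde_coef phi y 0 = coef (toC f) 0 by rewrite /ftilde_coef eqxx coef0_density.
have TFD i : T i <= 2 * sqcoef i + 2 * D i.
  rewrite /D; case: eqP => [->|/eqP i0].
    rewrite /T /sqcoef oppr0 f0; have := sqr_ge0 (cabs (coef (toC f) 0)); lra.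
  rewrite -cabs_ftilde_coefB_sum ?lt0n// /T /sqcoef.
  have := cabs_sqr_le (ftilde_coef phi y i%:Z) (coef (toC f) i%:Z).
  have := cabs_sqr_le (ftilde_coef phi y (- i%:Z)) (coef (toC f) (- i%:Z)).
  lra.
have FTD i : sqcoef i <= 2 * T i + 2 * D i.
  rewrite /D; case: eqP => [->|/eqP i0].
    rewrite /T /sqcoef oppr0 f0; have := sqr_ge0 (cabs (coef (toC f) 0)); lra.
  rewrite -cabs_ftilde_coefB_sum ?lt0n// /T /sqcoef.
  have := cabs_sqr_le (coef (toC f) i%:Z) (ftilde_coef phi y i%:Z).
  have := cabs_sqr_le (coef (toC f) (- i%:Z)) (ftilde_coef phi y (- i%:Z)).
  rewrite (cabs_distC (coef (toC f) i%:Z)) (cabs_distC (coef (toC f) (- i%:Z))).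
  lra.
have S0 : 0 <= excess y.
  by apply: sumr_ge0 => l _; rewrite le_max lexx orbT.
have DS l : (0 < l <= n)%N -> \sum_(1 <= i < l.+1) D i <= pen phi kappa n l / 4 + excess y.
  move=> /andP[l0 ln]; rewrite -lerBlDl DE.
  have lin : l \in index_iota 1 n.+1 by rewrite mem_index_iota l0 ltnS.
  rewrite /excess (bigD1_seq l lin (iota_uniq _ _))/=.
  apply: ler_wpDr; last by rewrite le_max lexx.
  by apply: sumr_ge0 => i _; rewrite le_max lexx orbT.
pose beta := L2norm (toC f) ^+ 2 - 1.
have B0 l : 0 <= beta - \sum_(1 <= i < l.+1) sqcoef i.
  by rewrite -L2norm_Pi_perp_nat sqr_ge0.
have := oracle_inequality w0 w1 wexp cE (@pen_lb n) F0 D0 TFD FTD DS S0 B0 kn.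
rewrite -L2norm_Pi_perp_nat; apply: le_trans.
rewrite le_eqVlt; apply/orP; left; apply/eqP.
apply: eq_big_nat => l _; congr (_ * _).
rewrite !sum_freqs f0 subrr; congr (_ + _).
  rewrite cabs0_sqr add0r DE; apply: eq_big_nat => i /andP[i0 _].
  exact: cabs_ftilde_coefB_sum.
by rewrite /beta coef0_density// cabsE /= expr1n expr0n addr0 opprD addrA.
Qed.

End risk.

(* [ge0_le_integral] does not apply to the loss, which is not shown to be measurable. *)
Lemma ge0_le_integralT (R : realType) d (T : measurableType d)
    (m : {measure set T -> \bar R}) (f1 f2 : T -> \bar R) :
  (forall t, 0 <= f1 t)%E -> (forall t, f1 t <= f2 t)%E ->
  (\int[m]_t f1 t <= \int[m]_t f2 t)%E.
Proof.
move=> f10 f12; have f20 t : (0 <= f2 t)%E by exact: le_trans (f12 t).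
rewrite !ge0_integralTE//; apply: ereal_sup_le => _ [h hf1 <-].
by exists h => // x; exact: le_trans (f12 x).
Qed.

(** * Expectation of the oracle inequality and choice of the dimension *)

Section expected_risk.
Context {R : realType}.
Variables (f phi : R -> R) (kappa : R).
Hypotheses (df : density_L2 f) (dphi : density_L2 phi).
Hypothesis phi_neq0 : forall j : int, coef (toC phi) j != 0.
Hypothesis kappa84 : 84 <= kappa.
Local Notation g := (cconv f phi).

Lemma measurable_sqdev_sum d (T : measurableType d) (P : probability T R) n k
    (Y : 'I_n -> {RV P >-> R}) : (0 < n)%N ->
  measurable_fun setT (fun t => \sum_(1 <= i < k.+1) sqdev f phi (fun l => Y l t) i).
Proof.
move=> n0; under eq_fun do rewrite sum_sqdev//.
apply: measurable_funM; first exact: measurable_cst.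
apply: measurable_sum => p; apply: measurable_funX.
apply: measurable_sum => l; apply: measurableT_comp => //.
exact: measurable_noise.
Qed.

Lemma expected_loss_oracle : exists2 C, 0 <= C &
  forall (w : nat -> (nat -> R) -> nat -> R), weight_scheme w ->
  forall n k, (0 < k <= n)%N ->
  forall d (T : measurableType d) (P : probability T R) (Y : 'I_n -> {RV P >-> R}),
  iid_with_density g Y ->
  ('E_P[fun t => loss f phi kappa w (fun i => Y i t)] <=
   (10 * pen phi kappa n k + 3 * L2norm (Pi_perp k (toC f)) ^+ 2 + C / n%:R)%:E)%E.
Proof.
have [C C0 H] := expect_excess df dphi kappa84.
(* Five times the expected excess: the terms in [1 / l^2] sum to at most [2 C / n], and the [n]
   terms [C / n^2] to [C / n]. *)
exists (12 + 15 * C) => [|w sw n k kn d T P Y iidY]; first by rewrite addr_ge0// mulr_ge0.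
have n0 : (0 < n)%N by case/andP: kn => k0; exact: leq_trans.
have nR : 0 < n%:R :> R by rewrite ltr0n.
set M := 10 * _ + _.
have M0 : 0 <= M.
  have p0 : 0 <= pen phi kappa n k.
    by apply: le_trans (pen_lb dphi kappa84 kn); rewrite divr_ge0// mulr_ge0.
  by rewrite addr_ge0// mulr_ge0// sqr_ge0.
pose E t l := Num.max (\sum_(1 <= i < l.+1) sqdev f phi (fun j => Y j t) i - pen phi kappa n l / 4) 0.
have E0 t l : 0 <= E t l by rewrite le_max lexx orbT.
have mE l : measurable_fun setT (E ^~ l).
  apply: measurable_maxr; last exact: measurable_cst.
  by apply: measurable_funB; [exact: measurable_sqdev_sum|exact: measurable_cst].
have M12 : 0 <= M + 12 / n%:R by rewrite addr_ge0// divr_ge0.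
rewrite unlock.
apply: (@le_trans _ _ (\int[P]_t ((M + 12 / n%:R)%:E + 5%:E * \sum_(1 <= l < n.+1) (E t l)%:E))%E).
  apply: ge0_le_integralT => t; first by rewrite lee_fin /loss sqr_ge0.
  rewrite sumEFin -EFinM -EFinD lee_fin.
  by apply: le_trans (loss_oracle df dphi phi_neq0 kappa84 (fun i => Y i t) sw kn) _; rewrite /excess -/M; lra.
rewrite ge0_integralD//; last 2 first.
- by move=> t _; rewrite mule_ge0// sume_ge0// => l _; rewrite lee_fin.
- apply: emeasurable_funM; first exact: measurable_cst.
  by apply: emeasurable_sum => l; apply/measurable_EFinP.
rewrite integral_prob_cst ge0_integralZl_EFin//; last 2 first.
- by move=> t _; rewrite sume_ge0// => l _; rewrite lee_fin.
- by apply: emeasurable_sum => l; apply/measurable_EFinP.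
rewrite ge0_integral_sum//; last 2 first.
- by move=> l; apply/measurable_EFinP.
- by move=> l t _; rewrite lee_fin.
apply: (@le_trans _ _ ((M + 12 / n%:R)%:E + 5%:E *
   \sum_(1 <= l < n.+1) (C / n%:R * (l%:R ^+ 2)^-1 + C / n%:R ^+ 2)%:E)%E).
  apply: leeD2l; apply: lee_wpmul2l => //.
  rewrite big_nat [leRHS]big_nat; apply: lee_sum => l ln.
  exact: H.
rewrite sumEFin -EFinM -EFinD lee_fin -addrA lerD2l.
rewrite big_split/= -mulr_sumr sumr_const_nat subn1 /=.
have h1 : C / n%:R * \sum_(1 <= l < n.+1) (l%:R ^+ 2)^-1 <= C / n%:R * 2.
  by rewrite ler_wpM2l ?divr_ge0// sum_inv_sqr_le2.
have h2 : C / n%:R ^+ 2 *+ n = C / n%:R.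
  by rewrite -mulr_natl; field; exact: lt0r_neq0.
rewrite h2 mulrDl; have : 0 <= C / n%:R by rewrite divr_ge0.
rewrite -mulrA; lra.
Qed.

Lemma L2norm_Pi_perp_le k l : (k <= l)%N ->
  L2norm (Pi_perp l (toC f)) ^+ 2 <= L2norm (Pi_perp k (toC f)) ^+ 2.
Proof.
move=> kl; rewrite !(L2norm_Pi_perp_nat df) lerD2l lerN2.
rewrite (@big_cat_nat _ _ _ k.+1 1 l.+1)//= lerDl.
by apply: sumr_ge0 => i _; rewrite addr_ge0 ?sqr_ge0.
Qed.

Lemma rate_a_attained n : (0 < n)%N ->
  exists2 k, (0 < k <= n)%N & rate_a f phi n = rate_term f phi n k.
Proof.
move=> n0; rewrite /rate_a big_nat.
apply: (big_ind (fun x => exists2 k, (0 < k <= n)%N & x = rate_term f phi n k)).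
- by exists 1%N.
- move=> x y [k kn ->] [l ln ->].
  by case: (leP (rate_term f phi n k) (rate_term f phi n l)) => _; [exists k|exists l].
- by move=> k kn; exists k.
Qed.

(** When the denominator of [b_] vanishes, the quotient is 0 by convention; then the left side
    vanishes too, by monotonicity in [k]. *)
Lemma L2norm_Pi_perp_b k : L2norm (Pi_perp k (toC f)) ^+ 2 <=
  b_ k (toC f) ^+ 2 * L2norm (Pi_perp 0 (toC f)) ^+ 2.
Proof.
have [z|nz] := eqVneq (L2norm (Pi_perp 0 (toC f))) 0.
  by apply: le_trans (L2norm_Pi_perp_le (leq0n k)) _; rewrite z expr0n mulr0.
by rewrite /b_ -exprMn divfK.
Qed.

Lemma Lambda_ge0 k : 0 <= Lambda_ phi k.
Proof.
rewrite mulr_ge0//; first by rewrite /lambda_ divr_ge0 ?sqr_ge0.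
exact: le_trans ler01 (vmax_ge1 dphi k).
Qed.

Lemma parametric_case K : b_ K (toC f) = 0 -> exists Cfphi : R,
  forall (w : nat -> (nat -> R) -> nat -> R), weight_scheme w ->
  forall n : nat, (0 < n)%N ->
  forall d (T : measurableType d) (P : probability T R) (Y : 'I_n -> {RV P >-> R}),
  iid_with_density g Y ->
  ('E_P[fun t => loss f phi kappa w (fun i => Y i t)] <= (Cfphi / n%:R)%:E)%E.
Proof.
move=> bK; have [C C0 H] := expected_loss_oracle.
pose m := maxn K 1; pose N := L2norm (toC f) ^+ 2.
have m0 : (0 < m)%N by rewrite leq_max orbT.
have kap0 : 0 <= kappa by apply: le_trans kappa84; rewrite ler0n.
(* The chosen dimension varies with [n] but stays at most [m]; the sum covers all its values at
   once. *)
pose Q := \sum_(1 <= i < m.+1) kappa * i%:R * Lambda_ phi i.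
exists (10 * Q + 3 * N * m%:R + C) => w sw n n0 d T P Y iidY.
have nR : 0 < n%:R :> R by rewrite ltr0n.
pose k := minn n m.
have kn : (0 < k <= n)%N by rewrite leq_min n0 m0 geq_minl.
apply: (le_trans (H w sw n k kn d T P Y iidY)); rewrite lee_fin.
have pk : pen phi kappa n k <= Q / n%:R.
  rewrite /pen ler_wpM2r ?invr_ge0// /Q (bigD1_seq k)/= ?iota_uniq//.
    rewrite lerDl; apply: sumr_ge0 => i _.
    by rewrite mulr_ge0 ?Lambda_ge0// mulr_ge0.
  by rewrite mem_index_iota ltnS geq_minr; case/andP: kn => ->.
have N0 : 0 <= N by exact: sqr_ge0.
have Bk : L2norm (Pi_perp k (toC f)) ^+ 2 <= N * m%:R / n%:R.
  (* For the finitely many [n <= m] the bias is bounded by [N <= N m / n]; for larger [n] the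
     dimension is [m >= K], where the bias vanishes. *)
  have [nm|mn] := leqP n m.
    apply: (@le_trans _ _ N).
      rewrite (L2norm_Pi_perp_nat df) -addrA gerDl -opprD oppr_le0 addr_ge0//.
      by apply: sumr_ge0 => i _; rewrite addr_ge0 ?sqr_ge0.
    by rewrite ler_pdivlMr// ler_wpM2l// ler_nat.
  apply: (@le_trans _ _ 0); last by rewrite divr_ge0// mulr_ge0.
  have Kk : (K <= k)%N by rewrite /k leq_min leq_maxl (leq_trans _ (ltnW mn)) ?leq_maxl.
  apply: le_trans (L2norm_Pi_perp_le Kk) _.
  by apply: le_trans (L2norm_Pi_perp_b K) _; rewrite bK expr0n mul0r.
have -> : (10 * Q + 3 * N * m%:R + C) / n%:R =
  10 * (Q / n%:R) + 3 * (N * m%:R / n%:R) + C / n%:R by ring.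
by rewrite lerD2r; apply: lerD; apply: ler_wpM2l.
Qed.

Lemma nonparametric_case : exists Cfphi : R,
  forall (w : nat -> (nat -> R) -> nat -> R), weight_scheme w ->
  forall n : nat, (0 < n)%N ->
  forall d (T : measurableType d) (P : probability T R) (Y : 'I_n -> {RV P >-> R}),
  iid_with_density g Y ->
  ('E_P[fun t => loss f phi kappa w (fun i => Y i t)] <=
   ((10 * kappa + 3) * Num.max (L2norm (Pi_perp 0 (toC f)) ^+ 2) 1 * rate_a f phi n
     + Cfphi / n%:R)%:E)%E.
Proof.
have [C C0 H] := expected_loss_oracle.
exists C => w sw n n0 d T P Y iidY.
have kap0 : 0 <= kappa by apply: le_trans kappa84; rewrite ler0n.
have [k kn ->] := rate_a_attained n0.
apply: (le_trans (H w sw n k kn d T P Y iidY)); rewrite lee_fin lerD2r.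
set N := L2norm (Pi_perp 0 (toC f)) ^+ 2.
set r := rate_term f phi n k; set M := Num.max N 1.
have r0 : 0 <= r by rewrite /r /rate_term le_max sqr_ge0.
have M1 : 1 <= M by rewrite le_max lexx orbT.
have NM : N <= M by rewrite le_max lexx.
have p1 : pen phi kappa n k <= kappa * (M * r).
  rewrite /pen -mulrA -mulrA; apply: ler_wpM2l => //.
  apply: (@le_trans _ _ r); last by rewrite ler_peMl.
  by rewrite mulrA /r /rate_term !le_max lexx orbT.
have p2 : L2norm (Pi_perp k (toC f)) ^+ 2 <= M * r.
  apply: (le_trans (L2norm_Pi_perp_b k)); rewrite mulrC.
  by apply: ler_pM => //; rewrite ?sqr_ge0// /r /rate_term le_max lexx.
have -> : (10 * kappa + 3) * M * r = 10 * (kappa * (M * r)) + 3 * (M * r) by ring.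
by apply: lerD; apply: ler_wpM2l.
Qed.

End expected_risk.

Theorem proposition2p4 (R : realType) (kappa : R) (hkappa : 84 <= kappa) :
  exists2 C : R, 0 < C &
  forall (f phi : R -> R), density_L2 f -> density_L2 phi ->
  (forall j : int, coef (toC phi) j != 0) ->
  (forall K : nat,
     0 < b_pred K (toC f) <= 1 -> b_ K (toC f) = 0 ->
     exists Cfphi : R,
     forall (w : nat -> (nat -> R) -> nat -> R), weight_scheme w ->
     forall n : nat, (0 < n)%N ->
     forall (d : measure_display) (T : measurableType d) (P : probability T R)
       (Y : 'I_n -> {RV P >-> R}),
     iid_with_density (cconv f phi) Y ->
     ('E_P[fun t => loss f phi kappa w (fun i => Y i t)] <=
      (C * L2norm (Pi_perp 0 (toC f)) ^+ 2 *
         Num.max (n%:R)^-1 (exp_term f phi (k_star f phi kappa K n))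
       + Cfphi / n%:R)%:E)%E) /\
  ((forall k : nat, (0 < k)%N -> 0 < b_ k (toC f)) ->
     exists Cfphi : R,
     forall (w : nat -> (nat -> R) -> nat -> R), weight_scheme w ->
     forall n : nat, (0 < n)%N ->
     forall (d : measure_display) (T : measurableType d) (P : probability T R)
       (Y : 'I_n -> {RV P >-> R}),
     iid_with_density (cconv f phi) Y ->
     ('E_P[fun t => loss f phi kappa w (fun i => Y i t)] <=
      (C * Num.max (L2norm (Pi_perp 0 (toC f)) ^+ 2) 1 * rate_a f phi n
       + Cfphi / n%:R)%:E)%E).
Proof.
have kap0 : 0 <= kappa by apply: le_trans hkappa; rewrite ler0n.
have C0 : 0 < 10 * kappa + 3 by rewrite ltr_wpDl// mulr_ge0.
(* In the oracle bound [10 pen + 3 bias], the penalty is at most [kappa] times the rate. *)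
exists (10 * kappa + 3) => // f phi df dphi phi0; split=> [K _ bK|_].
  have [C H] := parametric_case df dphi phi0 hkappa bK.
  exists C => w sw n n0 d T P Y iidY; apply: le_trans (H w sw n n0 d T P Y iidY) _.
  rewrite lee_fin lerDr mulr_ge0// ?le_max ?invr_ge0 ?ler0n//.
  by rewrite mulr_ge0 ?sqr_ge0// ltW.
exact: nonparametric_case.
Qed.
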